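(* Let $(V,Y(\cdot,(x,\varphi)),\mathbf{1},\tau)$ be an ($N=1$ Neveu-Schwarz) vertex operator superalgebra over $\bigwedge_*$ with odd formal variables. Let $u,v,w\in V$ and $v'\in V'$. (a) (rationality of iterates) The formal series $\langle v',Y(Y(u,(x_0,\varphi_1-\varphi_2))v,(x_2,\varphi_2))w\rangle$, which involves only finitely many negative powers of $x_0$ and only finitely many positive powers of $x_2$, lies in the image of the map $\iota_{20}$: $$\langle v',Y(Y(u,(x_0,\varphi_1-\varphi_2))v,(x_2,\varphi_2))w\rangle=\iota_{20}h(x_0,\varphi_1-\varphi_2,x_2,\varphi_2),$$ where the (uniquely determined) element $h\in\bigwedge_*[x_0,\varphi_1,x_2,\varphi_2]_{S'}$ is of the form $$h(x_0,\varphi_1-\varphi_2,x_2,\varphi_2)=\frac{k(x_0,\varphi_1-\varphi_2,x_2,\varphi_2)}{x_0^rx_2^s(x_0+x_2-\varphi_1\varphi_2)^t}$$ for some $k\in\bigwedge_*[x_0,\varphi_1,x_2,\varphi_2]$ and $r,s,t\in\mathbb{Z}$. (b) The formal series $\langle v',Y(u,(x_0+x_2+\varphi_1\varphi_2,\varphi_1))Y(v,(x_2,\varphi_2))w\rangle$, which involves only finitely many negative powers of $x_2$ and only finitely many positive powers of $x_0$, lies in the image of $\iota_{02}$, and in fact, with the same $h$, $$\langle v',Y(u,(x_0+x_2+\varphi_1\varphi_2,\varphi_1))Y(v,(x_2,\varphi_2))w\rangle=\iota_{02}h(x_0,\varphi_1-\varphi_2,x_2,\varphi_2).$$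
   Context: **Grassmann algebras and conventions.** $\bigwedge_*$ denotes either $\bigwedge_L$, the exterior algebra over $\mathbb{C}$ of an $L$-dimensional complex vector space $U_L$ ($L\in\mathbb{N}$, $U_L\subset U_{L+1}$), or the direct limit $\bigwedge_\infty$ of the $\bigwedge_L$; it is $\mathbb{Z}_2$-graded, $\bigwedge_*=\bigwedge_*^0\oplus\bigwedge_*^1$. For $a\in\bigwedge_*$, its body $a_B\in\mathbb{C}$ is its component of exterior degree $0$. For a $\mathbb{Z}_2$-graded space, $\eta(v)=i$ for $v$ homogeneous of sign $i\in\{0,1\}$. $[A,B]$ denotes the supercommutator $AB-(-1)^{\eta(A)\eta(B)}BA$ for homogeneous $A,B$. Even formal variables ($x,x_0,x_1,x_2$) commute with everything. Odd formal variables ($\varphi,\varphi_1,\varphi_2$) commute with even variables and with even elements of $\bigwedge_*$ and even operators, anticommute with each other and with odd elements of $\bigwedge_*$ and odd operators, and square to zero. $\delta(x)=\sum_{n\in\mathbb{Z}}x^n$. Expressions such as $(x_1-x_2)^n$ or $(x_0+x_2)^n$, $n\in\mathbb{Z}$, inside vertex operators and delta functions are expanded in nonnegative powers of the second variable, and functions of even and odd variables are expanded about the even variables: $(x_1-x_2-\varphi_1\varphi_2)^n=(x_1-x_2)^n-n\varphi_1\varphi_2(x_1-x_2)^{n-1}$, so $\delta\left(\frac{x_1-x_2-\varphi_1\varphi_2}{x_0}\right)=\sum_{n\in\mathbb{Z}}(x_1-x_2-\varphi_1\varphi_2)^nx_0^{-n}$, and similarly for other such expressions. $Y$ is extended linearly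 to series with formal-variable coefficients. **Vertex operator superalgebra over $\bigwedge_*$ with odd formal variables.** This is a $\frac12\mathbb{Z}$-graded (by weight) $\bigwedge_*$-module, also $\mathbb{Z}_2$-graded (by sign), $V=\coprod_{n\in\frac12\mathbb{Z}}V_{(n)}=\coprod_{n}V^0_{(n)}\oplus\coprod_nV^1_{(n)}=V^0\oplus V^1$, with $\dim V_{(n)}<\infty$ for all $n\in\frac12\mathbb{Z}$ and $V_{(n)}=0$ for $n$ sufficiently small (positive energy), equipped with a linear map $V\otimes V\to V[[x,x^{-1}]][\varphi]$, equivalently $V\to(\mathrm{End}\,V)[[x,x^{-1}]][\varphi]$, $v\mapsto Y(v,(x,\varphi))=\sum_{n\in\mathbb{Z}}v_nx^{-n-1}+\varphi\sum_{n\in\mathbb{Z}}v_{n-\frac12}x^{-n-1}$, where $v_n\in(\mathrm{End}\,V)^{\eta(v)}$ and $v_{n-\frac12}\in(\mathrm{End}\,V)^{(\eta(v)+1)\bmod 2}$ for $v$ of homogeneous sign, and with distinguished vectors $\mathbf{1}\in V^0_{(0)}$ (vacuum) and $\tau\in V^1_{(3/2)}$ (Neveu-Schwarz element), such that for $u,v\in V$: (1) (truncation) $u_nv=0$ for $n\in\frac12\mathbb{Z}$ sufficiently large; (2) $Y(\mathbf{1},(x,\varphi))=1$; (3) (creation) $Y(v,(x,\varphi))\mathbf{1}\in V[[x]][\varphi]$ and $\lim_{(x,\varphi)\to0}Y(v,(x,\varphi))\mathbf{1}=v$; (4) (Jacobi identity) for $u,v$ of homogeneous sign, $$x_0^{-1}\delta\left(\tfrac{x_1-x_2-\varphi_1\varphi_2}{x_0}\right)Y(u,(x_1,\varphi_1))Y(v,(x_2,\varphi_2))-(-1)^{\eta(u)\eta(v)}x_0^{-1}\delta\left(\tfrac{x_2-x_1+\varphi_1\varphi_2}{-x_0}\right)Y(v,(x_2,\varphi_2))Y(u,(x_1,\varphi_1))$$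 $$=x_2^{-1}\delta\left(\tfrac{x_1-x_0-\varphi_1\varphi_2}{x_2}\right)Y(Y(u,(x_0,\varphi_1-\varphi_2))v,(x_2,\varphi_2));$$ (5) (Neveu-Schwarz relations) with $G(n+\frac12)=\tau_{n+1}$ and $2L(n)=\tau_{n+\frac12}$ for $n\in\mathbb{Z}$, one has for $m,n\in\mathbb{Z}$: $[L(m),L(n)]=(m-n)L(m+n)+\frac1{12}(m^3-m)\delta_{m+n,0}(\mathrm{rank}\,V)$, $[G(m+\frac12),L(n)]=(m-\frac{n-1}{2})G(m+n+\frac12)$, $[G(m+\frac12),G(n-\frac12)]=2L(m+n)+\frac13(m^2+m)\delta_{m+n,0}(\mathrm{rank}\,V)$, where $\mathrm{rank}\,V\in\mathbb{C}$; (6) $L(0)v=nv$ for $n\in\frac12\mathbb{Z}$ and $v\in V_{(n)}$; (7) ($G(-\frac12)$-derivative property) $\left(\frac{\partial}{\partial\varphi}+\varphi\frac{\partial}{\partial x}\right)Y(v,(x,\varphi))=Y(G(-\tfrac12)v,(x,\varphi))$. **Graded dual.** $V_{(n)}^*=\mathrm{Hom}_{\bigwedge_*}(V_{(n)},\bigwedge_* )$, $V'=\coprod_{n\in\frac12\mathbb{Z}}V_{(n)}^*$ is the graded dual, and $\langle\cdot,\cdot\rangle$ is the natural pairing of $V'$ with $\prod_nV_{(n)}$, applied coefficientwise to formal series (with the odd formal variables written to the left of the coefficients). **Rational superfunctions and expansion maps.** $\bigwedge_*[x_0,\varphi_1,x_2,\varphi_2]_{S'}$ is the ring obtained from $\bigwedge_*[x_0,x_2][\varphi_1,\varphi_2]$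 by inverting the set $S'$ of all $a_0x_0+a_2x_2+a_{12}\varphi_1\varphi_2$ with $a_0,a_2,a_{12}\in\bigwedge_*^0$ and $(a_0)_B,(a_2)_B$ not both zero. Expanding about the even variables, $\frac{1}{a_0x_0+a_2x_2+a_{12}\varphi_1\varphi_2}=\frac{1}{a_0x_0+a_2x_2}-\frac{a_{12}\varphi_1\varphi_2}{(a_0x_0+a_2x_2)^2}$. The map $\iota_{20}$ sends an element of this ring to a formal series in $\bigwedge_*[[x_0,x_0^{-1},x_2,x_2^{-1}]][\varphi_1,\varphi_2]$ by first expanding in the odd variables as just described and then expanding each term as a series containing at most finitely many negative powers of $x_0$ (binomial expansion of negative powers of linear polynomials involving both variables). The map $\iota_{02}$ is defined the same way but with at most finitely many negative powers of $x_2$. $h(x_0,\varphi_1-\varphi_2,x_2,\varphi_2)$ denotes the result of substituting $\varphi_1-\varphi_2$ for $\varphi_1$ in $h$ (note $\varphi_1\varphi_2=(\varphi_1-\varphi_2)\varphi_2$). *)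

(* Defs.v *)
From HB Require Import structures.
From mathcomp Require Import all_boot all_order all_algebra finmap complex.
From mathcomp Require Import ring.
From mathcomp Require Import boolp classical_sets functions fsbigop reals.

Set Implicit Arguments.
Unset Strict Implicit.
Unset Printing Implicit Defensive.

Import Order.TTheory GRing.Theory Num.Theory.

Local Open Scope ring_scope.

(* Let U have basis z_0, z_1, z_2, ...  A family a : {fset nat} -> K stands
   for the (a priori infinite) sum of the a(S) z_S, where
   z_S = z_{i1} /\ ... /\ z_{ik} for S = {i1 < ... < ik}.  These families form
   a ring in which z_S z_T = (-1)^(ginv S T) z_{S u T} for disjoint S and T,
   and z_S z_T = 0 otherwise.  The Grassmann algebras are cut out of it below
   by a condition on supports. *)
Definition gfun (K : comNzRingType) := {fset nat} -> K.

HB.instance Definition _ (K : comNzRingType) :=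
  GRing.Zmodule.copy (gfun K) ({fset nat} -> K).

Definition ginv (S T : {fset nat}) : nat :=
  (\sum_(i <- S) \sum_(j <- T) (j < i)%N)%N.

Definition gone (K : comNzRingType) : gfun K := fun S => (S == fset0)%:R.

Definition gmul (K : comNzRingType) (a b : gfun K) : gfun K := fun S =>
  \sum_(T <- fpowerset S) (-1) ^+ ginv T (S `\` T)%fset * (a T * b (S `\` T)%fset).

Section GrassmannRing.

Variable K : comNzRingType.
Implicit Types (a b c : gfun K) (S T U : {fset nat}).

Lemma ginvUl S T U : [disjoint S & T]%fset ->
  ginv (S `|` T)%fset U = (ginv S U + ginv T U)%N.
Proof.
move=> dST; rewrite /ginv -big_cat /=; apply: perm_big; apply: uniq_perm.
- exact: fset_uniq.
- rewrite cat_uniq !fset_uniq andbT /=; apply/hasPn => x xT.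
  by apply/negP => xS; have := fdisjointP dST x xS; rewrite xT.
by move=> x; rewrite mem_cat in_fsetE.
Qed.

Lemma ginvUr S T U : [disjoint T & U]%fset ->
  ginv S (T `|` U)%fset = (ginv S T + ginv S U)%N.
Proof.
move=> dTU; rewrite /ginv -big_split /=; apply: eq_bigr => i _.
rewrite -big_cat /=; apply: perm_big; apply: uniq_perm.
- exact: fset_uniq.
- rewrite cat_uniq !fset_uniq andbT /=; apply/hasPn => x xU.
  by apply/negP => xT; have := fdisjointP dTU x xT; rewrite xU.
by move=> x; rewrite mem_cat in_fsetE.
Qed.

Lemma ginv0l S : ginv fset0 S = 0%N.
Proof. by rewrite /ginv big_seq_fset0. Qed.

Lemma ginv0r S : ginv S fset0 = 0%N.
Proof. by rewrite /ginv big1 // => i _; rewrite big_seq_fset0. Qed.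

Lemma gmul1l : left_id (gone K) (@gmul K).
Proof.
move=> a; apply/funext => S; rewrite /gmul.
rewrite (bigD1_seq fset0) ?fset_uniq ?fpowersetE ?fsub0set //=.
rewrite big1 ?addr0; first by rewrite fsetD0 ginv0l /gone eqxx !mul1r.
by move=> T /negPf nT; rewrite /gone nT mul0r mulr0.
Qed.

Lemma gmul1r : right_id (gone K) (@gmul K).
Proof.
move=> a; apply/funext => S; rewrite /gmul.
rewrite (bigD1_seq S) ?fset_uniq ?fpowersetE //=.
rewrite big_seq_cond big1 ?addr0.
  by rewrite fsetDv ginv0r /gone eqxx mulr1 mul1r.
move=> T /andP[]; rewrite fpowersetE => sTS nTS.
rewrite /gone fsetD_eq0; case: (boolP (S `<=` T)%fset) => [sST|_].
  by rewrite eqEfsubset sTS sST in nTS.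
by rewrite mulr0 mulr0.
Qed.

Lemma gmulDl : left_distributive (@gmul K) +%R.
Proof.
move=> a b c; apply/funext => S; rewrite /gmul -[RHS]big_split /=.
by apply: eq_bigr => T _; rewrite mulrDl mulrDr.
Qed.

Lemma gmulDr : right_distributive (@gmul K) +%R.
Proof.
move=> a b c; apply/funext => S; rewrite /gmul -[RHS]big_split /=.
by apply: eq_bigr => T _; rewrite !mulrDr.
Qed.

Lemma gmulA : associative (@gmul K).
Proof.
move=> a b c; apply/funext => S; rewrite /gmul.
under eq_bigr do rewrite mulr_sumr mulr_sumr.
under [RHS]eq_bigr do rewrite mulr_suml mulr_sumr.
pose g X T := (-1) ^+ ginv X (S `\` X)%fset * ((-1) ^+ ginv T (X `\` T)%fset *
  (a T * b (X `\` T)%fset) * c (S `\` X)%fset).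
transitivity (\sum_(X <- fpowerset S) \sum_(T <- fpowerset S | (T `<=` X)%fset) g X T); last first.
  rewrite big_seq [RHS]big_seq; apply: eq_bigr => X; rewrite fpowersetE => sXS.
  rewrite -big_filter; apply: perm_big; apply: uniq_perm.
  - by rewrite filter_uniq ?fset_uniq.
  - exact: fset_uniq.
  move=> T; rewrite mem_filter !fpowersetE andb_idr // => sTX.
  exact: fsubset_trans sTX sXS.
rewrite (exchange_big_dep xpredT) //= big_seq [RHS]big_seq.
apply: eq_bigr => T; rewrite fpowersetE => sTS.
rewrite -[RHS]big_filter.
transitivity (\sum_(X <- [seq (T `|` U)%fset | U <- fpowerset (S `\` T)%fset]) g X T).
  rewrite big_map big_seq [RHS]big_seq; apply: eq_bigr => U.
  rewrite fpowersetE fsubsetD => /andP[sUS dUT].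
  have dTU : [disjoint T & U]%fset by rewrite fdisjoint_sym.
  have eU : ((T `|` U) `\` T = U)%fset.
    by rewrite fsetDUl fsetDv fset0U; apply/fsetDidPl.
  have eW : ((S `\` T) `\` U = S `\` (T `|` U))%fset by rewrite fsetDDl.
  rewrite /g eU eW ginvUl //.
  have -> : ginv T (S `\` T)%fset = (ginv T U + ginv T (S `\` (T `|` U))%fset)%N.
    rewrite -eW -ginvUr; last by apply/fdisjointP => x xU; rewrite inE xU.
    congr (ginv T _); apply/fsetP => x; rewrite !inE.
    by case: (boolP (x \in U)) => [xU|//]; rewrite (fdisjointP dUT) ?(fsubsetP sUS).
  by rewrite !exprD; ring.
apply: perm_big; apply: uniq_perm.
- rewrite map_inj_in_uniq ?fset_uniq // => U W.
  rewrite !fpowersetE !fsubsetD => /andP[_ dU] /andP[_ dW] eUW.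
  have: ((T `|` U) `\` T = (T `|` W) `\` T)%fset by rewrite eUW.
  by rewrite !fsetDUl fsetDv !fset0U (fsetDidPl _ _ dU) (fsetDidPl _ _ dW).
- by rewrite filter_uniq ?fset_uniq.
move=> X; rewrite mem_filter fpowersetE; apply/mapP/andP => [[U]|[sTX sXS]].
  rewrite fpowersetE fsubsetD => /andP[sUS _] ->.
  by rewrite fsubsetUl fsubUset sTS sUS.
exists (X `\` T)%fset; first by rewrite fpowersetE fsetSD.
apply/fsetP => x; rewrite !inE; case: (boolP (x \in T)) => //= xT.
exact: (fsubsetP sTX).
Qed.

Lemma gone_neq0 : gone K != 0.
Proof.
apply/eqP => /(congr1 (fun f : gfun K => f fset0)).
by rewrite /gone eqxx; apply/eqP/oner_neq0.
Qed.

End GrassmannRing.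

HB.instance Definition _ (K : comNzRingType) :=
  GRing.Zmodule_isNzRing.Build (gfun K)
    (@gmulA K) (@gmul1l K) (@gmul1r K) (@gmulDl K) (@gmulDr K) (@gone_neq0 K).

Definition gsupp_in (K : comNzRingType) (n : nat) (a : gfun K) : Prop :=
  forall S, a S != 0 -> forall i, i \in S -> (i < n)%N.

(* [Some n] selects the exterior algebra on z_0, ..., z_{n-1};
   [None] selects the union of these algebras over all n *)
Definition gsupp (K : comNzRingType) (L : option nat) : {pred gfun K} :=
  fun a => if L is Some n then `[< gsupp_in n a >]
           else `[< exists n, gsupp_in n a >].

Arguments gsupp K L : clear implicits.

Section GrassmannSupport.

Variable K : comNzRingType.
Implicit Types (a b : gfun K).

Lemma gsupp_inW n m a : (n <= m)%N -> gsupp_in n a -> gsupp_in m a.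
Proof. by move=> nm sa S aS i iS; apply: leq_trans (sa S aS i iS) nm. Qed.

Lemma gsupp_inB n a b : gsupp_in n a -> gsupp_in n b -> gsupp_in n (a - b).
Proof.
move=> sa sb S; case: (eqVneq (a S) 0) => [a0|aS _]; last exact: sa.
case: (eqVneq (b S) 0) => [b0|bS _]; last exact: sb.
by rewrite -[(a - b) S]/(a S - b S) a0 b0 subr0 eqxx.
Qed.

Lemma gsupp_in1 n : gsupp_in n (1 : gfun K).
Proof.
move=> S; rewrite -[(1 : gfun K) S]/((S == fset0)%:R : K).
by case: (eqVneq S fset0) => [->|_]; rewrite ?eqxx // => _ i; rewrite inE.
Qed.

Lemma gsupp_inM n a b : gsupp_in n a -> gsupp_in n b -> gsupp_in n (a * b).
Proof.
move=> sa sb S nz i iS; apply: contra_neqT nz => ni.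
rewrite -[(a * b) S]/(gmul a b S) /gmul big1 // => T _.
have [iT|iT] := boolP (i \in T).
  have [->|aT] := eqVneq (a T) 0; first by rewrite mul0r mulr0.
  by rewrite (sa T aT i iT) in ni.
have [->|bT] := eqVneq (b (S `\` T)%fset) 0; first by rewrite !mulr0.
by rewrite (sb _ bT i) ?inE ?iT in ni.
Qed.

Lemma gsupp_subring L : GRing.subring_closed (gsupp K L).
Proof.
case: L => [n|]; split; rewrite /in_mem /=.
- exact/asboolP/gsupp_in1.
- by move=> a b /asboolP sa /asboolP sb; apply/asboolP/gsupp_inB.
- by move=> a b /asboolP sa /asboolP sb; apply/asboolP/gsupp_inM.
- by apply/asboolP; exists 0%N; apply: gsupp_in1.
- move=> a b /asboolP[n sa] /asboolP[m sb]; apply/asboolP; exists (maxn n m).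
  by apply: gsupp_inB; [apply: gsupp_inW sa | apply: gsupp_inW sb];
    rewrite ?leq_maxl ?leq_maxr.
- move=> a b /asboolP[n sa] /asboolP[m sb]; apply/asboolP; exists (maxn n m).
  by apply: gsupp_inM; [apply: gsupp_inW sa | apply: gsupp_inW sb];
    rewrite ?leq_maxl ?leq_maxr.
Qed.

End GrassmannSupport.

HB.instance Definition _ (K : comNzRingType) (L : option nat) :=
  GRing.isSubringClosed.Build (gfun K) (gsupp K L) (@gsupp_subring K L).

Record grassmann (K : comNzRingType) (L : option nat) := Grassmann {
  gval : gfun K;
  gvalP : gval \in gsupp K L }.

HB.instance Definition _ (K : comNzRingType) (L : option nat) :=
  [isSub for @gval K L].
HB.instance Definition _ (K : comNzRingType) (L : option nat) :=
  [Choice of grassmann K L by <:].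
HB.instance Definition _ (K : comNzRingType) (L : option nat) :=
  [SubChoice_isSubNzRing of grassmann K L by <:].

Section GrassmannInverse.

Variables (K : comNzRingType) (L : option nat).
Implicit Types a b : grassmann K L.

Definition ginvertible a b := b * a = 1 /\ a * b = 1.

Definition gunit : pred (grassmann K L) :=
  fun a => `[< exists b, ginvertible a b >].

Definition ginverse a : grassmann K L :=
  if pselect (exists b, ginvertible a b) is left e then projT1 (cid e) else a.

Lemma ginverseP a : gunit a -> ginvertible a (ginverse a).
Proof.
by move=> /asboolP e; rewrite /ginverse; case: pselect => // e'; case: cid.
Qed.

Lemma gmulVr : {in gunit, left_inverse 1 ginverse *%R}.
Proof. by move=> a /ginverseP[]. Qed.

Lemma gdivrr : {in gunit, right_inverse 1 ginverse *%R}.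
Proof. by move=> a /ginverseP[]. Qed.

Lemma gunitrP a b : b * a = 1 /\ a * b = 1 -> gunit a.
Proof. by move=> ab; apply/asboolP; exists b. Qed.

Lemma ginvr_out : {in [predC gunit], ginverse =1 id}.
Proof.
by move=> a /asboolP na; rewrite /ginverse; case: pselect => // e.
Qed.

End GrassmannInverse.

HB.instance Definition _ (K : comNzRingType) (L : option nat) :=
  GRing.NzRing_hasMulInverse.Build (grassmann K L)
    (@gmulVr K L) (@gdivrr K L) (@gunitrP K L) (@ginvr_out K L).

Section GrassmannGrading.

Variables (K : comNzRingType) (L : option nat).

Lemma gscalar_subproof (c : K) :
  (fun S : {fset nat} => if S == fset0 then c else 0) \in gsupp K L.
Proof.
have sc n : gsupp_in n (fun S : {fset nat} => if S == fset0 then c else 0).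
  move=> S; have [->|_] := eqVneq S fset0; last by rewrite eqxx.
  by move=> _ i; rewrite inE.
by case: L => [n|]; rewrite /in_mem /=; apply/asboolP; [|exists 0%N]; apply: sc.
Qed.

Definition gscalar (c : K) : grassmann K L := Grassmann (gscalar_subproof c).

Lemma gpar_subproof (a : grassmann K L) :
  (fun S : {fset nat} => (-1) ^+ #|` S| * gval a S) \in gsupp K L.
Proof.
have sc n : gsupp_in n (gval a) -> gsupp_in n (fun S => (-1) ^+ #|` S| * gval a S).
  move=> sa S; have [->|/sa //] := eqVneq (gval a S) 0.
  by rewrite mulr0 eqxx.
have := gvalP a; case: L a sc => [n|] a sc; rewrite /in_mem /=.
  by move=> /asboolP sa; apply/asboolP/sc.
by move=> /asboolP[n sa]; apply/asboolP; exists n; apply: sc.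
Qed.

(* the parity involution: a0 + a1 |-> a0 - a1 *)
Definition gpar (a : grassmann K L) : grassmann K L :=
  Grassmann (gpar_subproof a).

Definition gsign (i : bool) (a : grassmann K L) : Prop :=
  forall S, gval a S != 0 -> odd #|` S| = i.

Definition gbody (a : grassmann K L) : K := gval a fset0.

End GrassmannGrading.

Definition X0 : 'I_3 := @Ordinal 3 0 isT.
Definition X1 : 'I_3 := @Ordinal 3 1 isT.
Definition X2 : 'I_3 := @Ordinal 3 2 isT.

Definition expo := {ffun 'I_3 -> int}.
Definition xexp (i : 'I_3) (n : int) : expo := [ffun j => if j == i then n else 0].

(* (b1, b2) stands for phi_1^b1 phi_2^b2, in this order *)
Definition oexp := (bool * bool)%type.
Definition oodd (b : oexp) : bool := b.1 (+) b.2.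

(* phi^p.1 phi^p.2 = (-1)^(osgn p) phi^b exactly when osplit p b;
   phi^p.1 phi^p.2 = 0 if there is no such b *)
Definition osplit (p : oexp * oexp) (b : oexp) : bool :=
  [&& ~~ (p.1.1 && p.2.1), ~~ (p.1.2 && p.2.2),
      b.1 == p.1.1 || p.2.1 & b.2 == p.1.2 || p.2.2].
Definition osgn (p : oexp * oexp) : bool := p.1.2 && p.2.1.

(* f : series M stands for the sum of the x^e phi^b (f e b), with the odd
   variables to the left of the coefficients *)
Definition series (M : zmodType) := expo -> oexp -> M.

HB.instance Definition _ (M : zmodType) :=
  GRing.Zmodule.copy (series M) (expo -> oexp -> M).

Definition mono (M : zmodType) (e : expo) (b : oexp) (c : M) : series M :=
  fun e' b' => if (e' == e) && (b' == b) then c else 0.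

Definition const (M : zmodType) (c : M) : series M := mono 0 (false, false) c.

Definition smap (M N : zmodType) (f : M -> N) (g : series M) : series N :=
  fun e b => f (g e b).

(* Coefficientwise sum of a family.  The library's sum over [set: T] has the
   junk value 0 on families with infinite support; it is only used here, and
   in smul, on families that are locally finite by truncation. *)
Definition ssum (M : zmodType) (T : choiceType) (F : T -> series M) : series M :=
  fun e b => \sum_(t \in [set: T]%classic) F t e b.

Definition dx (M : zmodType) (i : 'I_3) (f : series M) : series M :=
  fun e b => f (e + xexp i 1) b *~ (e i + 1).
Definition dphi1 (M : zmodType) (f : series M) : series M :=
  fun e b => if b.1 then 0 else f e (true, b.2).

(* the substitution phi_1 |-> phi_1 - phi_2, which fixes phi_1 phi_2 *)
Definition ssubst (M : zmodType) (f : series M) : series M :=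
  fun e b => if b == (false, true) then f e b - f e (true, false) else f e b.

Section FormalCalculus.

Variables (R : realType) (L : option nat).
Local Notation C := R[i].
Local Notation Lam := (grassmann C L).
Local Notation scal c := (gscalar L (c : C)).

Definition gparn (i : bool) (a : Lam) : Lam := if i then gpar a else a.

(* phi^b1 a phi^b2 m = phi^b1 phi^b2 (gparn (oodd b2) a) m *)
Definition smul (V : lmodType Lam) (f : series Lam) (g : series V) : series V :=
  fun e b => \sum_(d \in [set: expo]%classic) \sum_(p : oexp * oexp | osplit p b)
    ((-1) ^+ osgn p * gparn (oodd p.2) (f d p.1)) *: g (e - d) p.2.

Definition sprod (f g : series Lam) : series Lam := @smul Lam^o f g.

Local Notation "f ** g" := (sprod f g) (at level 40, left associativity).

Definition phi1 : series Lam := mono 0 (true, false) 1.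
Definition phi2 : series Lam := mono 0 (false, true) 1.
Definition phi12 : series Lam := mono 0 (true, true) 1.

Definition xpow (i : 'I_3) (n : int) : series Lam :=
  mono (xexp i n) (false, false) 1.
Definition xpowN (i : 'I_3) (n : int) : series Lam :=
  mono (xexp i n) (false, false) (scal ((-1) ^ n)).

Definition binz (n : int) (k : nat) : C :=
  (\prod_(j < k) (n%:~R - j%:R)) / (k`!)%:R.

(* (x_i + c x_j)^n, in nonnegative powers of x_j *)
Definition xbin (i j : 'I_3) (c : C) (n : int) : series Lam :=
  ssum (fun k : nat => mono (xexp i (n - k%:Z) + xexp j k%:Z) (false, false)
                         (scal (binz n k * c ^+ k))).

(* (x_i + c x_j + d phi_1 phi_2)^n *)
Definition xobin (i j : 'I_3) (c d : C) (n : int) : series Lam :=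
  xbin i j c n + const (scal (d * n%:~R)) ** (phi12 ** xbin i j c (n - 1)).

(* delta (A / B), the powers of A and B being given by P and Q *)
Definition sdelta (P Q : int -> series Lam) : series Lam :=
  ssum (fun n : int => P n ** Q (- n)).

(* A (1/2)Z-grading by weight and a Z_2-grading by sign on a module, given by
   their projections.  Weights are doubled: wt n is the projection onto
   V_(n/2). *)
Record bigrading (V : lmodType Lam) := Bigrading {
  wt : int -> V -> V;
  sg : bool -> V -> V;
  wtD : forall n v w, wt n (v + w) = wt n v + wt n w;
  wtZ : forall n a v, wt n (a *: v) = a *: wt n v;
  wt_orth : forall m n v, wt m (wt n v) = if m == n then wt n v else 0;
  wt_sum : forall v, exists2 s : seq int, uniq s & v = \sum_(n <- s) wt n v;
  sgD : forall i v w, sg i (v + w) = sg i v + sg i w;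
  sgZ : forall i j a v, gsign j a -> sg i (a *: v) = a *: sg (i (+) j) v;
  sg_orth : forall i j v, sg i (sg j v) = if i == j then sg j v else 0;
  sg_sum : forall v, v = sg false v + sg true v;
  wt_sg : forall n i v, wt n (sg i v) = sg i (wt n v) }.

Section VertexOperators.

Variables (V : lmodType Lam) (G : bigrading V).

Definition has_wt (n : int) (v : V) : Prop := wt G n v = v.
Definition has_sg (i : bool) (v : V) : Prop := sg G i v = v.

Definition vpar (i : bool) (v : V) : V :=
  if i then sg G false v - sg G true v else v.

(* A phi^b c = phi^b (P^b A P^b) c, with P the parity involution of V: even
   operators commute and odd operators anticommute with the odd variables *)
Definition opact (A : V -> V) (g : series V) : series V :=
  fun e b => vpar (oodd b) (A (vpar (oodd b) (g e b))).

Variable mode : V -> int -> V -> V.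

(* Y(u, (A, psi)) applied to g, where P gives the powers of the even
   expression A and psi is odd.  Mode indices are doubled: mode u k is
   u_(k/2). *)
Definition Yop (P : int -> series Lam) (psi : series Lam) (u : V)
    (g : series V) : series V :=
  ssum (fun n : int =>
    smul (P (- n - 1)) (opact (mode u (2 * n)) g) +
    smul psi (smul (P (- n - 1)) (opact (mode u (2 * n - 1)) g))).

(* Y(f, (A, psi)) w for a series f with coefficients in V *)
Definition Yext (P : int -> series Lam) (psi : series Lam) (f : series V)
    (w : V) : series V :=
  ssum (fun q : expo * oexp =>
    smul (mono q.1 q.2 1) (Yop P psi (f q.1 q.2) (const w))).

Definition Y1 (u : V) : series V -> series V := Yop (xpow X1) phi1 u.
Definition Y2 (u : V) : series V -> series V := Yop (xpow X2) phi2 u.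

(* Y(Y(u, (x_0, phi_1 - phi_2))v, (x_2, phi_2))w *)
Definition Yiter (u v w : V) : series V :=
  Yext (xpow X2) phi2 (Yop (xpow X0) (phi1 - phi2) u (const v)) w.

(* Y(u, (x_0 + x_2 + phi_1 phi_2, phi_1))Y(v, (x_2, phi_2))w *)
Definition Yprod (u v w : V) : series V :=
  Yop (xobin X0 X2 1 1) phi1 u (Y2 v (const w)).

Definition scomm (i j : bool) (A B : V -> V) (v : V) : V :=
  A (B v) - (-1) ^+ (i && j) *: B (A v).

End VertexOperators.

Record ns_vosa (V : lmodType Lam) := NSVosa {
  grading :> bigrading V;
  mode : V -> int -> V -> V;
  vac : V;
  tau : V;
  rank : C;
  (* G(n + 1/2) = tau_(n+1) and 2 L(n) = tau_(n+1/2) *)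
  Gop := fun n : int => mode tau (2 * (n + 1));
  Lop := fun (n : int) (v : V) => scal 2^-1 *: mode tau (2 * n + 1) v;
  (* finite dimension over a Grassmann algebra, which is not a field, is read
     as finite generation *)
  wt_fg : forall n, exists (d : nat) (g : 'I_d -> V),
    (forall j, has_wt grading n (g j)) /\
    (forall v, has_wt grading n v ->
       exists c : 'I_d -> Lam, v = \sum_j c j *: g j);
  wt_low : exists N : int, forall (n : int) v, n < N -> has_wt grading n v -> v = 0;
  (* The vertex operator map is even and linear, elements of the Grassmann
     algebra passing odd variables and operators with the usual sign. *)
  modeDl : forall u v k w, mode (u + v) k w = mode u k w + mode v k w;
  modeDr : forall u k v w, mode u k (v + w) = mode u k v + mode u k w;
  YZl : forall a u w,
    Y1 grading mode (a *: u) (const w) = smul (const a) (Y1 grading mode u (const w));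
  YZr : forall i j a u w, has_sg grading i u -> gsign j a ->
    Y1 grading mode u (const (a *: w)) =
    smul (const ((-1) ^+ (i && j) * a)) (Y1 grading mode u (const w));
  mode_even : forall i j (n : int) u v, has_sg grading i u -> has_sg grading j v ->
    has_sg grading (i (+) j) (mode u (2 * n) v);
  mode_odd : forall i j (n : int) u v, has_sg grading i u -> has_sg grading j v ->
    has_sg grading (~~ i (+) j) (mode u (2 * n - 1) v);
  vac_wt : has_wt grading 0 vac;
  vac_sg : has_sg grading false vac;
  tau_wt : has_wt grading 3 tau;
  tau_sg : has_sg grading true tau;
  truncation : forall u v, exists N : int, forall k : int, N < k -> mode u k v = 0;
  vacuum : forall w, Y1 grading mode vac (const w) = const w;
  creation : forall v,
    (forall (e : expo) b, e X1 < 0 -> Y1 grading mode v (const vac) e b = 0) /\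
    Y1 grading mode v (const vac) 0 (false, false) = v;
  jacobi : forall i j u v w, has_sg grading i u -> has_sg grading j v ->
    smul (xpow X0 (-1) ** sdelta (xobin X1 X2 (-1) (-1)) (xpow X0))
         (Y1 grading mode u (Y2 grading mode v (const w)))
    - smul (const ((-1) ^+ (i && j)))
        (smul (xpow X0 (-1) ** sdelta (xobin X2 X1 (-1) 1) (xpowN X0))
              (Y2 grading mode v (Y1 grading mode u (const w))))
    = smul (xpow X2 (-1) ** sdelta (xobin X1 X0 (-1) (-1)) (xpow X2))
           (Yiter grading mode u v w);
  LL : forall (m n : int) v, scomm false false (Lop m) (Lop n) v =
    scal (m - n)%:~R *: Lop (m + n) v +
    scal (12^-1 * (m ^+ 3 - m)%:~R * (m + n == 0)%:R * rank) *: v;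
  GL : forall (m n : int) v, scomm true false (Gop m) (Lop n) v =
    scal (m%:~R - (n - 1)%:~R / 2) *: Gop (m + n) v;
  GG : forall (m n : int) v, scomm true true (Gop m) (Gop (n - 1)) v =
    scal 2 *: Lop (m + n) v +
    scal (3^-1 * (m ^+ 2 + m)%:~R * (m + n == 0)%:R * rank) *: v;
  L0_wt : forall (n : int) v, has_wt grading n v -> Lop 0 v = scal (n%:~R / 2) *: v;
  G_derivative : forall v w,
    dphi1 (Y1 grading mode v (const w)) +
    smul phi1 (dx X1 (Y1 grading mode v (const w))) =
    Y1 grading mode (Gop (-1) v) (const w) }.

(* The graded dual, as the space of linear functionals on V vanishing on all
   but finitely many V_(n).  Functionals are left-linear, matching the
   convention that the pairing pulls odd variables out to the left. *)
Definition graded_dual (V : lmodType Lam) (G : bigrading V) (f : {scalar V}) :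
    Prop :=
  exists s : seq int, forall n v, n \notin s -> has_wt G n v -> f v = 0.

Definition superpoly (k : series Lam) : Prop :=
  exists N : nat, forall (e : expo) b, k e b != 0 ->
    [/\ 0 <= e X0 <= N%:Z, e X1 = 0 & 0 <= e X2 <= N%:Z].

(* (a0, a2, a12) stands for a0 x_0 + a2 x_2 + a12 phi_1 phi_2 *)
Definition lform := (Lam * Lam * Lam)%type.

Definition lser (l : lform) : series Lam :=
  let: (a0, a2, a12) := l in
  const a0 ** xpow X0 1 + const a2 ** xpow X2 1 + const a12 ** phi12.

Definition in_S (l : lform) : Prop :=
  let: (a0, a2, a12) := l in
  [/\ gsign false a0, gsign false a2, gsign false a12
    & gbody a0 != 0 \/ gbody a2 != 0].

Definition lprod (d : seq lform) : series Lam :=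
  foldr (fun l f => lser l ** f) (const 1) d.

(* A fraction is a polynomial numerator with a list of denominators in S',
   which are central; the localization is the set of fractions modulo
   frac_eq. *)
Definition superfrac := (series Lam * seq lform)%type.

Definition is_frac (h : superfrac) : Prop :=
  superpoly h.1 /\ forall l, l \in h.2 -> in_S l.

Definition frac_eq (h h' : superfrac) : Prop :=
  exists d : seq lform, (forall l, l \in d -> in_S l) /\
    lprod d ** (lprod h'.2 ** h.1 - lprod h.2 ** h'.1) = 0.

Definition frac_mul (h h' : superfrac) : superfrac := (h.1 ** h'.1, h.2 ++ h'.2).

Definition frac_pow (l : lform) (n : int) : superfrac :=
  match n with
  | Posz m => (lprod (nseq m l), [::])
  | Negz m => (const 1, nseq m.+1 l)
  end.

(* h(x_0, phi_1 - phi_2, x_2, phi_2); elements of S' are invariant *)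
Definition frac_subst (h : superfrac) : superfrac := (ssubst h.1, h.2).

(* k / (x_0^r x_2^s (x_0 + x_2 - phi_1 phi_2)^t) *)
Definition pole_frac (k : series Lam) (r s t : int) : superfrac :=
  frac_mul (k, [::])
    (frac_mul (frac_pow (1, 0, 0) (- r))
      (frac_mul (frac_pow (0, 1, 0) (- s)) (frac_pow (1, 1, -1) (- t)))).

(* expansion of 1 / (a x_i + b x_j) in nonnegative powers of x_j, for a invertible *)
Definition linv (i j : 'I_3) (a b : Lam) : series Lam :=
  ssum (fun k : nat => mono (xexp i (- k.+1%:Z) + xexp j k%:Z) (false, false)
                         ((-1) ^+ k * b ^+ k * a ^- k.+1)).

(* The expansion of 1 / (a0 x_0 + a2 x_2 + a12 phi_1 phi_2) with finitely many
   negative powers of x_0.  If a2 has zero body it is nilpotent, a0 is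
   invertible, and the only expansion is a finite sum in powers of a2. *)
Definition iota20_inv (l : lform) : series Lam :=
  let: (a0, a2, a12) := l in
  let E := if gbody a2 != 0 then linv X2 X0 a2 a0 else linv X0 X2 a0 a2 in
  E - const a12 ** (phi12 ** (E ** E)).

Definition iota02_inv (l : lform) : series Lam :=
  let: (a0, a2, a12) := l in
  let E := if gbody a0 != 0 then linv X0 X2 a0 a2 else linv X2 X0 a2 a0 in
  E - const a12 ** (phi12 ** (E ** E)).

Definition iota20 (h : superfrac) : series Lam :=
  foldr (fun l f => iota20_inv l ** f) h.1 h.2.

Definition iota02 (h : superfrac) : series Lam :=
  foldr (fun l f => iota02_inv l ** f) h.1 h.2.

Definition bounded_powers (i j : 'I_3) (f : series Lam) : Prop :=
  exists N : int, forall (e : expo) b, f e b != 0 -> - N <= e i /\ e j <= N.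

End FormalCalculus.

(* Main.v *)
From HB Require Import structures.
Require Import Defs.
From mathcomp Require Import all_boot all_order all_algebra finmap complex.
From mathcomp Require Import ring zify.
From mathcomp Require Import boolp classical_sets functions fsbigop reals.

Set Implicit Arguments.
Unset Strict Implicit.
Unset Printing Implicit Defensive.

Import Order.TTheory GRing.Theory Num.Theory.

Local Open Scope ring_scope.

(** The theorem rests on weak associativity. Write [X] for [x_0 + x_2] and [eps] for
    [phi_1 phi_2]. All three delta functions of the Jacobi identity express the relation
    [x_1 = X + eps], so that, on each of the three terms, passing from the coefficient of
    [x_1^m] to that of [x_1^(m-1)] is multiplication by [X + eps]. The residue in [x_1]
    is the product [Y(u, (x_0 + x_2 + eps, phi_1)) Y(v, (x_2, phi_2)) w] for the first term
    and the iterate for the term on the right, while the reversed product has no negative powers of [x_1]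
    beyond some bound, by truncation for [u] and [w]. Comparing coefficients of [x_1^(-1-t)]
    for large [t] gives [(X + eps)^t product = (X + eps)^t iterate]
    (lemma [weak_associativity]).

    The two sides of this equation have only finitely many negative powers of [x_2] and
    of [x_0] respectively. After pairing with [v'] their total degree in [x_0] and [x_2]
    is moreover bounded, and the common value is a Laurent polynomial
    (lemma [clear_denominators]). The factor [X - eps] of the theorem can be used
    in place of [X + eps] because [(X - eps)^(t+1) = (X + eps)^t (X - (2 t + 1) eps)]
    (lemma [lminus_lplus]).

    The bound on the total degree comes from the weights: a mode [v_k] changes weights by
    a fixed amount (lemma [mode_wt]), and [v'] sees only finitely many weights. That modes
    are homogeneous follows from the axioms: the Jacobi identity for [u = tau] gives the
    commutator of [L(0)] with [Y(v, (x, phi))] (lemma [tau_commutator]), in which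
    [L(-1) = G(-1/2)^2] acts as a derivative, and vectors of weight [n] are eigenvectors of [L(0)].

    Finally, for either expansion map the series with finitely many negative powers of
    the chosen variable and bounded total degree form a ring, in which every element
    of the denominator set has the prescribed expansion as its inverse
    (lemmas [iota20_inverse] and [iota02_inverse]). Clearing denominators can therefore be undone in
    both rings, and a fraction is determined by its expansion. *)

(** * Grassmann algebras *)

Section Grassmann.

Variables (K : fieldType) (L : option nat).
Local Notation Lam := (grassmann K L).
Implicit Types (a b : Lam) (S T : {fset nat}).

Lemma gval_inj a b : gval a =1 gval b -> a = b.
Proof. by move=> ab; apply/val_inj/funext. Qed.

Lemma gval0 S : gval (0 : Lam) S = 0. Proof. by []. Qed.

Lemma gvalD a b S : gval (a + b) S = gval a S + gval b S. Proof. by []. Qed.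

Lemma gvalN a S : gval (- a) S = - gval a S. Proof. by []. Qed.

Lemma gvalM a b S : gval (a * b) S = gmul (gval a) (gval b) S. Proof. by []. Qed.

Lemma gval1 S : gval (1 : Lam) S = (S == fset0)%:R. Proof. by []. Qed.

Lemma gparE a S : gval (gpar a) S = (-1) ^+ #|` S| * gval a S. Proof. by []. Qed.

Lemma gparK : involutive (@gpar K L).
Proof. by move=> a; apply: gval_inj => S; rewrite !gparE mulrA -expr2 sqrr_sign mul1r. Qed.

Lemma gparD a b : gpar (a + b) = gpar a + gpar b.
Proof. by apply: gval_inj => S; rewrite !(gvalD, gparE) mulrDr. Qed.

Lemma gpar0 : gpar (0 : Lam) = 0.
Proof. by apply: gval_inj => S; rewrite gparE gval0 mulr0. Qed.

Lemma gparN a : gpar (- a) = - gpar a.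
Proof. by apply/eqP; rewrite -subr_eq0 opprK -gparD addNr gpar0. Qed.

Lemma gparM a b : gpar (a * b) = gpar a * gpar b.
Proof.
apply: gval_inj => S; rewrite gparE !gvalM /gmul mulr_sumr big_seq [RHS]big_seq.
apply: eq_bigr => T; rewrite fpowersetE => sTS.
rewrite !gparE -(cardfsID T S) (fsetIidPr sTS) exprD.
by ring.
Qed.

Lemma gpar1 : gpar (1 : Lam) = 1.
Proof.
apply: gval_inj => S; rewrite gparE gval1; case: eqVneq => [->|_].
  by rewrite cardfs0 mul1r.
by rewrite mulr0.
Qed.

Lemma gpar_even a : gsign false a -> gpar a = a.
Proof.
move=> ea; apply: gval_inj => S; rewrite gparE.
have [->|/ea oS] := eqVneq (gval a S) 0; first by rewrite mulr0.
by rewrite -signr_odd oS mul1r.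
Qed.

(** A pair of distinct generators is inverted in exactly one of the two orders. *)
Lemma ginv_flip S T : [disjoint S & T]%fset ->
  (ginv S T + ginv T S = #|` S| * #|` T|)%N.
Proof.
move=> dST; rewrite /ginv [X in (_ + X)%N]exchange_big -big_split /=.
rewrite (eq_big_seq (fun=> #|` T|)).
  by rewrite big_const_seq count_predT iter_addn_0 mulnC.
move=> i iS; rewrite -big_split /= (eq_big_seq (fun=> 1%N)).
  by rewrite big_const_seq count_predT iter_addn_0 mul1n.
move=> j jT /=; case: (ltngtP i j) => // ij.
by have := fdisjointP dST i iS; rewrite ij jT.
Qed.

(** Moving [z_S] past [z_T] costs one sign for each pair of generators, hence
    none at all when [S] has an even number of elements. *)
Lemma even_central a b : gsign false a -> a * b = b * a.
Proof.
move=> ea; apply: gval_inj => S; rewrite !gvalM /gmul.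
transitivity (\sum_(T <- [seq (S `\` T)%fset | T <- fpowerset S])
    (-1) ^+ ginv T (S `\` T)%fset * (gval a T * gval b (S `\` T)%fset)).
  apply: perm_big; apply: uniq_perm; first exact: fset_uniq.
    rewrite map_inj_in_uniq ?fset_uniq // => T U.
    rewrite !fpowersetE => sT sU eTU.
    by rewrite -(fsetDK sT) -(fsetDK sU) eTU.
  move=> T; apply/idP/mapP => [|[U]]; rewrite !fpowersetE => sT.
    exists (S `\` T)%fset; first by rewrite fpowersetE fsubsetDl.
    by rewrite fsetDK.
  by move=> ->; rewrite fsubsetDl.
rewrite big_map big_seq [RHS]big_seq; apply: eq_bigr => T; rewrite fpowersetE => sT.
rewrite fsetDK //.
have [->|/ea eS] := eqVneq (gval a (S `\` T)%fset) 0; first by rewrite !(mul0r, mulr0).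
rewrite [gval b T * _]mulrC; congr (_ * _).
rewrite -signr_odd -[RHS]signr_odd; congr (_ ^+ _).
have /ginv_flip/(congr1 odd) : [disjoint S `\` T & T]%fset.
  by apply/fdisjointP => x; rewrite inE => /andP[].
rewrite oddD oddM eS andFb => /eqP; rewrite addbC.
by case: (odd _); case: (odd _).
Qed.

Lemma gsupp_fin a : exists n, gsupp_in n (gval a).
Proof.
move: (gvalP a); rewrite unfold_in /gsupp; move: (gval a) => x.
by case: L => [n|] /asboolP //; exists n.
Qed.

(** Elements of exterior degree at least [k] form an ideal, and the [k]-th
    power of an element without body lies in it; degrees are bounded by the
    number of generators that occur. *)
Lemma body0_nilpotent a : gbody a = 0 -> exists k, a ^+ k = 0.
Proof.
move=> a0; have [n sa] := gsupp_fin a; exists n.+1.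
have deg k S : gval (a ^+ k) S != 0 -> (k <= #|` S|)%N /\ forall i, i \in S -> (i < n)%N.
  elim: k S => [|k IH] S.
    rewrite expr0 gval1; case: (eqVneq S fset0) => [->|]; last by rewrite eqxx.
    by move=> _; split=> // i; rewrite inE.
  rewrite exprS gvalM /gmul => nz.
  have [T [TS]] : exists T, (T `<=` S)%fset /\ gval a T * gval (a ^+ k) (S `\` T)%fset != 0.
    apply: contrapT => H; move: nz; rewrite big_seq big1 ?eqxx // => T.
    rewrite fpowersetE => TS; have [->|h] := eqVneq (gval a T * gval (a ^+ k) (S `\` T)%fset) 0.
      by rewrite mulr0.
    by case: H; exists T.
  rewrite mulf_eq0 negb_or => /andP[aT /IH [cT sT]].
  have T0 : T != fset0 by apply: contraNneq aT => ->; rewrite -/(gbody a) a0.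
  rewrite -(cardfsID T S) (fsetIidPr TS); split.
    by rewrite -add1n leq_add // cardfs_gt0.
  move=> i iS; have [/(sa T aT)//|iT] := boolP (i \in T).
  by apply: sT; rewrite inE iT.
apply: gval_inj => S; apply/eqP; rewrite gval0; apply: contraT => /deg[cS sS].
have : (S `<=` [fset i in iota 0 n])%fset.
  by apply/fsubsetP => i /sS; rewrite !inE mem_iota.
move/fsubset_leq_card; rewrite card_fseq undup_id ?iota_uniq // size_iota => cS'.
by rewrite leqNgt ltnS cS' in cS.
Qed.

Lemma gscalarE (c : K) S : gval (@gscalar K L c) S = if S == fset0 then c else 0.
Proof. by []. Qed.

Lemma gscalarD c d : @gscalar K L (c + d) = @gscalar K L c + @gscalar K L d.
Proof. by apply: gval_inj => S; rewrite gvalD !gscalarE; case: eqP; rewrite ?addr0. Qed.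

Lemma gscalar0 : @gscalar K L (0 : K) = 0.
Proof. by apply: gval_inj => S; rewrite !gscalarE; case: eqP. Qed.

Lemma gscalar1 : @gscalar K L (1 : K) = 1.
Proof. by apply: gval_inj => S; rewrite !gscalarE gval1; case: eqP. Qed.

Lemma gscalar_mulE c a S : gval (@gscalar K L c * a) S = c * gval a S.
Proof.
rewrite gvalM /gmul (bigD1_seq fset0) ?fset_uniq ?fpowersetE ?fsub0set //=.
rewrite big1 ?addr0; first by rewrite fsetD0 ginv0l !mul1r.
by move=> T /negPf nT; rewrite nT mul0r mulr0.
Qed.

Lemma gscalarM c d : @gscalar K L (c * d) = @gscalar K L c * @gscalar K L d.
Proof.
by apply: gval_inj => S; rewrite gscalar_mulE !gscalarE; case: eqP; rewrite ?mulr0.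
Qed.

Lemma gscalar_even c : gsign false (@gscalar K L c).
Proof. by move=> S; rewrite gscalarE; case: (eqVneq S fset0) => [->|]; rewrite ?cardfs0 ?eqxx. Qed.

(** geometric series *)
Lemma nilpotent_unit a k : a ^+ k = 0 -> 1 - a \is a GRing.unit.
Proof.
move=> ak; apply/unitrP; exists (\sum_(i < k) a ^+ i).
have := subrX1 a k; rewrite ak sub0r => e.
have e' : (1 - a) * (\sum_(i < k) a ^+ i) = 1.
  by rewrite -opprB mulNr -e opprK.
split=> //; rewrite -[RHS]e'.
suff : GRing.comm (1 - a) (\sum_(i < k) a ^+ i) by move=> ->.
apply: commr_sum => i _; apply: commrX.
by apply/commr_sym/commrB; [apply: commr1|].
Qed.

(** Up to the invertible scalar given by its body, such an element is [1 - m] with [m]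
    without body, hence nilpotent. *)
Lemma body_unit a : gbody a != 0 -> a \is a GRing.unit.
Proof.
move=> a0; pose c := gbody a.
have cV : @gscalar K L c * @gscalar K L c^-1 = 1 by rewrite -gscalarM divff // gscalar1.
have Vc : @gscalar K L c^-1 * @gscalar K L c = 1 by rewrite -gscalarM mulVf // gscalar1.
pose m := 1 - @gscalar K L c^-1 * a.
have -> : a = @gscalar K L c * (1 - m).
  by rewrite /m opprB addrCA subrr addr0 mulrA cV mul1r.
have [k mk] : exists k, m ^+ k = 0.
  apply: body0_nilpotent; rewrite /gbody /m gvalD gvalN gscalar_mulE gval1 eqxx.
  by rewrite -/(gbody a) mulVf ?subrr.
rewrite unitrMr; first exact: nilpotent_unit mk.
by apply/unitrP; exists (@gscalar K L c^-1).
Qed.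

Lemma gsign1 : gsign false (1 : Lam).
Proof. by rewrite -gscalar1; apply: gscalar_even. Qed.

Lemma gsign0 i : gsign i (0 : Lam).
Proof. by move=> S; rewrite gval0 eqxx. Qed.

Lemma gsignN i a : gsign i a -> gsign i (- a).
Proof. by move=> ia S; rewrite gvalN oppr_eq0; apply: ia. Qed.

End Grassmann.

(** * Coefficients with odd variables *)

(** Polynomials in the odd variables, written to the left of their coefficients. With
    these as a ring of coefficients, products of formal series become plain
    convolutions over the exponents of the even variables, and the signs are dealt
    with once and for all in [oactA]. *)
Definition osa (R : realType) (L : option nat) := oexp -> grassmann R[i] L.

HB.instance Definition _ (R : realType) (L : option nat) :=
  GRing.Zmodule.copy (osa R L) (oexp -> grassmann R[i] L).

Definition oser (M : zmodType) := oexp -> M.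

HB.instance Definition _ (M : zmodType) :=
  GRing.Zmodule.copy (oser M) (oexp -> M).

Lemma oserP (M : zmodType) (f g : oser M) :
  f (false, false) = g (false, false) -> f (true, false) = g (true, false) ->
  f (false, true) = g (false, true) -> f (true, true) = g (true, true) -> f = g.
Proof. by move=> h1 h2 h3 h4; apply/funext => -[[] []]. Qed.

Section OddCoefficients.

Variables (R : realType) (L : option nat).
Local Notation C := R[i].
Local Notation Lam := (grassmann C L).
Local Notation Q := (osa R L).

Definition oact (V : lmodType Lam) (f : Q) (g : oser V) : oser V := fun b =>
  \sum_(p : oexp * oexp | osplit p b)
    ((-1) ^+ osgn p * gparn (oodd p.2) (f p.1)) *: g p.2.

(** A coefficient is twisted by the parity involution when an odd variable moves past
    it; the minus sign is that of [phi_2 phi_1]. *)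
Lemma oactE (V : lmodType Lam) (f : Q) (g : oser V) :
  [/\ oact f g (false, false) = f (false, false) *: g (false, false),
      oact f g (true, false) = f (true, false) *: g (false, false)
                               + gpar (f (false, false)) *: g (true, false),
      oact f g (false, true) = f (false, true) *: g (false, false)
                               + gpar (f (false, false)) *: g (false, true)
    & oact f g (true, true) = f (true, true) *: g (false, false)
        + gpar (f (true, false)) *: g (false, true)
        - gpar (f (false, true)) *: g (true, false)
        + f (false, false) *: g (true, true) ].
Proof.
have e (F : oexp * oexp -> V) P : \sum_(p | P p) F p =
    \sum_(a : bool) \sum_(b : bool) \sum_(c : bool) \sum_(d : bool)
      if P ((a, b), (c, d)) then F ((a, b), (c, d)) else 0.
  rewrite big_mkcond pair_bigA /=.
  rewrite [RHS](eq_bigr (fun p : bool * bool => \sum_(q : bool * bool)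
    if P (p, q) then F (p, q) else 0)); last first.
    by move=> [a b] _ /=; rewrite pair_bigA; apply: eq_bigr => -[].
  by rewrite pair_bigA; apply: eq_bigr => -[].
by split; rewrite /oact e !big_bool /= ?(expr0, expr1, mul1r, mulN1r, add0r, addr0) //
  ?scaleNr ?addrA //; rewrite /gparn /= ?[RHS]addrC ?addrA // ![in RHS]addrA.
Qed.

Lemma oact00 (V : lmodType Lam) (f : Q) (g : oser V) :
  oact f g (false, false) = f (false, false) *: g (false, false).
Proof. by case: (oactE f g). Qed.

Lemma oact10 (V : lmodType Lam) (f : Q) (g : oser V) :
  oact f g (true, false) = f (true, false) *: g (false, false)
                               + gpar (f (false, false)) *: g (true, false).
Proof. by case: (oactE f g). Qed.

Lemma oact01 (V : lmodType Lam) (f : Q) (g : oser V) :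
  oact f g (false, true) = f (false, true) *: g (false, false)
                               + gpar (f (false, false)) *: g (false, true).
Proof. by case: (oactE f g). Qed.

Lemma oact11 (V : lmodType Lam) (f : Q) (g : oser V) :
  oact f g (true, true) = f (true, true) *: g (false, false)
        + gpar (f (true, false)) *: g (false, true)
        - gpar (f (false, true)) *: g (true, false)
        + f (false, false) *: g (true, true).
Proof. by case: (oactE f g). Qed.

Definition oactx := (oact00, oact10, oact01, oact11).

Lemma oserD (M : zmodType) (f g : oser M) b : (f + g) b = f b + g b.
Proof. by []. Qed.

Lemma osaD (f g : Q) b : (f + g) b = f b + g b.
Proof. by []. Qed.

Definition osa1 : Q := fun b => if b == (false, false) then 1 else 0.

Definition osa_mul (f g : Q) : Q := @oact Lam^o f g.

Lemma oactDl (V : lmodType Lam) (f f' : Q) (g : oser V) :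
  oact (f + f') g = oact f g + oact f' g.
Proof.
by apply/funext => b; rewrite oserD /oact -big_split /=; apply: eq_bigr => p _;
  rewrite osaD /gparn; case: ifP; rewrite ?gparD mulrDr scalerDl.
Qed.

Lemma oactDr (V : lmodType Lam) (f : Q) (g g' : oser V) :
  oact f (g + g') = oact f g + oact f g'.
Proof.
by apply/funext => b; rewrite oserD /oact -big_split /=; apply: eq_bigr => p _;
  rewrite oserD scalerDr.
Qed.

Lemma oact1 (V : lmodType Lam) (g : oser V) : oact osa1 g = g.
Proof.
by apply: oserP; rewrite oactx /osa1 /= ?gpar0 ?gpar1 !scale1r ?scale0r
  ?(oppr0, add0r, addr0).
Qed.

Lemma osa_mul1 (f : Q) : osa_mul f osa1 = f.
Proof.
by apply: oserP; rewrite /osa_mul oactx /osa1 /= ?scaler0 ?(oppr0, add0r, addr0) //;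
  rewrite -[_ *: _]/(_ * _) mulr1.
Qed.

Lemma oactA (V : lmodType Lam) (f f' : Q) (g : oser V) :
  oact f (oact f' g) = oact (osa_mul f f') g.
Proof.
have m (a b : Lam) : a *: (b : Lam^o) = a * b by [].
apply: oserP; rewrite /osa_mul !oactx !m ?(gparD, gparN, gparM, gparK) //
   ?scalerDr ?scalerDl ?scaleNr ?scalerN ?scalerA ?opprD ?addrA //.
by rewrite [LHS](ACl (1*2*4*6*3*7*5*8*9)).
Qed.

Lemma osa_mulA : associative osa_mul.
Proof. by move=> f g h; apply: (@oactA Lam^o). Qed.

Lemma osa_1mul : left_id osa1 osa_mul.
Proof. by move=> f; apply: (@oact1 Lam^o). Qed.

Lemma osa_mulDl : left_distributive osa_mul +%R.
Proof. by move=> f g h; apply: (@oactDl Lam^o). Qed.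

Lemma osa_mulDr : right_distributive osa_mul +%R.
Proof. by move=> f g h; apply: (@oactDr Lam^o). Qed.

Lemma osa1_neq0 : osa1 != 0.
Proof.
apply/eqP => /(congr1 (fun f : Q => f (false, false))) /eqP.
by rewrite /osa1 /= oner_eq0.
Qed.

End OddCoefficients.

HB.instance Definition _ (R : realType) (L : option nat) :=
  GRing.Zmodule_isNzRing.Build (osa R L)
    (@osa_mulA R L) (@osa_1mul R L) (@osa_mul1 R L) (@osa_mulDl R L)
    (@osa_mulDr R L) (@osa1_neq0 R L).

HB.instance Definition _ (R : realType) (L : option nat)
    (V : lmodType (grassmann R[i] L)) :=
  GRing.Zmodule_isLmodule.Build (osa R L) (oser V)
    (@oactA R L V) (@oact1 R L V) (@oactDr R L V)
    (fun g f f' => @oactDl R L V f f' g).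

Section OddElements.

Variables (R : realType) (L : option nat).
Local Notation C := R[i].
Local Notation Lam := (grassmann C L).
Local Notation Q := (osa R L).
Variable V : lmodType Lam.

Lemma oscaleE (f : Q) (g : oser V) : f *: g = oact f g. Proof. by []. Qed.

Lemma osaMx (f g : Q) :
  ((f * g) (false, false) = f (false, false) * g (false, false)) *
  ((f * g) (true, false) = f (true, false) * g (false, false)
                               + gpar (f (false, false)) * g (true, false)) *
  ((f * g) (false, true) = f (false, true) * g (false, false)
                               + gpar (f (false, false)) * g (false, true)) *
  ((f * g) (true, true) = f (true, true) * g (false, false)
        + gpar (f (true, false)) * g (false, true)
        - gpar (f (false, true)) * g (true, false)
        + f (false, false) * g (true, true)).
Proof. by rewrite -[f * g]/(@oact R L Lam^o f g) !oactx. Qed.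

(** the monomial [phi_1^b.1 phi_2^b.2 c] *)
Definition qm (b : oexp) (c : Lam) : Q := fun b' => if b' == b then c else 0.

Definition qc : Lam -> Q := qm (false, false).
Definition qe : Lam -> Q := qm (true, true).

Lemma qmD b c d : qm b (c + d) = qm b c + qm b d.
Proof. by apply/funext => b'; rewrite osaD /qm; case: ifP; rewrite ?addr0. Qed.

Lemma qm0 b : qm b 0 = 0.
Proof. by apply/funext => b'; rewrite /qm; case: ifP. Qed.

Lemma qcM c d : qc (c * d) = qc c * qc d.
Proof.
by apply: oserP; rewrite !osaMx /qc /qm /= ?gpar0 ?(mulr0, mul0r, addr0, subr0).
Qed.

Lemma qc1 : qc 1 = 1. Proof. by []. Qed.

Lemma qcqe c d : qc c * qe d = qe (c * d).
Proof.
by apply: oserP; rewrite !osaMx /qc /qe /qm /= ?gpar0 ?(mulr0, mul0r, addr0, subr0, add0r, oppr0).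
Qed.

Lemma qeqc c d : qe c * qc d = qe (c * d).
Proof.
by apply: oserP; rewrite !osaMx /qc /qe /qm /= ?gpar0 ?(mulr0, mul0r, addr0, subr0, add0r, oppr0).
Qed.

Lemma qeqe c d : qe c * qe d = 0.
Proof.
by apply: oserP; rewrite !osaMx /qc /qe /qm /= ?gpar0 ?(mulr0, mul0r, addr0, subr0, add0r, oppr0).
Qed.

(** Even elements of the Grassmann algebra commute with the odd variables as
    well as with all coefficients. *)
Lemma qc_central a (f : Q) : gsign false a -> qc a * f = f * qc a.
Proof.
move=> ea; apply: oserP; rewrite !osaMx /qc /qm /=
  ?(gpar0, gpar_even ea, mulr0, mul0r, addr0, subr0, add0r, oppr0) //; exact: even_central.
Qed.

Lemma qe_central a (f : Q) : gsign false a -> qe a * f = f * qe a.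
Proof.
move=> ea; apply: oserP; rewrite !osaMx /qe /qm /=
  ?(gpar0, gpar_even ea, mulr0, mul0r, addr0, subr0, add0r, oppr0) //; exact: even_central.
Qed.

Lemma qc_act c (g : oser V) b : (qc c *: g) b = gparn (oodd b) c *: g b.
Proof.
by rewrite oscaleE; case: b => [[] []]; rewrite oactx /qc /qm /= ?gpar0 ?scale0r ?(addr0, subr0, add0r, oppr0).
Qed.

Lemma qe_act (c : Lam) (g : oser V) :
  qe c *: g = fun b => if b == (true, true) then c *: g (false, false) else 0.
Proof.
by rewrite oscaleE; apply: oserP; rewrite oactx /qe /qm /= ?gpar0 ?scale0r ?(addr0, subr0, add0r, oppr0).
Qed.

Lemma phi1_act (g : oser V) :
  qm (true, false) 1 *: g =
    fun b => if b.1 then g (false, b.2) else 0.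
Proof.
by rewrite oscaleE; apply: oserP;
  rewrite oactx /qm /= ?gpar0 ?gpar1 ?scale0r ?scale1r ?(addr0, subr0, add0r, oppr0).
Qed.

Lemma phi2_act (g : oser V) :
  qm (false, true) 1 *: g =
    fun b => if b.2 then (if b.1 then - g (true, false) else g (false, false)) else 0.
Proof.
by rewrite oscaleE; apply: oserP;
  rewrite oactx /qm /= ?gpar0 ?gpar1 ?scale0r ?scale1r ?(addr0, subr0, add0r, oppr0).
Qed.

End OddElements.

(** * Exponents and locally finite sums *)

Lemma X0E : (X0 == X0 = true) * (X0 == X1 = false) * (X0 == X2 = false). Proof. by []. Qed.
Lemma X1E : (X1 == X0 = false) * (X1 == X1 = true) * (X1 == X2 = false). Proof. by []. Qed.
Lemma X2E : (X2 == X0 = false) * (X2 == X1 = false) * (X2 == X2 = true). Proof. by []. Qed.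

Lemma expoD (e e' : expo) i : (e + e') i = e i + e' i. Proof. by rewrite ffunE. Qed.
Lemma expoN (e : expo) i : (- e) i = - e i. Proof. by rewrite ffunE. Qed.
Lemma expo0 i : (0 : expo) i = 0. Proof. by rewrite ffunE. Qed.
Lemma xexpE i n j : xexp i n j = if j == i then n else 0. Proof. by rewrite ffunE. Qed.

Lemma expoP (e e' : expo) : e X0 = e' X0 -> e X1 = e' X1 -> e X2 = e' X2 -> e = e'.
Proof.
move=> h0 h1 h2; apply/ffunP => -[[|[|[|//]]] hi].
- by rewrite (_ : Ordinal hi = X0) //; apply: val_inj.
- by rewrite (_ : Ordinal hi = X1) //; apply: val_inj.
- by rewrite (_ : Ordinal hi = X2) //; apply: val_inj.
Qed.

Lemma expo_eq (e e' : expo) :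
  (e == e') = [&& e X0 == e' X0, e X1 == e' X1 & e X2 == e' X2].
Proof.
apply/eqP/and3P => [->|[/eqP ? /eqP ? /eqP ?]]; last exact: expoP.
by rewrite !eqxx.
Qed.

Definition expoE := (expoD, expoN, expo0, xexpE, X0E, X1E, X2E).

Lemma xexp0 i : xexp i 0 = 0.
Proof. by apply/ffunP => j; rewrite !ffunE; case: ifP. Qed.

Definition small (M : nat) (e : expo) : bool :=
  [&& (`|e X0| <= M)%N, (`|e X1| <= M)%N & (`|e X2| <= M)%N].

Definition box (M : nat) : seq expo :=
  [seq ([ffun i => (nat_of_ord (x i))%:Z - M%:Z] : expo)
    | x : {ffun 'I_3 -> 'I_(M + M).+1} <- enum {: {ffun 'I_3 -> 'I_(M + M).+1}}].

Lemma box_uniq M : uniq (box M).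
Proof.
rewrite map_inj_uniq ?enum_uniq // => x y /ffunP xy.
by apply/ffunP => i; apply: val_inj => /=; have := xy i; rewrite !ffunE; lia.
Qed.

Lemma mem_box M e : small M e -> e \in box M.
Proof.
move=> /and3P[h0 h1 h2].
have h i : (`|(e i + M%:Z)%R| < (M + M).+1)%N.
  case: i => -[|[|[|//]]] hi.
  - by rewrite (_ : Ordinal hi = X0); [lia|apply: val_inj].
  - by rewrite (_ : Ordinal hi = X1); [lia|apply: val_inj].
  - by rewrite (_ : Ordinal hi = X2); [lia|apply: val_inj].
apply/mapP; exists [ffun i => Ordinal (h i)]; first by rewrite mem_enum.
apply: expoP; rewrite !ffunE /=; lia.
Qed.

Lemma fsum_seq (M : zmodType) (T : choiceType) (F : T -> M) (s : seq T) :
  uniq s -> (forall t, t \notin s -> F t = 0) ->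
  \sum_(t \in [set: T]%classic) F t = \sum_(t <- s) F t.
Proof.
move=> us s0; rewrite (@fsbigE _ _ _ _ _ s) //; last by move=> t _; apply: s0.
by rewrite big_mkcond /=; apply: eq_bigr => t _; rewrite ifT // inE.
Qed.

Lemma sum_cover (M : zmodType) (T : choiceType) (F : T -> M) (s s' : seq T) :
  uniq s -> uniq s' -> (forall t, F t != 0 -> (t \in s) && (t \in s')) ->
  \sum_(t <- s) F t = \sum_(t <- s') F t.
Proof.
move=> us us' ss'; rewrite -!fsum_seq // => t ts;
  by apply/eqP; apply: contraNT ts => /ss'/andP[].
Qed.

Lemma oser_sum (M : zmodType) (T : Type) (s : seq T) (F : T -> oser M) b :
  (\sum_(t <- s) F t) b = \sum_(t <- s) F t b.
Proof. by elim: s => [|t s IH]; rewrite ?big_nil // !big_cons oserD IH. Qed.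

Lemma oser0 (M : zmodType) b : (0 : oser M) b = 0. Proof. by []. Qed.

Lemma ssumE (M : zmodType) (T : choiceType) (F : T -> series M) (s : seq T) e :
  uniq s -> (forall t, t \notin s -> (F t e : oser M) = 0) ->
  ssum F e = \sum_(t <- s) (F t e : oser M).
Proof.
move=> us s0; apply/funext => b; rewrite oser_sum /ssum (fsum_seq us) // => t ts.
by have := congr1 (fun h => h b) (s0 t ts).
Qed.

Lemma ssum1 (M : zmodType) (T : choiceType) (F : T -> series M) (t0 : T) e :
  (forall t, t != t0 -> (F t e : oser M) = 0) -> ssum F e = F t0 e.
Proof.
move=> s0; rewrite (@ssumE _ _ _ [:: t0]) ?big_seq1 // => t.
by rewrite inE; apply: s0.
Qed.

(** * Products of formal series *)

Section Products.

Variables (R : realType) (L : option nat).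
Local Notation C := R[i].
Local Notation Lam := (grassmann C L).
Local Notation Q := (osa R L).

Section Action.

Variable V : lmodType Lam.
Implicit Types (f : series Lam) (g h : series V).

(** The sums defining products of series are evaluated over any list that covers
    their support, so that the default value of sums with infinite support is
    never met. *)
Lemma smulE f g e s : uniq s ->
  (forall d : expo, d \notin s -> (f d : Q) = 0 \/ (g (e - d) : oser V) = 0) ->
  smul f g e = \sum_(d <- s) (f d : Q) *: (g (e - d) : oser V).
Proof.
move=> us s0; apply/funext => b; rewrite oser_sum /smul.
have -> : (fun d => \sum_(p : oexp * oexp | osplit p b)
    ((-1) ^+ osgn p * gparn (oodd p.2) (f d p.1)) *: g (e - d) p.2) =
    (fun d => ((f d : Q) *: (g (e - d) : oser V)) b) by [].
apply: fsum_seq us _ => d /s0[]->; by rewrite ?scale0r ?scaler0.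
Qed.

Lemma smul0E f g e :
  (forall d : expo, (f d : Q) = 0 \/ (g (e - d) : oser V) = 0) -> smul f g e = (0 : oser V).
Proof. by move=> s0; rewrite (@smulE _ _ _ [::]) ?big_nil. Qed.

End Action.

Lemma sprodE (f g : series Lam) e s : uniq s ->
  (forall d : expo, d \notin s -> (f d : Q) = 0 \/ (g (e - d) : Q) = 0) ->
  sprod f g e = \sum_(d <- s) (f d : Q) * (g (e - d) : Q).
Proof. exact: (@smulE Lam^o). Qed.

Section Associativity.

Variable V : lmodType Lam.
Implicit Types (f : series Lam) (g : series V).

(** Products of infinite series need not associate; under this finiteness condition
    both sides are the same finite sum over pairs of exponents. *)
Lemma smulA f f' g :
  (forall e : expo, exists M, forall c c', (f c : Q) != 0 -> (f' c' : Q) != 0 ->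
     (g (e - c - c') : oser V) != 0 -> small M c && small M c') ->
  smul f (smul f' g) = smul (sprod f f') g.
Proof.
move=> fin; apply/funext => e; have [M hM] := fin e.
have smallD c c' : small M c -> small M c' -> small (M + M) (c + c').
  by rewrite /small !expoE; lia.
have e1 c : (f c : Q) != 0 -> smul f' g (e - c) =
    \sum_(d <- box M) (f' d : Q) *: (g (e - c - d) : oser V).
  move=> fc; apply: smulE (box_uniq M) _ => d dM.
  have [->|f'd] := eqVneq (f' d : Q) 0; [by left|right].
  apply/eqP; apply: contraNT dM => /(hM _ _ fc f'd)/andP[_].
  exact: mem_box.
have e2 d : (g (e - d) : oser V) != 0 -> (sprod f f' d : Q) =
    \sum_(c <- box M) (f c : Q) * (f' (d - c) : Q).
  move=> gd; rewrite (@sprodE _ _ _ (box M)) ?box_uniq // => c cM.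
  have [->|fc] := eqVneq (f c : Q) 0; [by left|right].
  apply/eqP; apply: contraNT cM => f'c.
  apply/mem_box/(proj1 (andP (hM _ _ fc f'c _))).
  by rewrite opprB addrA subrK.
rewrite (@smulE V f _ _ (box M)) ?box_uniq //; last first.
  move=> c cM; have [->|fc] := eqVneq (f c : Q) 0; [by left|right].
  rewrite e1 // big1 // => d _; apply/eqP; apply: contraNT cM => nz.
  have f'd : (f' d : Q) != 0 by apply: contraNneq nz => ->; rewrite scale0r.
  have gd : (g (e - c - d) : oser V) != 0 by apply: contraNneq nz => ->; rewrite scaler0.
  by have /andP[/mem_box] := hM _ _ fc f'd gd.
rewrite (@smulE V (sprod f f') _ _ (box (M + M))) ?box_uniq //; last first.
  move=> d dM; have [->|gd] := eqVneq (g (e - d) : oser V) 0; [by right|left].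
  rewrite e2 // big1 // => c _; apply/eqP; apply: contraNT dM => nz.
  have fc : (f c : Q) != 0 by apply: contraNneq nz => ->; rewrite mul0r.
  have f'd : (f' (d - c) : Q) != 0 by apply: contraNneq nz => ->; rewrite mulr0.
  have /andP[s1 s2] : small M c && small M (d - c).
    by apply: hM fc f'd _; rewrite opprB addrA subrK.
  by rewrite -(subrK c d) addrC; apply/mem_box/smallD.
transitivity (\sum_(c <- box M) \sum_(d <- box (M + M))
    ((f c : Q) * (f' (d - c) : Q)) *: (g (e - d) : oser V)).
  apply: eq_bigr => c _.
  have [->|fc] := eqVneq (f c : Q) 0.
    by rewrite scale0r big1 // => d _; rewrite mul0r scale0r.
  rewrite e1 // scaler_sumr.
  rewrite -(@sum_cover _ _ (fun d => ((f c : Q) * (f' (d - c) : Q)) *: (g (e - d) : oser V))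
     [seq c + d | d <- box M]); first last.
  - move=> d nz.
    have f'd : (f' (d - c) : Q) != 0.
      by apply: contraNneq nz => ->; rewrite mulr0 scale0r.
    have gd : (g (e - d) : oser V) != 0 by apply: contraNneq nz => ->; rewrite scaler0.
    have /andP[s1 s2] : small M c && small M (d - c).
      by apply: hM fc f'd _; rewrite opprB addrA subrK.
    have ed : d = c + (d - c) by rewrite addrC subrK.
    by rewrite ed (mem_box (smallD _ _ s1 s2)) (map_f (fun d => c + d) (mem_box s2)).
  - exact: box_uniq.
  - by rewrite map_inj_uniq ?box_uniq //; apply: addrI.
  rewrite [RHS]big_map; apply: eq_bigr => d _.
  by rewrite scalerA opprD addrA [c + d]addrC addrK.
rewrite exchange_big; apply: eq_bigr => d _ /=.
have [->|gd] := eqVneq (g (e - d) : oser V) 0.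
  by rewrite scaler0 big1 // => c _; rewrite scaler0.
by rewrite e2 // scaler_suml.
Qed.

End Associativity.

End Products.

(** * Monomials and linear forms *)

Section Monomials.

Variables (R : realType) (L : option nat).
Local Notation C := R[i].
Local Notation Lam := (grassmann C L).
Local Notation Q := (osa R L).
Local Notation "f ** g" := (@sprod R L f g) (at level 40, left associativity).

Definition qmono (e0 : expo) (q : Q) : series Lam :=
  fun e => if e == e0 then q else 0.

Lemma monoE e0 b (c : Lam) : mono e0 b c = qmono e0 (qm b c).
Proof. by apply/funext => e; apply/funext => b'; rewrite /mono /qmono /qm; case: eqP. Qed.

Lemma qmono_act (V : lmodType Lam) e0 q (g : series V) e :
  smul (qmono e0 q) g e = q *: (g (e - e0) : oser V).
Proof.
rewrite (@smulE _ _ _ _ _ _ [:: e0]) ?big_seq1 /qmono ?eqxx // => d.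
by rewrite inE => /negPf ->; left.
Qed.

Lemma qmono_mul e0 q f e : (qmono e0 q ** f) e = q * (f (e - e0) : Q).
Proof. exact: (@qmono_act Lam^o). Qed.

Lemma mul_qmono e0 q f e : (f ** qmono e0 q) e = (f (e - e0) : Q) * q.
Proof.
rewrite (@sprodE _ _ _ _ _ [:: e - e0]) ?big_seq1 /qmono ?subKr ?eqxx // => d.
rewrite inE => de; right; case: eqP => // h.
by rewrite -h subKr eqxx in de.
Qed.

Lemma constE (c : Lam) : const c = qmono 0 (qc c).
Proof. exact: monoE. Qed.

Lemma serD (M : zmodType) (f g : series M) e :
  (f + g) e = (f e : oser M) + g e :> oser M.
Proof. by []. Qed.

Lemma serB (M : zmodType) (f g : series M) e :
  (f - g) e = (f e : oser M) - g e :> oser M.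
Proof. by []. Qed.

Definition central (f : series Lam) := forall e (q : Q), (f e : Q) * q = q * f e.

Lemma sprodC f g : central f -> f ** g = g ** f.
Proof.
move=> cf; apply/funext => e; apply/funext => b.
transitivity (\sum_(d \in [set: expo]%classic) ((f d : Q) * (g (e - d) : Q)) b).
  by [].
have bij : bijective (fun d : expo => e - d : expo).
  by exists (fun d => e - d) => d; rewrite subKr.
rewrite (@reindex_fsbigT _ _ _ _ _ _ (fun d => ((f d : Q) * (g (e - d) : Q)) b) bij).
by apply: eq_fsbigr => d _; rewrite subKr cf.
Qed.

Lemma smul_const1 (V : lmodType Lam) (g : series V) : smul (const 1) g = g.
Proof. by apply/funext => e; rewrite constE qmono_act subr0 qc1 scale1r. Qed.

Lemma const1_mul f : const 1 ** f = f.
Proof. exact: (@smul_const1 Lam^o). Qed.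

Definition fsupp (f : series Lam) := exists M, forall e, (f e : Q) != 0 -> small M e.

Definition locfin (V : lmodType Lam) (f : series Lam) (g : series V) :=
  forall e : expo, exists M, forall d, (f d : Q) != 0 -> (g (e - d) : oser V) != 0 -> small M d.

Lemma small_leq M N e : (M <= N)%N -> small M e -> small N e.
Proof. rewrite /small; lia. Qed.

Lemma smulA_fsupp (V : lmodType Lam) f f' (g : series V) :
  fsupp f -> locfin f' g -> smul f (smul f' g) = smul (f ** f') g.
Proof.
move=> [M fM] lf; apply: smulA => e.
have [N hN] := choice (fun c => lf (e - c)).
exists (maxn M (\max_(c <- box M) N c)) => c c' fc f'c gc.
rewrite (small_leq _ (fM _ fc)) ?leq_maxl //=.
apply: small_leq (hN c c' f'c gc); rewrite leq_max; apply/orP; right.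
by rewrite (big_rem c) ?mem_box ?fM //= leq_maxl.
Qed.

Lemma fsupp_locfin (V : lmodType Lam) f (g : series V) : fsupp f -> locfin f g.
Proof. by move=> [M fM] e; exists M => d /fM. Qed.

Lemma smul_map (V W : lmodType Lam) (F : V -> W) f (g : series V) :
  {morph F : x y / x + y} -> (forall a x, F (a *: x) = a *: F x) ->
  fsupp f -> smap F (smul f g) = smul f (smap F g).
Proof.
move=> FD FZ [M fM]; apply/funext => e.
have F0 : F 0 = 0 by apply: (@addrI _ (F 0)); rewrite -FD !addr0.
have out d : d \notin box M -> (f d : Q) = 0.
  by move=> dM; apply/eqP; apply: contraNT dM => /fM; apply: mem_box.
rewrite (@smulE _ _ _ _ _ _ (box M)) ?box_uniq //; last by move=> d /out; left.
rewrite /smap (@smulE _ _ _ _ _ _ (box M)) ?box_uniq //; last by move=> d /out; left.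
apply/funext => b; rewrite !oser_sum (big_morph F FD F0); apply: eq_bigr => d _.
by rewrite !oscaleE /oact (big_morph F FD F0); apply: eq_bigr => p _; rewrite FZ.
Qed.

Lemma smulBr (V : lmodType Lam) f (g h : series V) :
  fsupp f -> smul f (g - h) = smul f g - smul f h.
Proof.
move=> [M fM]; apply/funext => e; rewrite serB.
have out d : d \notin box M -> (f d : Q) = 0.
  by move=> dM; apply/eqP; apply: contraNT dM => /fM; apply: mem_box.
do 3 (rewrite (@smulE _ _ _ _ _ _ (box M)) ?box_uniq //; last by move=> d /out; left).
by rewrite -sumrB; apply: eq_bigr => d _; rewrite serB scalerBr.
Qed.

Lemma sprodBr f g h : fsupp f -> f ** (g - h) = f ** g - f ** h.
Proof. exact: (@smulBr Lam^o). Qed.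

Lemma lserE l e : lser l e =
  (if e == xexp X0 1 then qc l.1.1 else 0) + (if e == xexp X2 1 then qc l.1.2 else 0)
  + (if e == 0 then qe l.2 else 0) :> Q.
Proof.
case: l => [[a0 a2] a12] /=; rewrite /lser !serD !constE /xpow /phi12 !monoE.
rewrite !qmono_mul /qmono !subr0.
congr (_ + _ + _); case: ifP => _; rewrite ?mulr0 //.
- by rewrite -/(qc 1) -qcM mulr1.
- by rewrite -/(qc 1) -qcM mulr1.
- by rewrite -/(qe 1) qcqe mulr1.
Qed.

Lemma lser_act (V : lmodType Lam) l (g : series V) e :
  smul (lser l) g e = qc l.1.1 *: (g (e - xexp X0 1) : oser V)
    + qc l.1.2 *: (g (e - xexp X2 1) : oser V) + qe l.2 *: (g e : oser V).
Proof.
have h02 : (xexp X0 1 == xexp X2 1) = false by rewrite expo_eq !expoE.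
have h0 : (xexp X0 1 == 0) = false by rewrite expo_eq !expoE.
have h2 : (xexp X2 1 == 0) = false by rewrite expo_eq !expoE.
rewrite (@smulE _ _ _ _ _ _ [:: xexp X0 1; xexp X2 1; 0]) /=.
- by rewrite !big_cons big_nil !lserE !expo_eq !expoE /= subr0 !(@addr0 Q, @add0r Q) (@addr0 (oser V)) addrA.
- by rewrite !inE h02 h0 h2.
move=> d; rewrite !inE !negb_or => /and3P[/negPf d0 /negPf d2 /negPf d3].
by left; rewrite lserE d0 d2 d3 !addr0.
Qed.

Lemma lser_mul l f e : (lser l ** f) e = qc l.1.1 * (f (e - xexp X0 1) : Q)
    + qc l.1.2 * (f (e - xexp X2 1) : Q) + qe l.2 * (f e : Q).
Proof. exact: (@lser_act Lam^o). Qed.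

Lemma lser_fsupp l : fsupp (lser l).
Proof.
exists 1%N => e; rewrite lserE; apply: contraNT => H.
have -> : (e == xexp X0 1) = false by apply: contraNF H => /eqP ->; rewrite /small !expoE.
have -> : (e == xexp X2 1) = false by apply: contraNF H => /eqP ->; rewrite /small !expoE.
have -> : (e == 0) = false by apply: contraNF H => /eqP ->; rewrite /small !expoE.
by rewrite !addr0.
Qed.

Definition even_lform (l : @lform R L) :=
  [/\ gsign false l.1.1, gsign false l.1.2 & gsign false l.2].

Lemma in_S_even l : in_S l -> even_lform l.
Proof. by case: l => [[a0 a2] a12] []. Qed.

Lemma lser_central l : even_lform l -> central (lser l).
Proof.
move=> [e0 e2 e12] e q; rewrite lserE !mulrDl !mulrDr.
by congr (_ + _ + _); case: ifP => _; rewrite ?(mul0r, mulr0) //;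
   [apply: qc_central | apply: qc_central | apply: qe_central].
Qed.

Lemma lser_smulCA (V : lmodType Lam) l l' (g : series V) : even_lform l ->
  smul (lser l) (smul (lser l') g) = smul (lser l') (smul (lser l) g).
Proof.
move=> el; have A k k' : smul (lser k) (smul (lser k') g) = smul (lser k ** lser k') g.
  by apply: smulA_fsupp; [|apply: fsupp_locfin]; apply: lser_fsupp.
by rewrite (A l l') (A l' l) sprodC //; apply: lser_central.
Qed.

Lemma lserCA l l' f : even_lform l ->
  lser l ** (lser l' ** f) = lser l' ** (lser l ** f).
Proof. exact: (@lser_smulCA Lam^o). Qed.

Definition evens (d : seq (@lform R L)) := forall l, l \in d -> even_lform l.

Lemma lprod_mul d f : evens d ->
  fsupp (lprod d) /\ lprod d ** f = foldr (fun l g => lser l ** g) f d.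
Proof.
elim: d => [|l d IH] ed /=.
  split; last exact: const1_mul.
  exists 0%N => e; rewrite constE /qmono; case: (eqVneq e 0) => [->|_]; last by rewrite eqxx.
  by rewrite /small !expoE.
have [l' l'd|[M fM] E] := IH; first by apply: ed; rewrite inE l'd orbT.
rewrite -E; split; last first.
  by apply/esym/(@smulA_fsupp Lam^o); [exact: lser_fsupp | apply: fsupp_locfin; exists M].
exists M.+1 => e; rewrite lser_mul; apply: contraNT => H.
have h (e' : expo) : (`|e' X0| <= 1)%N -> (`|e' X1| <= 1)%N -> (`|e' X2| <= 1)%N ->
    (lprod d (e - e') : Q) = 0.
  move=> h0 h1 h2; apply/eqP; apply: contraNT H => /fM; rewrite /small !expoE; lia.
have -> : (lprod d e : Q) = 0 by rewrite -[e]subr0; apply: h; rewrite !expoE.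
by rewrite !h ?expoE // !mulr0 !addr0.
Qed.

End Monomials.

(** * Expansions of rational functions *)

(** The coefficient of [x^(-k-1) y^(k+1)] in [(a x + b y)] times the expansion of its
    inverse in nonnegative powers of [y]. *)
Lemma geometric_cancel (A : unitRingType) (a b : A) k :
  a \is a GRing.unit -> GRing.comm a b ->
  a * ((-1) ^+ k.+1 * b ^+ k.+1 * a ^- k.+2) + b * ((-1) ^+ k * b ^+ k * a ^- k.+1) = 0.
Proof.
move=> ua ab.
have -> : a ^- k.+2 = a ^- k.+1 * a^-1 by rewrite exprS invrM ?unitrX.
set s := (-1) ^+ k; set B := b ^+ k.+1; set A' := a ^- k.+1.
have as' : a * (-1) ^+ k.+1 = (-1) ^+ k.+1 * a by apply: commr_sign.
have bs : b * s = s * b by apply: commr_sign.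
have cb : a * (B * A') = (B * A') * a.
  by apply: commrM; [apply: commrX | apply/commrV/commrX].
have -> : a * ((-1) ^+ k.+1 * B * (A' * a^-1)) = (-1) ^+ k.+1 * (a * (B * A') * a^-1).
  by rewrite !mulrA as'.
have -> : b * (s * b ^+ k * A') = s * (B * A').
  by rewrite /B exprS !mulrA bs.
by rewrite cb mulrK // exprS mulN1r mulNr addNr.
Qed.

Section Cones.

Variables (R : realType) (L : option nat).
Local Notation C := R[i].
Local Notation Lam := (grassmann C L).
Local Notation Q := (osa R L).
Local Notation "f ** g" := (@sprod R L f g) (at level 40, left associativity).

(** Exponents of series with finitely many negative powers of [x_i] and bounded total
    degree: a product of such series is again one, and only finitely many terms
    contribute to each of its coefficients. *)
Definition cone (i : 'I_3) (N : nat) (e : expo) : bool :=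
  [&& e X1 == 0, - N%:Z <= e i & `|e X0 + e X2| <= N%:Z].

Definition incone (i : 'I_3) (f : series Lam) :=
  exists N, forall e, (f e : Q) != 0 -> cone i N e.

Definition x02 (i : 'I_3) := i = X0 \/ i = X2.

Lemma incone_prod i f g : x02 i -> incone i f -> incone i g ->
  incone i (f ** g) /\
  forall h, incone i h -> f ** (g ** h) = (f ** g) ** h.
Proof.
move=> hi [Nf hf] [Ng hg]; split.
  exists (Nf + Ng)%N => e; apply: contraNT => H; apply/eqP.
  apply: (@smul0E _ _ Lam^o) => d.
  have [->|/hf fd] := eqVneq (f d : Q) 0; [by left|right].
  apply/eqP; apply: contraNT H => /hg; move: fd.
  by rewrite /cone !expoE; lia.
move=> h [Nh hh]; apply: (@smulA _ _ Lam^o) => e.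
exists (Nf + Ng + Nh + `|e X0| + `|e X2| + Nf + Ng + Nh + Nf + Ng + Nh)%N => c c' /hf fc /hg gc /hh.
by move: fc gc; case: hi => ->; rewrite /cone /small !expoE; lia.
Qed.

Lemma inconeB i f g : incone i f -> incone i g -> incone i (f - g).
Proof.
move=> [Nf hf] [Ng hg]; exists (Nf + Ng)%N => e; rewrite serB; apply: contraNT => H.
have [->|/hf fe] := eqVneq (f e : Q) 0; last by move: fe H; rewrite /cone; lia.
have [->|/hg fe] := eqVneq (g e : Q) 0; last by move: fe H; rewrite /cone; lia.
by rewrite subr0.
Qed.

Lemma incone_supp i (f : series Lam) M : (forall e, (f e : Q) != 0 -> e X1 = 0 /\ small M e) -> incone i f.
Proof.
move=> h; exists (M + M)%N => e /h [e1]; rewrite /small /cone e1.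
have : i = X0 \/ i = X1 \/ i = X2.
  by case: i => [[|[|[|//]]] hi]; [left|right; left|right; right]; apply: val_inj.
by case=> [->|[->|->]]; rewrite ?e1; lia.
Qed.

Lemma incone_superpoly i f : superpoly f -> incone i f.
Proof.
move=> [N hN]; apply: (@incone_supp i f N) => e.
move=> /eqP H; have [b fb] : exists b, f e b != 0.
  apply: contrapT => nb; case: H; apply/funext => b.
  by apply/eqP/negPn/negP => fb; apply: nb; exists b.
have [/andP[? ?] e1 /andP[? ?]] := hN _ _ fb; split=> //.
by rewrite /small e1; lia.
Qed.

Lemma incone_lser i l : incone i (lser l).
Proof.
apply: (@incone_supp _ _ 1) => e; rewrite lserE => H; suff : e == xexp X0 1 \/ e == xexp X2 1 \/ e == 0.
  by case=> [/eqP ->|[/eqP ->|/eqP ->]]; rewrite /small !expoE.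
move: H; case: (e == xexp X0 1); first by left.
case: (e == xexp X2 1); first by right; left.
case: (e == 0); first by right; right.
by rewrite !addr0 eqxx.
Qed.

Lemma incone_lser_mul i l f : x02 i -> incone i f -> incone i (lser l ** f).
Proof. by move=> hi hf; case: (incone_prod hi (incone_lser i l) hf). Qed.

(** ** Inverses of linear forms *)

Lemma linvE i j (a b : Lam) e : [\/ i = X0 /\ j = X2 | i = X2 /\ j = X0] ->
  (linv i j a b e : Q) =
    if [&& e X1 == 0, e i + e j == -1 & 0 <= e j]
    then qc ((-1) ^+ `|e j|%N * b ^+ `|e j|%N * a ^- (`|e j|%N).+1) else 0.
Proof.
move=> hij; rewrite /linv.
have key (k : nat) : (e == xexp i (- k.+1%:Z) + xexp j k%:Z) =
    [&& e X1 == 0, e i + e j == -1, 0 <= e j & k == `|e j|%N].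
  by case: hij => -[-> ->]; rewrite expo_eq !expoE /=; lia.
rewrite (@ssum1 _ _ _ `|e j|%N).
  by rewrite monoE /qmono key eqxx andbT; case: ifP.
move=> k /negPf hk; rewrite monoE /qmono key hk !andbF //.
Qed.

Lemma linv_cone i j a b : [\/ i = X0 /\ j = X2 | i = X2 /\ j = X0] ->
  incone j (linv i j a b).
Proof.
move=> hij; exists 1%N => e; rewrite linvE //; case: ifP; last by rewrite eqxx.
by move=> h _; move: h; rewrite /cone; case: hij => -[-> ->]; lia.
Qed.

(** A nilpotent coefficient makes the expansion finite, so that it is also one in
    the opposite direction. *)
Lemma linv_cone_nilpotent i j a b k : [\/ i = X0 /\ j = X2 | i = X2 /\ j = X0] ->
  b ^+ k = 0 -> incone i (linv i j a b).
Proof.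
move=> hij bk; exists k.+1%N => e; rewrite linvE //; case: ifP; last by rewrite eqxx.
move=> h; have [kj|jk _] := leqP k `|e j|%N.
  have -> : b ^+ `|e j|%N = 0 by rewrite -(subnKC kj) exprD bk mul0r.
  by rewrite mulr0 mul0r /qc qm0 eqxx.
by move: h jk; rewrite /cone; case: hij => -[-> ->]; lia.
Qed.

Definition lin (a0 a2 : Lam) : series Lam := lser (a0, a2, 0).

Lemma linv_inverse i j a0 a2 a b :
  [\/ [/\ i = X0, j = X2, a = a0 & b = a2] | [/\ i = X2, j = X0, a = a2 & b = a0]] ->
  a \is a GRing.unit -> GRing.comm a b ->
  lin a0 a2 ** linv i j a b = const 1.
Proof.
move=> hij ua ab; apply/funext => e.
have hij' : [\/ i = X0 /\ j = X2 | i = X2 /\ j = X0].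
  by case: hij => -[-> -> _ _]; [left|right].
have -> : (lin a0 a2 ** linv i j a b) e =
    qc a * (linv i j a b (e - xexp i 1) : Q) + qc b * (linv i j a b (e - xexp j 1) : Q).
  rewrite lser_mul /= /qe qm0 mul0r addr0.
  by case: hij => -[-> -> -> ->] //; rewrite addrC.
have h1 : (e - xexp i 1) X1 = e X1 by case: hij' => -[ei ej]; rewrite ?ei ?ej !expoE subr0.
have h1' : (e - xexp j 1) X1 = e X1 by case: hij' => -[ei ej]; rewrite ?ei ?ej !expoE subr0.
have hi : (e - xexp i 1) i = e i - 1 by rewrite !expoE eqxx.
have hj : (e - xexp j 1) j = e j - 1 by rewrite !expoE eqxx.
have hji : (e - xexp i 1) j = e j by case: hij' => -[ei ej]; rewrite ?ei ?ej !expoE subr0.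
have hij2 : (e - xexp j 1) i = e i by case: hij' => -[ei ej]; rewrite ?ei ?ej !expoE subr0.
have e0 : (e == 0) = [&& e X1 == 0, e i + e j == 0 & e j == 0].
  by case: hij' => -[-> ->]; rewrite expo_eq !expoE; lia.
rewrite constE /qmono e0 !linvE // h1 h1' hi hj hij2 hji.
have -> : e i - 1 + e j = e i + e j - 1 by lia.
have -> : e i + (e j - 1) = e i + e j - 1 by lia.
have -> : (e i + e j - 1 == -1) = (e i + e j == 0) by lia.
case: (e X1 == 0); last by rewrite !mulr0 addr0.
case: (e i + e j == 0); last by rewrite !mulr0 addr0.
rewrite /=; case: (e j) => [[|k]|k]; first last.
- by rewrite !mulr0 addr0.
- have -> : (0 <= Posz k.+1) = true by [].
  have -> : (0 <= Posz k.+1 - 1) = true by lia.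
  have -> : `|Posz k.+1|%N = k.+1 by [].
  have -> : `|(Posz k.+1 - 1)%R|%N = k by lia.
  by rewrite -!qcM -qmD geometric_cancel // qm0.
rewrite /= !mulr0 addr0 expr0 !mul1r expr1.
by rewrite -qcM divrr.
Qed.

Definition is_inverse i (l : @lform R L) (J : series Lam) :=
  incone i J /\ lser l ** J = const 1.

(** Since [phi_1 phi_2] squares to zero, the geometric series in it around the inverse [E] of
    the part without odd variables stops after two terms. *)
Lemma lser_inverse i a0 a2 a12 E : x02 i ->
  incone i E -> lin a0 a2 ** E = const 1 -> even_lform (a0, a2, a12) ->
  is_inverse i (a0, a2, a12) (E - const a12 ** (phi12 R L ** (E ** E))).
Proof.
move=> hi iE E1 [e0 e2 e12].
have [iEE assE] := incone_prod hi iE iE.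
have EE e : (const a12 ** (phi12 R L ** (E ** E))) e = qe a12 * ((E ** E) e : Q).
  by rewrite constE /phi12 monoE !qmono_mul !subr0 mulrA -/(qe 1) qcqe mulr1.
split.
  apply: inconeB => //; case: iEE => N hN; exists N => e; rewrite EE => h.
  by apply: hN; apply: contraNneq h => ->; rewrite mulr0.
have lEE : lin a0 a2 ** (E ** E) = E.
  have [_ ->] := incone_prod hi (incone_lser i (a0, a2, 0)) iE; last by [].
  by rewrite E1 const1_mul.
apply/funext => e.
have := congr1 (fun f : series Lam => (f e : Q)) E1.
have := congr1 (fun f : series Lam => (f e : Q)) lEE.
rewrite !lser_mul /= /qe qm0 !mul0r !addr0 -/(qe _) => h2 h1.
rewrite !serB !EE !mulrBr !mulrA qeqe mul0r subr0.
rewrite (qc_central (qe a12) e0) (qc_central (qe a12) e2) -!mulrA.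
rewrite addrACA -opprD -mulrDr h1 h2.
by rewrite -addrA addNr addr0.
Qed.

(** A form whose [x_2] coefficient has no body must have an invertible [x_0] coefficient. *)
Lemma iota20_inverse l : in_S l -> is_inverse X0 l (iota20_inv l).
Proof.
case: l => [[a0 a2] a12] [e0 e2 e12 nz]; rewrite /iota20_inv.
apply: lser_inverse; [by left| | |by split].
  case: ifP => h2; first by apply: linv_cone; right.
  have [k a2k] := body0_nilpotent (eqP (negbFE h2)).
  by apply: linv_cone_nilpotent a2k; left.
case: ifP => h2.
  by apply: linv_inverse; [right|apply: body_unit|apply: even_central].
case: nz => // h0; last by rewrite h0 in h2.
by apply: linv_inverse; [left|apply: body_unit|apply: even_central].
Qed.

Lemma iota02_inverse l : in_S l -> is_inverse X2 l (iota02_inv l).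
Proof.
case: l => [[a0 a2] a12] [e0 e2 e12 nz]; rewrite /iota02_inv.
apply: lser_inverse; [by right| | |by split].
  case: ifP => h0; first by apply: linv_cone; left.
  have [k a0k] := body0_nilpotent (eqP (negbFE h0)).
  by apply: linv_cone_nilpotent a0k; right.
case: ifP => h0.
  by apply: linv_inverse; [left|apply: body_unit|apply: even_central].
case: nz => // h2; first by rewrite h2 in h0.
by apply: linv_inverse; [right|apply: body_unit|apply: even_central].
Qed.

Definition all_in_S (d : seq (@lform R L)) := forall l, l \in d -> in_S l.

Lemma all_in_S_even d : all_in_S d -> evens d.
Proof. by move=> h l /h /in_S_even. Qed.

Section Localization.

Variables (i : 'I_3) (inv : @lform R L -> series Lam).
Hypotheses (hi : x02 i) (invP : forall l, in_S l -> is_inverse i l (inv l)).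

Lemma mul_inv l f : in_S l -> incone i f -> lser l ** (inv l ** f) = f.
Proof.
move=> hl hf; have [iJ J1] := invP hl.
have [_ ->] := incone_prod hi (incone_lser i l) iJ; last by [].
by rewrite J1 const1_mul.
Qed.

Lemma inv_mul l f : in_S l -> incone i f -> inv l ** (lser l ** f) = f.
Proof.
move=> hl hf; have [iJ J1] := invP hl.
have [_ ->] := incone_prod hi iJ (incone_lser i l); last by [].
rewrite -(@sprodC _ _ (lser l) (inv l)); last exact/lser_central/in_S_even.
by rewrite J1 const1_mul.
Qed.

Lemma incone_inv l f : in_S l -> incone i f -> incone i (inv l ** f).
Proof. by move=> /invP[iJ _] hf; case: (incone_prod hi iJ hf). Qed.

Lemma incone_expansion d k : all_in_S d -> incone i k ->
  incone i (foldr (fun l f => inv l ** f) k d).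
Proof.
move=> + hk; elim: d => [//|l d IH] hd /=.
apply: incone_inv; first by apply: hd; rewrite inE eqxx.
by apply: IH => l' l'd; apply: hd; rewrite inE l'd orbT.
Qed.

Lemma lprod_lser d l f : all_in_S d ->
  foldr (fun l g => lser l ** g) (lser l ** f) d =
  lser l ** foldr (fun l g => lser l ** g) f d.
Proof.
elim: d => [//|l' d IH] hd /=; rewrite IH; last by move=> k kd; apply: hd; rewrite inE kd orbT.
by apply/lserCA/in_S_even/hd; rewrite inE eqxx.
Qed.

(** Multiplying by the denominators in any order undoes their expansions one by one,
    because linear forms are central. *)
Lemma lprod_expansion d k : all_in_S d -> incone i k ->
  lprod d ** foldr (fun l f => inv l ** f) k d = k.
Proof.
move=> hd hk; rewrite (proj2 (lprod_mul _ (all_in_S_even hd))).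
elim: d hd => [//|l d IH] hd /=.
have hd' : all_in_S d by move=> l' l'd; apply: hd; rewrite inE l'd orbT.
have hl : in_S l by apply: hd; rewrite inE eqxx.
by rewrite -lprod_lser // mul_inv ?IH //; apply: incone_expansion.
Qed.

Lemma expansion_lprod d f : all_in_S d -> incone i f ->
  foldr (fun l g => inv l ** g) (lprod d ** f) d = f.
Proof.
move=> hd hf; rewrite (proj2 (lprod_mul _ (all_in_S_even hd))).
elim: d f hf hd => [//|l d IH] f hf hd /=.
have hd' : all_in_S d by move=> l' l'd; apply: hd; rewrite inE l'd orbT.
have hl : in_S l by apply: hd; rewrite inE eqxx.
by rewrite -lprod_lser // IH ?inv_mul //; apply: incone_lser_mul.
Qed.

End Localization.

(** ** The substitution of [phi_1 - phi_2] for [phi_1] *)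

Definition osubst (q : Q) : Q := fun b =>
  if b == (false, true) then q b - q (true, false) else q b.

Lemma ssubstE (f : series Lam) e : ssubst f e = osubst (f e). Proof. by []. Qed.

(** The substitution fixes the coefficients of the linear forms, as they
    involve the odd variables only through [phi_1 phi_2]. *)
Lemma osubst_mul (a q : Q) : a (true, false) = 0 -> a (false, true) = 0 ->
  osubst (a * q) = a * osubst q.
Proof.
move=> a1 a2; apply: oserP; rewrite !osaMx /osubst /= ?osaMx ?a1 ?a2 ?gpar0 ?mul0r //.
by rewrite !add0r mulrBr.
Qed.

Lemma osubstD (q q' : Q) : osubst (q + q') = osubst q + osubst q'.
Proof. by apply: oserP; rewrite ?osaD /osubst //= !osaD opprD addrACA. Qed.

Lemma osubst_inj : injective osubst.
Proof.
move=> q q' qq'; have h b := congr1 (fun f : Q => f b) qq'.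
apply: oserP; [exact: (h (false, false))|exact: (h (true, false))| |exact: (h (true, true))].
have := h (false, true); rewrite /osubst /= (h (true, false) : q (true, false) = _).
by move/addIr.
Qed.

Lemma ssubst_lser l f : ssubst (lser l ** f) = lser l ** ssubst f.
Proof.
apply/funext => e; rewrite lser_mul !ssubstE lser_mul !osubstD.
by congr (_ + _ + _); apply: osubst_mul.
Qed.

Lemma ssubst_lprod d f : evens d -> ssubst (lprod d ** f) = lprod d ** ssubst f.
Proof.
move=> ed; rewrite (proj2 (lprod_mul f ed)) (proj2 (lprod_mul (ssubst f) ed)).
by elim: d {ed} => [//|l d IH] /=; rewrite ssubst_lser IH.
Qed.

Lemma ssubst_inj : injective (@ssubst Lam).
Proof.
move=> f f' ff'; apply/funext => e; apply: osubst_inj.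
by rewrite -!ssubstE ff'.
Qed.

Lemma superpoly_ssubst (f : series Lam) : superpoly f -> superpoly (ssubst f).
Proof.
move=> [N hN]; exists N => e b; rewrite /ssubst; case: ifP => _; last exact: hN.
have [->|/hN //] := eqVneq (f e b) 0; rewrite sub0r oppr_eq0; exact: hN.
Qed.

Definition ssubst_inv (f : series Lam) : series Lam := fun e b =>
  if b == (false, true) then f e b + f e (true, false) else f e b.

Lemma ssubst_invK f : ssubst (ssubst_inv f) = f.
Proof.
apply/funext => e; apply: oserP; rewrite /ssubst /ssubst_inv //=.
by rewrite addrK.
Qed.

Lemma superpoly_ssubst_inv f : superpoly f -> superpoly (ssubst_inv f).
Proof.
move=> [N hN]; exists N => e b; rewrite /ssubst_inv; case: ifP => _; last exact: hN.
have [->|/hN //] := eqVneq (f e b) 0; rewrite add0r; exact: hN.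
Qed.

End Cones.

(** * Binomial series and delta functions *)

Section Binomial.

Variables (R : realType).
Local Notation C := R[i].
Local Notation binz n k := (@binz R n k).

Lemma binz0 n : binz n 0 = 1.
Proof. by rewrite /Defs.binz big_ord0 divr1. Qed.

Lemma natC_neq0 k : (k.+1%:R : C) != 0.
Proof. by rewrite pnatr_eq0. Qed.

Lemma factC_neq0 k : (k`!%:R : C) != 0.
Proof. by rewrite pnatr_eq0 -lt0n fact_gt0. Qed.

Lemma binzSr n k : binz n k.+1 * k.+1%:R = binz n k * (n%:~R - k%:R).
Proof.
rewrite /Defs.binz big_ord_recr /= factS natrM invfM.
by field; rewrite factC_neq0 nat1r natC_neq0.
Qed.

Lemma binzSl n k : binz n k.+1 * k.+1%:R = n%:~R * binz (n - 1) k.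
Proof.
rewrite /Defs.binz big_ord_recl /= factS natrM invfM subr0.
rewrite (eq_bigr (fun j : 'I_k => (n - 1)%:~R - j%:R)).
  by field; rewrite factC_neq0 nat1r natC_neq0.
by move=> j _; rewrite /bump /= add1n -natr1 rmorphB /=; ring.
Qed.

Lemma binz_absorb n k : (n%:~R - k%:R) * binz n k = n%:~R * binz (n - 1) k.
Proof. by rewrite -binzSl binzSr mulrC. Qed.

Lemma binz_pascal n k : binz (n + 1) k.+1 = binz n k + binz n k.+1.
Proof.
apply: (mulIf (natC_neq0 k)); rewrite mulrDl binzSl binzSr addrK rmorphD /= -natr1.
by ring.
Qed.

Lemma binz_reflect n k : binz (- n - 1) k = (-1) ^+ k * binz (n + k%:Z) k.
Proof.
elim: k n => [|k IH] n; first by rewrite !binz0 expr0 mulr1.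
apply: (mulIf (natC_neq0 k)); rewrite binzSr IH -[RHS]mulrA binzSl.
have -> : (n + k.+1%:Z - 1 = n + k%:Z)%R by lia.
by rewrite exprS !(rmorphB, rmorphD, rmorphN) /= -!pmulrn -natr1; ring.
Qed.

(** the coefficient of [x^p y^q] in [(x + c y)^n], expanded in nonnegative
    powers of [y] *)
Definition bcoef (c : C) (n p q : int) : C :=
  if (0 <= q) && (p + q == n) then binz n `|q|%N * c ^+ `|q|%N else 0.

Lemma bcoef_pascal c n p q :
  bcoef c (n + 1) p q = bcoef c n (p - 1) q + c * bcoef c n p (q - 1).
Proof.
rewrite /bcoef (_ : (p - 1 + q == n) = (p + q == n + 1)); last by lia.
rewrite (_ : (p + (q - 1) == n) = (p + q == n + 1)); last by lia.
case: (p + q == n + 1); rewrite ?andbT ?andbF ?mulr0 ?addr0 //.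
case: q => [[|k]|k] //=; rewrite ?mulr0 ?addr0 //.
  by rewrite !binz0.
by rewrite subn1 /= binz_pascal exprS; ring.
Qed.

End Binomial.

Section Delta.

Variables (R : realType) (L : option nat).
Local Notation C := R[i].
Local Notation Lam := (grassmann C L).
Local Notation Q := (osa R L).
Local Notation "f ** g" := (@sprod R L f g) (at level 40, left associativity).
Local Notation scal c := (gscalar L (c : C)).
Local Notation sq c := (qc (scal c)).
Local Notation se c := (qe (scal c)).

Definition third (i j k : 'I_3) := uniq [:: i; j; k].

Lemma third_cover i j k l : third i j k -> [|| l == i, l == j | l == k].
Proof.
rewrite /third /= !inE -!val_eqE.
by case: i => [[|[|[|//]]] ?]; case: j => [[|[|[|//]]] ?];
  case: k => [[|[|[|//]]] ?]; case: l => [[|[|[|//]]] ?].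
Qed.

Lemma xbinE i j k c n e : third i j k -> (@xbin R L i j c n e : Q) =
  if e k == 0 then sq (bcoef c n (e i) (e j)) else 0.
Proof.
move=> ijk; rewrite /xbin /bcoef.
have key (m : nat) : (e == xexp i (n - m%:Z) + xexp j m%:Z) =
    [&& e k == 0, 0 <= e j, e i + e j == n & m == `|e j|%N].
  have := ijk; rewrite /third /= !inE => /and3P[/norP[ij ik] jk _].
  apply/eqP/idP => [->|].
    by rewrite !expoE !eqxx ![k == _]eq_sym [j == i]eq_sym (negPf ij) (negPf ik) (negPf jk); lia.
  case/and4P => /eqP hk hj /eqP hn /eqP hm; apply/ffunP => l; rewrite !expoE.
  rewrite ![_ == i]eq_sym ![_ == j]eq_sym.
  case/or3P: (third_cover l ijk) => /eqP ->.
  - by rewrite eqxx (eq_sym j) (negPf ij) hm addr0 gez0_abs // -hn addrK.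
  - by rewrite (negPf ij) eqxx hm add0r gez0_abs.
  - by rewrite (negPf ik) (negPf jk) hk.
rewrite (@ssum1 _ _ _ `|e j|%N).
  by rewrite monoE /qmono key eqxx andbT; case: (e k == 0); case: (0 <= e j);
    case: (_ == n); rewrite ?gscalar0 /= /qc ?qm0.
by move=> m /negPf hm; rewrite monoE /qmono key hm !andbF.
Qed.

(** the coefficient of [x_i^p x_j^q] in [(x_i + c x_j + d phi_1 phi_2)^n] *)
Definition ocoef (c d : C) (n p q : int) : Q :=
  sq (bcoef c n p q) + se (d * n%:~R * bcoef c (n - 1) p q).

Lemma xobinE i j k c d n e : third i j k -> (@xobin R L i j c d n e : Q) =
  if e k == 0 then ocoef c d n (e i) (e j) else 0.
Proof.
move=> ijk; rewrite /xobin serD constE /phi12 monoE !qmono_mul !subr0 !(xbinE _ _ _ ijk).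
case: ifP => _; last by rewrite !mulr0 addr0.
by rewrite -/(qe 1) qeqc mul1r qcqe -gscalarM.
Qed.

Lemma ocoef_central c d n p q (f : Q) : ocoef c d n p q * f = f * ocoef c d n p q.
Proof.
by rewrite /ocoef mulrDl mulrDr qc_central ?qe_central //; apply: gscalar_even.
Qed.

Lemma ocoef_pascal c d n p q : ocoef c d (n + 1) p q =
  ocoef c d n (p - 1) q + sq c * ocoef c d n p (q - 1) + se d * ocoef c d n p q.
Proof.
rewrite /ocoef bcoef_pascal addrK !mulrDr -!qcM !qcqe qeqc qeqe addr0 -!gscalarM.
rewrite addrACA -qmD -gscalarD -addrA -!qmD -!gscalarD; congr (_ + qe (scal _)).
have := bcoef_pascal c (n - 1) p q; rewrite subrK => ->.
by rewrite rmorphD /=; ring.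
Qed.

Lemma ocoef_supp c d n p q : ocoef c d n p q != 0 -> 0 <= q /\ n - 1 <= p + q <= n.
Proof.
rewrite /ocoef /bcoef => H; split; move: H.
  by case: (0 <= q) => //=; rewrite !mulr0 gscalar0 /qc /qe !qm0 addr0 eqxx.
case: (eqVneq (p + q) n) => [|h1]; first by move=> -> _; lia.
case: (eqVneq (p + q) (n - 1)) => [|h2]; first by move=> -> _; lia.
by rewrite !andbF mulr0 gscalar0 /qc /qe !qm0 addr0 eqxx.
Qed.

(** The delta function of [(x_1 - x_2 - phi_1 phi_2) / x_0] is also that of
    [(x_0 + x_2 + phi_1 phi_2) / x_1]: both sides are its coefficient of [x_0^m x_1^n x_2^k]. *)
Lemma ocoef_swap n m k : ocoef (-1) (-1) (- m - 1) n k = ocoef 1 1 (- n - 1) m k.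
Proof.
rewrite /ocoef /bcoef; case: k => k; last by rewrite !mulr0.
rewrite (_ : 0 <= Posz k = true) // !andTb !expr1n !mulr1.
rewrite (_ : (n + k%:Z == - m - 1) = (m + k%:Z == - n - 1)); last by lia.
rewrite (_ : (n + k%:Z == - m - 1 - 1) = (m + k%:Z == - n - 1 - 1)); last by lia.
have sgn2 : (-1) ^+ k * (-1) ^+ k = 1 :> C by rewrite -expr2 sqrr_sign.
congr (sq _ + se _).
  case: eqP => // h; rewrite (_ : - m - 1 = n + k%:Z); last by lia.
  by rewrite binz_reflect mulrC.
case: eqP => [h|]; last by rewrite !mulr0.
have -> : - m - 1 = n + 1 + k%:Z by lia.
rewrite (_ : n + 1 + k%:Z - 1 = n + k%:Z); last by lia.
rewrite mul1r -[in RHS]binz_absorb binz_reflect.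
by rewrite !(rmorphB, rmorphD, rmorphN) /= -!pmulrn; ring.
Qed.

Lemma binz_eq0 (m k : nat) : (m < k)%N -> binz R m k = 0.
Proof. by move=> mk; rewrite /binz (bigD1 (Ordinal mk)) //= subrr !mul0r. Qed.

Lemma ocoef0 c d p q : ocoef c d 0 p q = ((p == 0) && (q == 0))%:R.
Proof.
rewrite /ocoef mulr0 mul0r gscalar0 /qe qm0 addr0 /bcoef; case: q => [[|k]|k].
- by rewrite addr0 andbT; case: eqP; rewrite ?binz0 ?expr0 ?mulr1 ?gscalar1 ?gscalar0 /qc ?qm0.
- rewrite andbF; case: ifP; last by rewrite gscalar0 /qc qm0.
  by rewrite binz_eq0 ?mul0r ?gscalar0 /qc ?qm0.
- by rewrite andbF gscalar0 /qc qm0.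
Qed.

(** Among the powers of [x_1 - x_0 - phi_1 phi_2] only the inverse contains [x_1^(-1)]:
    nonnegative powers are polynomials, and for [n < -1] all exponents of [x_1]
    are less than [-1]. *)
Lemma ocoef_residue n q : ocoef (-1) (-1) n (-1) q = ((n == -1) && (q == 0))%:R.
Proof.
rewrite /ocoef /bcoef; case: q => [[|k]|k] /=; first last.
- by rewrite andbF mulr0 gscalar0 /qc /qe !qm0 addr0.
- rewrite andbF (_ : (-1 + k.+1%:Z == n) = (n == k%:Z)); last by lia.
  rewrite (_ : (-1 + k.+1%:Z == n - 1) = (n == k.+1%:Z)); last by lia.
  case: eqP => [->|_].
    rewrite binz_eq0 ?mul0r //.
    rewrite (_ : (k%:Z == k.+1%:Z) = false); last by lia.
    by rewrite mulr0 gscalar0 /qc /qe !qm0 addr0.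
  case: eqP => [->|_]; last by rewrite mulr0 gscalar0 /qc /qe !qm0 addr0.
  by rewrite -addn1 PoszD addrK binz_eq0 ?mul0r ?mulr0 ?gscalar0 /qc /qe ?qm0 ?addr0 // addn1.
rewrite !addr0 andbT [n == -1]eq_sym (_ : (-1 == n - 1) = (n == 0)); last by lia.
case: eqP => [<-|_] /=.
  by rewrite binz0 expr0 mulr1 mulr0 gscalar1 gscalar0 /qe qm0 addr0 qc1.
case: eqP => [->|_]; rewrite ?mulr0 ?mul0r gscalar0 /qc /qe !qm0 addr0 //.
Qed.

(** ** Delta functions *)

(** At a given exponent of [x_k] a single power contributes to the delta function. *)
Lemma sdeltaE k (P : int -> series Lam) (q : int -> Q) (S : int -> series Lam) e :
  (forall n e, (P n e : Q) != 0 -> e k = 0) ->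
  (forall n, S n = qmono (xexp k n) (q n)) ->
  (sdelta P S e : Q) = (P (- e k) (e - xexp k (e k)) : Q) * q (e k).
Proof.
move=> hP hS; rewrite /sdelta (@ssum1 _ _ _ (- e k)).
  by rewrite hS mul_qmono opprK.
move=> n nk; rewrite hS mul_qmono.
have [->|/hP] := eqVneq (P n (e - xexp k (- n)) : Q) 0; first by rewrite mul0r.
by rewrite !expoE eqxx => h; case/eqP: nk; lia.
Qed.

Definition delta k (P : int -> series Lam) : series Lam :=
  xpow R L k (-1) ** sdelta P (xpow R L k).

Lemma xpowE k n : xpow R L k n = qmono (xexp k n) 1.
Proof. by rewrite /xpow monoE. Qed.

Lemma deltaE i j k c d e : third i j k ->
  (delta k (@xobin R L i j c d) e : Q) = ocoef c d (- e k - 1) (e i) (e j).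
Proof.
move=> ijk; rewrite /delta xpowE qmono_mul mul1r.
have ki : (i == k) = false /\ (j == k) = false.
  by have := ijk; rewrite /third /= !inE => /and3P[/norP[_ /negPf ->] /negPf -> _].
rewrite (@sdeltaE k _ (fun=> 1)) ?mulr1; last exact: xpowE.
  rewrite (xobinE _ _ _ _ ijk) !expoE eqxx !ki.1 !ki.2 subrr eqxx !subr0 opprK.
  by congr ocoef; lia.
by move=> n e'; rewrite (xobinE _ _ _ _ ijk); case: ifP => [/eqP //|]; rewrite eqxx.
Qed.

Lemma delta_flip_supp (e : expo) : e X1 < 0 ->
  ((xpow R L X0 (-1) ** sdelta (@xobin R L X2 X1 (-1) 1) (@xpowN R L X0)) e : Q) = 0.
Proof.
move=> e1; rewrite xpowE qmono_mul mul1r.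
rewrite (@sdeltaE X0 _ (fun n => sq ((-1) ^ n))); first last.
- by move=> n; rewrite /xpowN monoE.
- by move=> n e'; rewrite (@xobinE X2 X1 X0) //; case: ifP => [/eqP //|]; rewrite eqxx.
rewrite (@xobinE X2 X1 X0) // !expoE.
case: ifP => _; last by rewrite mul0r.
set o := ocoef _ _ _ _ _; have [->|/ocoef_supp[]] := eqVneq o 0; first by rewrite mul0r.
by rewrite subr0; lia.
Qed.

Lemma delta_flip_residue (e : expo) : e X0 = -1 ->
  ((xpow R L X0 (-1) ** sdelta (@xobin R L X2 X1 (-1) 1) (@xpowN R L X0)) e : Q) =
  ((e X1 == 0) && (e X2 == 0))%:R.
Proof.
move=> e0; rewrite xpowE qmono_mul mul1r.
rewrite (@sdeltaE X0 _ (fun n => sq ((-1) ^ n))); first last.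
- by move=> n; rewrite /xpowN monoE.
- by move=> n e'; rewrite (@xobinE X2 X1 X0) //; case: ifP => [/eqP //|]; rewrite eqxx.
rewrite (@xobinE X2 X1 X0) // !expoE e0 /= !subr0 (_ : -1 - -1 = 0 :> int) //.
by rewrite oppr0 expr0z gscalar1 qc1 mulr1 ocoef0 andbC.
Qed.

End Delta.

Definition zbox (M : nat) : seq int := [seq (k%:Z - M%:Z) | k <- iota 0 (M + M).+1].

Lemma zbox_uniq M : uniq (zbox M).
Proof. by rewrite map_inj_uniq ?iota_uniq // => a b; lia. Qed.

Lemma mem_zbox M (n : int) : (`|n| <= M)%N -> n \in zbox M.
Proof.
move=> h; apply/mapP; exists `|(n + M%:Z)%R|%N; last by lia.
by rewrite mem_iota; lia.
Qed.

(** * Coefficients of the products and iterates of vertex operators *)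

Section Vertex.

Variables (R : realType) (L : option nat).
Local Notation C := R[i].
Local Notation Lam := (grassmann C L).
Local Notation Q := (osa R L).
Local Notation "f ** g" := (@sprod R L f g) (at level 40, left associativity).
Variables (V : lmodType Lam) (D : ns_vosa V).
Local Notation W := (oser V).
Local Notation md := (mode D).
Local Notation par := (vpar D).
Implicit Types (e d : expo) (u v w : V).

Lemma vparD b x y : par b (x + y) = par b x + par b y.
Proof. by case: b => //=; rewrite !sgD opprD addrACA. Qed.

Lemma add_zero (A B : zmodType) (f : A -> B) : {morph f : x y / x + y} -> f 0 = 0.
Proof. by move=> fD; apply: (@addrI _ (f 0)); rewrite -fD !addr0. Qed.

Lemma vpar0 b : par b 0 = 0. Proof. exact/add_zero/vparD. Qed.

Lemma mode0r u k : md u k 0 = 0.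
Proof. by apply: add_zero => x y; apply: modeDr. Qed.

Lemma mode0l k w : md 0 k w = 0.
Proof. by apply: (@add_zero _ _ (fun u => md u k w)) => x y; apply: modeDl. Qed.

(** the action of an operator on the coefficient of one even monomial, the parity
    involution giving the sign of its passage past the odd variables *)
Definition oact_op (A : V -> V) (g : W) : W :=
  fun b => par (oodd b) (A (par (oodd b) (g b))).

(** the coefficient of [x^(-n-1)] in [Y(u, (x, psi))], applied to [g] *)
Definition ymode (psi : Q) (u : V) (n : int) (g : W) : W :=
  oact_op (md u (2 * n)) g + psi *: oact_op (md u (2 * n - 1)) g.

Lemma oact_op0 A : A 0 = 0 -> oact_op A 0 = 0.
Proof. by move=> A0; apply/funext => b; rewrite /oact_op oser0 vpar0 A0 vpar0. Qed.

Lemma oact_opD u k g g' : oact_op (md u k) (g + g') = oact_op (md u k) g + oact_op (md u k) g'.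
Proof. by apply/funext => b; rewrite /oact_op !oserD vparD modeDr vparD. Qed.

Lemma oact_opDl u u' k g : oact_op (md (u + u') k) g = oact_op (md u k) g + oact_op (md u' k) g.
Proof. by apply/funext => b; rewrite /oact_op oserD modeDl vparD. Qed.

Lemma ymode0 psi u n : ymode psi u n 0 = 0.
Proof. by rewrite /ymode !oact_op0 ?mode0r // scaler0 addr0. Qed.

Lemma ymode0l psi n g : ymode psi 0 n g = 0.
Proof.
have h k : oact_op (md 0 k) g = 0.
  by apply/funext => b; rewrite /oact_op mode0l vpar0.
by rewrite /ymode !h scaler0 addr0.
Qed.

Lemma ymodeD psi u n g g' : ymode psi u n (g + g') = ymode psi u n g + ymode psi u n g'.
Proof. by rewrite /ymode !oact_opD scalerDr addrACA. Qed.

Lemma ymodeDl psi u u' n g : ymode psi (u + u') n g = ymode psi u n g + ymode psi u' n g.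
Proof. by rewrite /ymode !oact_opDl scalerDr addrACA. Qed.

Definition cvec (w : V) : W := fun b => if b == (false, false) then w else 0.

Lemma cvecD w w' : cvec (w + w') = cvec w + cvec w'.
Proof. by apply/funext => b; rewrite oserD /cvec; case: ifP; rewrite ?addr0. Qed.

Lemma const_cvec w e : const w e = if e == 0 then cvec w else 0 :> W.
Proof.
by apply/funext => b; rewrite /const /mono /cvec; case: (e == 0).
Qed.

Definition qphi1 : Q := qm (true, false) 1.
Definition qphi2 : Q := qm (false, true) 1.

Lemma phi1E : phi1 R L = qmono 0 qphi1. Proof. exact: monoE. Qed.
Lemma phi2E : phi2 R L = qmono 0 qphi2. Proof. exact: monoE. Qed.
Lemma phi1B2E : phi1 R L - phi2 R L = qmono 0 (qphi1 - qphi2).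
Proof.
rewrite phi1E phi2E; apply/funext => e; rewrite serB /qmono.
by case: eqP; rewrite ?subr0.
Qed.

Lemma xpow_act i n (g : series V) e : smul (xpow R L i n) g e = g (e - xexp i n) :> W.
Proof. by rewrite xpowE qmono_act scale1r. Qed.

Lemma const_act (c : Lam) (g : series V) e : smul (const c) g e = qc c *: (g e : W).
Proof. by rewrite constE qmono_act subr0. Qed.

Lemma Yop_xpow i q u (g : series V) e : (forall e, (g e : W) != 0 -> e i = 0) ->
  Yop D md (xpow R L i) (qmono 0 q) u g e =
    ymode q u (- e i - 1) (g (e - xexp i (e i))) :> W.
Proof.
move=> hg; rewrite /Yop (@ssum1 _ _ _ (- e i - 1)).
  rewrite serD qmono_act subr0 !xpow_act.
  by rewrite (_ : - (- e i - 1) - 1 = e i) //; lia.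
move=> n hn; rewrite serD qmono_act subr0 !xpow_act.
have g0 : (g (e - xexp i (- n - 1)) : W) = 0.
  apply: contraNeq hn => /hg; rewrite !expoE eqxx => h.
  by apply/eqP; lia.
rewrite /opact g0 -/(oact_op (md u (2 * n)) 0) -/(oact_op (md u (2 * n - 1)) 0).
by rewrite !oact_op0 ?mode0r // scaler0 addr0.
Qed.

Lemma Yconst i q u w e :
  Yop D md (xpow R L i) (qmono 0 q) u (const w) e =
    if e - xexp i (e i) == 0 then ymode q u (- e i - 1) (cvec w) else 0 :> W.
Proof.
rewrite Yop_xpow => [|e']; last first.
  by rewrite const_cvec; case: (eqVneq e' 0) => [->|_]; rewrite ?expo0 ?eqxx.
by rewrite const_cvec; case: ifP => _ //; rewrite ymode0.
Qed.

(** the coefficient of [x_1^(-n-1) x_2^(-m-1)] in [Y(u, (x_1, phi_1)) Y(v, (x_2, phi_2)) w] *)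
Definition Fprod u v w n m := ymode qphi1 u n (ymode qphi2 v m (cvec w)).

Lemma Y2constE v w e : Y2 D md v (const w) e =
  if (e X0 == 0) && (e X1 == 0) then ymode qphi2 v (- e X2 - 1) (cvec w) else 0 :> W.
Proof.
rewrite /Y2 phi2E Yconst; congr (if _ then _ else _).
by rewrite expo_eq !expoE; lia.
Qed.

Lemma Y1constE v w e : Y1 D md v (const w) e =
  if (e X0 == 0) && (e X2 == 0) then ymode qphi1 v (- e X1 - 1) (cvec w) else 0 :> W.
Proof.
rewrite /Y1 phi1E Yconst; congr (if _ then _ else _).
by rewrite expo_eq !expoE; lia.
Qed.

Lemma Y12E u v w e : Y1 D md u (Y2 D md v (const w)) e =
  if e X0 == 0 then Fprod u v w (- e X1 - 1) (- e X2 - 1) else 0 :> W.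
Proof.
rewrite /Y1 phi1E Yop_xpow => [|e'].
  rewrite Y2constE !expoE subrr eqxx !subr0 andbT.
  by case: ifP => // _; rewrite ymode0.
by rewrite Y2constE; case: ifP => [/andP[_ /eqP]//|_]; rewrite eqxx.
Qed.

Lemma Y21E u v w e : Y2 D md v (Y1 D md u (const w)) e =
  if e X0 == 0 then ymode qphi2 v (- e X2 - 1) (ymode qphi1 u (- e X1 - 1) (cvec w)) else 0 :> W.
Proof.
rewrite /Y2 phi2E Yop_xpow => [|e'].
  rewrite Y1constE !expoE subrr eqxx !subr0 andbT.
  by case: ifP => // _; rewrite ymode0.
by rewrite Y1constE; case: ifP => [/andP[_ /eqP]//|_]; rewrite eqxx.
Qed.

(** the coefficient of [x_0^(-n-1) x_2^(-m-1)] in the iterate; the sum is over the odd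
    monomials of the inner vertex operator *)
Definition Fiter u v w n m :=
  \sum_(b <- [:: (false, false); (true, false); (false, true); (true, true)])
    qm b 1 *: ymode qphi2 (ymode (qphi1 - qphi2) u n (cvec v) b) m (cvec w).

Lemma YiterE u v w e : Yiter D md u v w e =
  if e X1 == 0 then Fiter u v w (- e X0 - 1) (- e X2 - 1) else 0 :> W.
Proof.
rewrite /Yiter /Yext phi1B2E phi2E.
set f := Yop D md (xpow R L X0) _ u (const v).
have fE e' : (f e' : W) = if (e' X1 == 0) && (e' X2 == 0)
    then ymode (qphi1 - qphi2) u (- e' X0 - 1) (cvec v) else 0.
  by rewrite /f Yconst; congr (if _ then _ else _); rewrite expo_eq !expoE; lia.
have tE (q : expo * oexp) :
    smul (mono q.1 q.2 1) (Yop D md (xpow R L X2) (qmono 0 qphi2) (f q.1 q.2) (const w)) e =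
    if (e X1 == 0) && (q.1 == xexp X0 (e X0)) then
    qm q.2 1 *: ymode qphi2 (ymode (qphi1 - qphi2) u (- e X0 - 1) (cvec v) q.2) (- e X2 - 1) (cvec w)
    else 0 :> W.
  rewrite monoE qmono_act Yconst.
  rewrite fE.
  case: (boolP ((q.1 X1 == 0) && (q.1 X2 == 0))) => [/andP[/eqP q1 /eqP q2]|nq].
    rewrite !expo_eq !expoE q1 q2 eqxx /= !subr0 subrr eqxx !andbT subr_eq0.
    rewrite [e X0 == _]eq_sym andbC.
    by case: ifP => [/andP[_ /eqP ->] //|]; rewrite scaler0.
  rewrite oser0 ymode0l if_same scaler0; case: ifP => [/andP[_ /eqP hq]|//].
  by rewrite hq !expoE eqxx in nq.
rewrite (@ssumE _ _ _ [seq (xexp X0 (e X0), b) | b <-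
  [:: (false, false); (true, false); (false, true); (true, true)]]) //; last first.
  move=> [e' b] hq; rewrite tE /=; case: ifP => // /andP[_ /eqP he'].
  by move: hq; rewrite he' map_f //; case: b => [[] []].
- by rewrite map_inj_uniq // => b b' [].
rewrite big_map; case: ifP => e1.
  by apply: eq_bigr => b _; rewrite tE e1 eqxx.
by rewrite big1 // => b _; rewrite tE e1.
Qed.

Lemma oact_op_cvec u k w : md u k w = 0 -> oact_op (md u k) (cvec w) = 0.
Proof.
move=> h; apply/funext => b; rewrite /oact_op /cvec.
by case: eqP => [->|_] //=; rewrite vpar0 mode0r vpar0.
Qed.

Lemma ymode_trunc psi u w (N : nat) (n : int) : (forall k : int, N%:Z < k -> md u k w = 0) ->
  N%:Z < n -> ymode psi u n (cvec w) = 0.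
Proof.
by move=> hN nN; rewrite /ymode !oact_op_cvec ?scaler0 ?addr0 //; apply: hN; lia.
Qed.

Lemma truncation_nat u w : exists N : nat, forall k : int, N%:Z < k -> md u k w = 0.
Proof.
by have [N hN] := truncation D u w; exists `|N|%N => k hk; apply: hN; lia.
Qed.

Lemma Y2const_supp v w (N : nat) e : (forall k : int, N%:Z < k -> md v k w = 0) ->
  (Y2 D md v (const w) e : W) != 0 -> [/\ e X0 = 0, e X1 = 0 & - N.+1%:Z <= e X2].
Proof.
move=> hN; rewrite Y2constE; case: ifP => [/andP[/eqP e0 /eqP e1]|]; last by rewrite eqxx.
move=> H; split=> //; rewrite leNgt; apply: contraNN H => h; apply/eqP.
by apply: ymode_trunc hN _; lia.
Qed.

(** Truncation for [v] and [w] bounds the power [k] of [x_2] taken from the binomial series,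
    and then the mode index [n]. The bound [N] is left free so that products for
    several [v] can be compared over one box. *)
Lemma YprodE u v w (N : nat) e (M : nat) : (forall k : int, N%:Z < k -> md v k w = 0) ->
  (`|e X0| + `|e X2| + N + 5 <= M)%N ->
  Yprod D md u v w e = (if e X1 == 0 then
    \sum_(n <- zbox (M + M)) \sum_(k <- iota 0 M)
      ocoef L 1 1 (- n - 1) (e X0) k%:Z *: Fprod u v w n (- (e X2 - k%:Z) - 1) else 0) :> W.
Proof.
move=> hN hM; rewrite /Yprod /Yop phi1E.
pose g := Y2 D md v (const w).
have cover A (n : int) : A 0 = 0 ->
    smul (@xobin R L X0 X2 1 1 (- n - 1)) (opact D A g) e =
    (if e X1 == 0 then \sum_(k <- iota 0 M) ocoef L 1 1 (- n - 1) (e X0) k%:Z *: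
      oact_op A (ymode qphi2 v (- (e X2 - k%:Z) - 1) (cvec w)) else 0) :> W.
  move=> A0; rewrite (@smulE _ _ _ _ _ _ [seq xexp X0 (e X0) + xexp X1 (e X1) + xexp X2 k%:Z | k <- iota 0 M]).
  - rewrite big_map; case: ifP => e1; last first.
      by rewrite big1 // => k _; rewrite (@xobinE _ _ X0 X2 X1) // !expoE add0r addr0 e1 scale0r.
    apply: eq_bigr => k _; rewrite (@xobinE _ _ X0 X2 X1) // !expoE /= !(add0r, addr0) e1.
    congr (_ *: _); rewrite /opact -/(oact_op A (g _)) /g Y2constE !expoE /= !(add0r, addr0).
    by rewrite !subrr.
  - rewrite map_inj_uniq ?iota_uniq // => k k' /(congr1 (fun e : expo => e X2)).
    by rewrite !expoE; lia.
  move=> d hd; have [gd|] := eqVneq (g (e - d) : W) 0.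
    by right; rewrite /opact gd -/(oact_op A 0) oact_op0.
  rewrite /g => /(Y2const_supp hN); rewrite !expoE => -[d0 d1 d2]; left.
  rewrite (@xobinE _ _ X0 X2 X1) //; case: ifP => // _.
  apply/eqP; apply: contraNT hd => /ocoef_supp[d2' _].
  apply/mapP; exists `|d X2|%N; first by rewrite mem_iota; lia.
  by apply: expoP; rewrite !expoE /=; lia.
have term (n : int) : (smul (@xobin R L X0 X2 1 1 (- n - 1)) (opact D (md u (2 * n)) g) +
    smul (qmono 0 qphi1) (smul (@xobin R L X0 X2 1 1 (- n - 1)) (opact D (md u (2 * n - 1)) g))) e =
    (if e X1 == 0 then \sum_(k <- iota 0 M)
      ocoef L 1 1 (- n - 1) (e X0) k%:Z *: Fprod u v w n (- (e X2 - k%:Z) - 1) else 0) :> W.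
  rewrite serD qmono_act subr0 !cover ?mode0r //.
  case: ifP => _; last by rewrite scaler0 addr0.
  rewrite scaler_sumr -big_split; apply: eq_bigr => k _ /=.
  by rewrite scalerA -ocoef_central -scalerA -scalerDr.
rewrite (@ssumE _ _ _ (zbox (M + M))) ?zbox_uniq //.
  by under eq_bigr do rewrite term; case: ifP => // _; rewrite big1.
move=> n hn; rewrite term; case: ifP => // _; rewrite big_seq big1 // => k.
rewrite mem_iota add0n /= => kM; set o := ocoef _ _ _ _ _ _.
have [->|/ocoef_supp[_ h]] := eqVneq o 0; first by rewrite scale0r.
by case/negP: hn; apply: mem_zbox; lia.
Qed.

Local Notation delta_prod := (@delta R L X0 (@xobin R L X1 X2 (-1) (-1))).
Local Notation delta_iter := (@delta R L X2 (@xobin R L X1 X0 (-1) (-1))).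

Lemma delta_prodE d : (delta_prod d : Q) = ocoef L (-1) (-1) (- d X0 - 1) (d X1) (d X2).
Proof. by rewrite (@deltaE _ _ X1 X2 X0). Qed.

Lemma delta_iterE d : (delta_iter d : Q) = ocoef L (-1) (-1) (- d X2 - 1) (d X1) (d X0).
Proof. by rewrite (@deltaE _ _ X1 X0 X2). Qed.

(** the form [x_0 + x_2 + phi_1 phi_2] that replaces [x_1] *)
Definition lplus : @lform R L := (1, 1, 1).

Lemma sc1 : gscalar L (1 : C) = 1. Proof. exact: gscalar1. Qed.
Lemma scN1 : gscalar L (-1 : C) = -1.
Proof.
by apply/eqP; rewrite -subr_eq0 opprK -sc1 -gscalarD addNr gscalar0.
Qed.

Lemma qcN1 : qc (-1 : Lam) = -1 :> Q.
Proof. by apply/eqP; rewrite -subr_eq0 opprK -qc1 -qmD addNr qm0. Qed.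

Lemma qeN1 : qe (-1 : Lam) = - qe 1 :> Q.
Proof. by apply/eqP; rewrite -subr_eq0 opprK -qmD addNr qm0. Qed.

(** On the support of each of the delta functions [x_1 = x_0 + x_2 + phi_1 phi_2]. *)
Lemma delta_prod_shift : xpow R L X1 1 ** delta_prod = lser lplus ** delta_prod.
Proof.
apply/funext => e; rewrite lser_mul xpowE qmono_mul mul1r /= qc1 !mul1r !delta_prodE !expoE /=.
rewrite !subr0 (_ : - (e X0 - 1) - 1 = - e X0 - 1 + 1); last by lia.
rewrite ocoef_pascal scN1 qcN1 qeN1 !mulN1r mulNr.
by rewrite [X in _ = X + _]addrAC !subrK.
Qed.

Lemma delta_iter_shift : xpow R L X1 1 ** delta_iter = lser lplus ** delta_iter.
Proof.
apply/funext => e; rewrite lser_mul xpowE qmono_mul mul1r /= qc1 !mul1r !delta_iterE !expoE /=.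
rewrite !subr0 (_ : - (e X2 - 1) - 1 = - e X2 - 1 + 1); last by lia.
rewrite ocoef_pascal scN1 qcN1 qeN1 !mulN1r mulNr [X in _ = X + _]addrC.
by rewrite [X in _ = X + _]addrAC !subrK.
Qed.

Lemma delta_prod_locfin u v w : locfin delta_prod (Y1 D md u (Y2 D md v (const w))).
Proof.
move=> e; have [N hN] := truncation_nat v w.
exists (`|e X0| + `|e X1| + `|e X2| + N + 9 + `|e X0| + `|e X1| + `|e X2| + N)%N => d.
rewrite delta_prodE => /ocoef_supp; rewrite Y12E !expoE => -[d2 d3].
case: ifP => [/eqP d0|_]; last by rewrite eqxx.
have [h|h _] := ltrP N%:Z (- (e X2 - d X2) - 1).
  by rewrite /Fprod (ymode_trunc qphi2 hN h) ymode0 eqxx.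
by rewrite /small; lia.
Qed.

Lemma Yiter_supp u v w (N : nat) e : (forall k : int, N%:Z < k -> md u k v = 0) ->
  (Yiter D md u v w e : W) != 0 -> e X1 = 0 /\ - N.+1%:Z <= e X0.
Proof.
move=> hN; rewrite YiterE; case: ifP => [/eqP e1|]; last by rewrite eqxx.
move=> H; split=> //; rewrite leNgt; apply: contraNN H => h; apply/eqP.
rewrite /Fiter big1 // => b _; rewrite (ymode_trunc _ hN); last by lia.
by rewrite oser0 ymode0l scaler0.
Qed.

Lemma delta_iter_locfin u v w : locfin delta_iter (Yiter D md u v w).
Proof.
move=> e; have [N hN] := truncation_nat u v.
exists (`|e X0| + `|e X1| + `|e X2| + N + 9 + `|e X0| + `|e X1| + `|e X2| + N)%N => d.
rewrite delta_iterE => /ocoef_supp [d2 d3] /(Yiter_supp hN); rewrite !expoE => -[e1 e2].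
by rewrite /small; lia.
Qed.

(** By [ocoef_swap], the residue in [x_1] of the first term of the Jacobi identity replaces
    [x_1] by [x_0 + x_2 + phi_1 phi_2]. *)
Lemma delta_prod_residue u v w e : e X1 = 0 ->
  smul delta_prod (Y1 D md u (Y2 D md v (const w))) (e - xexp X1 1) = Yprod D md u v w e :> W.
Proof.
move=> e1; have [N hN] := truncation_nat v w.
pose M := (`|e X0| + `|e X2| + N + 5)%N.
rewrite (YprodE _ hN (leqnn M)) e1 eqxx.
pose f n (k : nat) := xexp X0 (e X0) + xexp X1 n + xexp X2 k%:Z.
rewrite (@smulE _ _ _ _ _ _ [seq f n k | n <- zbox (M + M), k <- iota 0 M]).
- rewrite big_allpairs_dep; apply: eq_bigr => n _; apply: eq_bigr => k _.
  rewrite delta_prodE Y12E /f !expoE /= !(addr0, add0r, subr0) subrr eqxx e1 ocoef_swap.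
  by congr (_ *: Fprod _ _ _ _ _); lia.
- apply: allpairs_uniq; rewrite ?zbox_uniq ?iota_uniq // => -[n k] [n' k'] _ _ /= h.
  have /= := congr1 (fun e : expo => e X1) h; rewrite !expoE /= !(addr0, add0r) => ->.
  have /= := congr1 (fun e : expo => e X2) h; rewrite !expoE /= !(addr0, add0r) => h2.
  by congr (_, _); lia.
move=> d hd; rewrite delta_prodE Y12E !expoE /= !subr0.
set o := ocoef _ _ _ _ _ _; have [->|/ocoef_supp[d2 d3]] := eqVneq o 0; first by left.
right; case: ifP => // /eqP d0.
have [h|h] := ltrP N%:Z (- (e X2 - d X2) - 1).
  by rewrite /Fprod (ymode_trunc qphi2 hN h) ymode0.
case/negP: hd; apply/allpairsP; exists (d X1, `|d X2|%N); split=> /=.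
- by apply: mem_zbox; lia.
- by rewrite mem_iota; lia.
- by apply: expoP; rewrite /f !expoE /=; lia.
Qed.

(** By [ocoef_residue], the delta function contributes only [x_1^(-1)] to the residue. *)
Lemma delta_iter_residue u v w e : e X1 = 0 ->
  smul delta_iter (Yiter D md u v w) (e - xexp X1 1) = Yiter D md u v w e :> W.
Proof.
move=> e1; rewrite (@smulE _ _ _ _ _ _ [:: xexp X1 (-1)]) //.
  rewrite big_seq1 delta_iterE !expoE /= ocoef_residue /= scale1r; congr (Yiter _ _ _ _ _ _ : W).
  by apply: expoP; rewrite !expoE /=; lia.
move=> d; rewrite inE => hd; rewrite delta_iterE YiterE !expoE e1 /=.
case: eqP => [h|]; [left|by right].
rewrite (_ : d X1 = -1); last by lia.
rewrite ocoef_residue; case: eqP => //= h2; case: eqP => //= h0.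
by case/eqP: hd; apply: expoP; rewrite !expoE /=; lia.
Qed.

End Vertex.

(** * Weak associativity *)

Section WeakAssociativity.

Variables (R : realType) (L : option nat).
Local Notation C := R[i].
Local Notation Lam := (grassmann C L).
Local Notation Q := (osa R L).
Local Notation "f ** g" := (@sprod R L f g) (at level 40, left associativity).
Variables (V : lmodType Lam) (D : ns_vosa V).
Local Notation W := (oser V).
Local Notation md := (mode D).
Local Notation par := (vpar D).
Local Notation delta_prod := (@delta R L X0 (@xobin R L X1 X2 (-1) (-1))).
Local Notation delta_iter := (@delta R L X2 (@xobin R L X1 X0 (-1) (-1))).
Local Notation delta_flip := (xpow R L X0 (-1) ** sdelta (@xobin R L X2 X1 (-1) 1) (@xpowN R L X0)).
Local Notation lplus := (lplus R L).
Implicit Types (e d : expo) (u v w : V).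

(** the coefficient of [x_1^m], as a series in [x_0] and [x_2] *)
Definition x1coef (m : int) (g : series V) : series V :=
  fun e => if e X1 == 0 then g (e + xexp X1 m) else 0.

Definition times_lplus : series V -> series V := smul (lser lplus).

(** On the support of the delta function [x_1] acts as [x_0 + x_2 + phi_1 phi_2]. *)
Lemma x1coef_shift (Dl : series Lam) (g : series V) m : locfin Dl g ->
  xpow R L X1 1 ** Dl = lser lplus ** Dl ->
  x1coef (m - 1) (smul Dl g) = times_lplus (x1coef m (smul Dl g)).
Proof.
move=> lf shift; set G := smul Dl g.
have fx : fsupp (xpow R L X1 1).
  exists 1%N => e; rewrite xpowE /qmono; case: (eqVneq e (xexp X1 1)) => [->|_].
    by rewrite /small !expoE.
  by rewrite eqxx.
have GE : smul (xpow R L X1 1) G = smul (lser lplus) G.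
  by rewrite /G (smulA_fsupp fx lf) (smulA_fsupp (lser_fsupp lplus) lf) shift.
apply/funext => e; rewrite /times_lplus lser_act /x1coef !expoE /= !subr0.
case: ifP => e1; last by rewrite !scaler0 !addr0.
have := congr1 (fun g : series V => (g (e + xexp X1 m) : W)) GE.
rewrite lser_act xpow_act => H.
rewrite (_ : e + xexp X1 (m - 1) = e + xexp X1 m - xexp X1 1); last first.
  by rewrite -addrA; congr (_ + _); apply: expoP; rewrite !expoE //= subr0.
rewrite H /=.
rewrite (_ : e - xexp X0 1 + xexp X1 m = e + xexp X1 m - xexp X0 1); last by rewrite addrAC.
rewrite (_ : e - xexp X2 1 + xexp X1 m = e + xexp X1 m - xexp X2 1); last by rewrite addrAC.
by [].
Qed.

Lemma x1coef_iter (Dl : series Lam) (g : series V) t : locfin Dl g ->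
  xpow R L X1 1 ** Dl = lser lplus ** Dl ->
  x1coef (- 1 - t%:Z) (smul Dl g) = iter t times_lplus (x1coef (-1) (smul Dl g)).
Proof.
move=> lf shift; elim: t => [|t IH]; first by rewrite subr0.
rewrite (_ : - 1 - t.+1%:Z = - 1 - t%:Z - 1); last by lia.
by rewrite x1coef_shift // IH.
Qed.

Lemma xexpN1 e : e + xexp X1 (-1) = e - xexp X1 1.
Proof. by congr (_ + _); apply: expoP; rewrite !expoE //= oppr0. Qed.

Lemma x1coef_prod u v w t :
  x1coef (- 1 - t%:Z) (smul delta_prod (Y1 D md u (Y2 D md v (const w)))) =
  iter t times_lplus (Yprod D md u v w).
Proof.
rewrite x1coef_iter; [|exact: delta_prod_locfin|exact: delta_prod_shift]; congr (iter _ _ _).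
apply/funext => e; rewrite /x1coef; case: ifP => [/eqP e1|e1].
  rewrite -[RHS](delta_prod_residue D u v w e1); congr (smul _ _ _).
  exact: xexpN1.
have [N hN] := truncation_nat D v w.
by rewrite (YprodE _ hN (leqnn _)) e1.
Qed.

Lemma x1coef_iterate u v w t :
  x1coef (- 1 - t%:Z) (smul delta_iter (Yiter D md u v w)) =
  iter t times_lplus (Yiter D md u v w).
Proof.
rewrite x1coef_iter; [|exact: delta_iter_locfin|exact: delta_iter_shift]; congr (iter _ _ _).
apply/funext => e; rewrite /x1coef; case: ifP => [/eqP e1|e1].
  rewrite -[RHS](delta_iter_residue D u v w e1); congr (smul _ _ _).
  exact: xexpN1.
by rewrite YiterE e1.
Qed.

(** In the Jacobi identity the term with the reversed product contains only powers of
    [x_1] bounded below, because of the truncation condition for [u] and [w]; at lower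
    powers the two other terms agree. *)
Lemma weak_associativity_sg i j u v w : has_sg D i u -> has_sg D j v ->
  exists t0, forall t, (t0 <= t)%N ->
    iter t times_lplus (Yprod D md u v w) = iter t times_lplus (Yiter D md u v w).
Proof.
move=> hu hv; have [N hN] := truncation_nat D u w.
exists N.+1 => t ht; rewrite -x1coef_prod -x1coef_iterate.
apply/funext => e; rewrite /x1coef; case: ifP => // /eqP e1.
have := congr1 (fun g : series V => (g (e + xexp X1 (- 1 - t%:Z)) : W)) (jacobi w hu hv).
rewrite serB const_act (@smul0E _ _ _ delta_flip) ?scaler0 ?subr0 //.
move=> d; have [d1|d1] := ltrP (d X1) 0; first by left; apply: delta_flip_supp.
right; rewrite Y21E; case: ifP => // _.
rewrite (ymode_trunc (qphi1 R L) hN) ?ymode0 // !expoE /=; lia.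
Qed.

Lemma iter_lplusB t (f g : series V) :
  iter t times_lplus (f - g) = iter t times_lplus f - iter t times_lplus g.
Proof.
by elim: t => [//|t IH]; rewrite !iterS IH /times_lplus smulBr //; apply: lser_fsupp.
Qed.

Definition defect u v w := Yprod D md u v w - Yiter D md u v w.

Lemma FprodDl u u' v w n m : Fprod D (u + u') v w n m = Fprod D u v w n m + Fprod D u' v w n m.
Proof. by rewrite /Fprod ymodeDl. Qed.

Lemma FprodDr u v v' w n m : Fprod D u (v + v') w n m = Fprod D u v w n m + Fprod D u v' w n m.
Proof. by rewrite /Fprod ymodeDl ymodeD. Qed.

Lemma FiterDl u u' v w n m : Fiter D (u + u') v w n m = Fiter D u v w n m + Fiter D u' v w n m.
Proof.
rewrite /Fiter -big_split; apply: eq_bigr => b _ /=.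
by rewrite ymodeDl oserD ymodeDl scalerDr.
Qed.

Lemma FiterDr u v v' w n m : Fiter D u (v + v') w n m = Fiter D u v w n m + Fiter D u v' w n m.
Proof.
rewrite /Fiter -big_split; apply: eq_bigr => b _ /=.
by rewrite cvecD ymodeD oserD ymodeDl scalerDr.
Qed.

Lemma YprodDl u u' v w : Yprod D md (u + u') v w = Yprod D md u v w + Yprod D md u' v w.
Proof.
have [N hN] := truncation_nat D v w.
apply/funext => e; rewrite serD !(YprodE _ hN (leqnn _)); case: ifP => _; last by rewrite addr0.
rewrite -big_split; apply: eq_bigr => n _; rewrite -big_split; apply: eq_bigr => k _ /=.
by rewrite FprodDl scalerDr.
Qed.

Lemma YprodDr u v v' w : Yprod D md u (v + v') w = Yprod D md u v w + Yprod D md u v' w.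
Proof.
have [N1 hN1] := truncation_nat D v w; have [N2 hN2] := truncation_nat D v' w.
pose N := (N1 + N2)%N.
have hN k : N%:Z < k -> md v k w = 0 by move=> h; apply: hN1; lia.
have hN' k : N%:Z < k -> md v' k w = 0 by move=> h; apply: hN2; lia.
have hN'' k : N%:Z < k -> md (v + v') k w = 0 by move=> h; rewrite modeDl hN ?hN' ?addr0.
apply/funext => e; rewrite serD (YprodE _ hN (leqnn _)) (YprodE _ hN' (leqnn _)).
rewrite (YprodE _ hN'' (leqnn _)); case: ifP => _; last by rewrite addr0.
rewrite -big_split; apply: eq_bigr => n _; rewrite -big_split; apply: eq_bigr => k _ /=.
by rewrite FprodDr scalerDr.
Qed.

Lemma YiterDl u u' v w : Yiter D md (u + u') v w = Yiter D md u v w + Yiter D md u' v w.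
Proof.
by apply/funext => e; rewrite serD !YiterE; case: ifP => _; rewrite ?FiterDl ?addr0.
Qed.

Lemma YiterDr u v v' w : Yiter D md u (v + v') w = Yiter D md u v w + Yiter D md u v' w.
Proof.
by apply/funext => e; rewrite serD !YiterE; case: ifP => _; rewrite ?FiterDr ?addr0.
Qed.

Lemma iter_lplus0 t : iter t times_lplus 0 = 0.
Proof. by have := iter_lplusB t 0 0; rewrite !subrr. Qed.

Lemma iter_lplusD t (f g : series V) :
  iter t times_lplus (f + g) = iter t times_lplus f + iter t times_lplus g.
Proof. by rewrite -[X in f + X]opprK iter_lplusB -[- g]sub0r iter_lplusB iter_lplus0 sub0r opprK. Qed.

(** The Jacobi identity is available for homogeneous signs only, so one power is chosen for
    the four pairs of homogeneous parts of [u] and [v]. *)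
Lemma weak_associativity u v w : exists t, iter t times_lplus (defect u v w) = 0.
Proof.
have hsg i x : has_sg D i (sg D i x) by rewrite /has_sg sg_orth eqxx.
have step i j : exists t0, forall t, (t0 <= t)%N ->
    iter t times_lplus (defect (sg D i u) (sg D j v) w) = 0.
  have [t0 h] := weak_associativity_sg w (hsg i u) (hsg j v).
  by exists t0 => t /h e; rewrite iter_lplusB e subrr.
have [t1 h1] := step false false; have [t2 h2] := step false true.
have [t3 h3] := step true false; have [t4 h4] := step true true.
exists (t1 + t2 + t3 + t4)%N.
have defDl x x' y : defect (x + x') y w = defect x y w + defect x' y w.
  by rewrite /defect YprodDl YiterDl opprD addrACA.
have defDr x y y' : defect x (y + y') w = defect x y w + defect x y' w.
  by rewrite /defect YprodDr YiterDr opprD addrACA.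
pose x i j := defect (sg D i u) (sg D j v) w.
have -> : defect u v w = (x false false + x false true) + (x true false + x true true).
  by rewrite {1}(sg_sum D u) {1}(sg_sum D v) defDl !defDr.
rewrite (iter_lplusD _ (x _ _ + x _ _)) !(iter_lplusD _ (x _ _)).
by rewrite /x h1 ?h2 ?h3 ?h4 ?addr0 //; lia.
Qed.

End WeakAssociativity.

(** * Weights of modes *)

Section Weights.

Variables (R : realType) (L : option nat).
Local Notation C := R[i].
Local Notation Lam := (grassmann C L).
Local Notation Q := (osa R L).
Local Notation "f ** g" := (@sprod R L f g) (at level 40, left associativity).
Variables (V : lmodType Lam) (D : ns_vosa V).
Local Notation W := (oser V).
Local Notation md := (mode D).
Local Notation par := (vpar D).
Local Notation p1 := (qphi1 R L).
Local Notation p2 := (qphi2 R L).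
Local Notation delta_prod := (@delta R L X0 (@xobin R L X1 X2 (-1) (-1))).
Local Notation delta_iter := (@delta R L X2 (@xobin R L X1 X0 (-1) (-1))).
Local Notation delta_flip := (xpow R L X0 (-1) ** sdelta (@xobin R L X2 X1 (-1) 1) (@xpowN R L X0)).
Implicit Types (e d : expo) (u v w : V).

#[local] Arguments vpar : simpl never.

(** This is the coefficient of [x_0^(-1) x_1^(-2)] in the Jacobi identity for [u = tau], where
    [phi_1 x_1^(-2)] picks [2 L(0)]. On the left [x_0^(-1)] comes with the zeroth power of
    [x_1 - x_2 - phi_1 phi_2] only, so a supercommutator remains; on the right [x_1^(-2)] is reached
    from the residue by one multiplication by [x_0 + x_2 + phi_1 phi_2]. *)
Lemma tau_commutator j v w m : has_sg D j v ->
  Fprod D (tau D) v w 1 m -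
    qc ((-1) ^+ j) *: ymode D p2 v m (ymode D p1 (tau D) 1 (cvec w)) =
  Fiter D (tau D) v w 1 m + Fiter D (tau D) v w 0 (m + 1) + qe 1 *: Fiter D (tau D) v w 0 m.
Proof.
move=> hv; pose e := xexp X0 (-1) + xexp X2 (- m - 1).
have e1 : e X1 = 0 by rewrite /e !expoE.
have := congr1 (fun g : series V => (g (e + xexp X1 (-2)) : W)) (jacobi w (tau_sg D) hv).
have := congr1 (fun g : series V => (g e : W)) (x1coef_iterate D (tau D) v w 1).
rewrite {1}/x1coef e1 eqxx => -> /=.
rewrite /times_lplus lser_act !YiterE !expoE /= qc1 !scale1r.
rewrite serB const_act.
rewrite (@smulE _ _ _ delta_prod _ _ [:: xexp X0 (-1)]) //; last first.
  move=> d; rewrite inE => hd; rewrite delta_prodE Y12E !expoE /=.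
  case: eqP => [h|_]; [left|by right].
  rewrite (_ : - d X0 - 1 = 0); last by lia.
  rewrite ocoef0; case: eqP => //= h1; case: eqP => //= h2.
  by case/eqP: hd; apply: expoP; rewrite !expoE /=; lia.
rewrite (@smulE _ _ _ delta_flip _ _ [:: xexp X0 (-1)]) //; last first.
  move=> d; rewrite inE => hd; rewrite Y21E !expoE /=.
  case: eqP => [h|_]; [left|by right].
  rewrite delta_flip_residue; last by lia.
  case: eqP => //= h1; case: eqP => //= h2.
  by case/eqP: hd; apply: expoP; rewrite !expoE /=; lia.
rewrite !big_seq1 delta_prodE delta_flip_residue ?expoE //= ocoef0 !scale1r Y12E Y21E !expoE /=.
rewrite (_ : - (0 + 0 + -2 - 0) - 1 = 1) // => h.
have hm : - (0 + (- m - 1) + 0 - 0) - 1 = m by lia.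
rewrite !hm in h; rewrite h.
by congr (_ + _ + _ *: _); congr (Fiter _ _ _ _ _ _); lia.
Qed.

Lemma phi_mode psi u n g b : ymode D psi u n g b =
  oact_op D (md u (2 * n)) g b + (psi *: oact_op D (md u (2 * n - 1)) g) b.
Proof. by []. Qed.

Lemma oact_op_even A (g : W) b : oodd b = false -> oact_op D A g b = A (g b).
Proof. by rewrite /oact_op => ->. Qed.

Lemma oact_op_odd A (g : W) b : oodd b = true -> oact_op D A g b = par true (A (par true (g b))).
Proof. by rewrite /oact_op => ->. Qed.

Lemma oact_op_cvecE u k w b :
  oact_op D (md u k) (cvec w) b = if b == (false, false) then md u k w else 0.
Proof.
rewrite /oact_op /cvec; have [->|] := eqVneq b (false, false); first by [].
by rewrite vpar0 mode0r vpar0.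
Qed.

Lemma ymode_p1_cvec u n w b : ymode D p1 u n (cvec w) b =
  if b == (false, false) then md u (2 * n) w
  else if b == (true, false) then md u (2 * n - 1) w else 0.
Proof.
rewrite phi_mode /qphi1 phi1_act oact_op_cvecE.
by case: b => [[] []] /=; rewrite ?oact_op_cvecE /= ?(add0r, addr0).
Qed.

Lemma ymode_p2_cvec u n w b : ymode D p2 u n (cvec w) b =
  if b == (false, false) then md u (2 * n) w
  else if b == (false, true) then md u (2 * n - 1) w else 0.
Proof.
rewrite phi_mode /qphi2 phi2_act oact_op_cvecE.
by case: b => [[] []] /=; rewrite ?oact_op_cvecE /= ?(oppr0, add0r, addr0).
Qed.

Lemma oserB (f g : W) b : (f - g) b = f b - g b. Proof. by []. Qed.

Lemma ymode_p12_cvec u n w b : ymode D (p1 - p2) u n (cvec w) b =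
  if b == (false, false) then md u (2 * n) w
  else if b == (true, false) then md u (2 * n - 1) w
  else if b == (false, true) then - md u (2 * n - 1) w else 0.
Proof.
rewrite phi_mode scalerBl oserB /qphi2 phi2_act /qphi1 phi1_act oact_op_cvecE.
by case: b => [[] []] /=; rewrite ?oact_op_cvecE /= ?(oppr0, add0r, addr0).
Qed.

Lemma FiterE u v w n m :
  [/\ Fiter D u v w n m (false, false) = md (md u (2 * n) v) (2 * m) w,
      Fiter D u v w n m (true, false) = md (md u (2 * n - 1) v) (2 * m) w
    & Fiter D u v w n m (true, true) = md (md u (2 * n - 1) v) (2 * m - 1) w].
Proof.
rewrite /Fiter !big_cons big_nil addr0 !ymode_p12_cvec /= ymode0l scaler0 addr0.
rewrite -/(qc 1) qc1 scale1r phi1_act phi2_act.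
by split; rewrite !oserD !ymode_p2_cvec /= ?(addr0, add0r, oppr0).
Qed.

Lemma vpar_sg i x : has_sg D i x -> par true x = (-1) ^+ i *: x.
Proof.
rewrite /has_sg => hx; have h i' : i' != i -> sg D i' x = 0.
  by move=> ii'; rewrite -hx sg_orth (negPf ii').
rewrite /vpar; case: i hx h => hx h.
  by rewrite hx h // sub0r expr1 scaleN1r.
by rewrite hx h // subr0 expr0 scale1r.
Qed.

Lemma has_sg_proj i x : has_sg D i (sg D i x).
Proof. by rewrite /has_sg sg_orth eqxx. Qed.

Lemma signr_bool_scale (i : bool) (x : V) : (-1) ^+ i *: x = if i then - x else x.
Proof. by case: i; rewrite ?expr1 ?scaleN1r ?expr0 ?scale1r. Qed.

Lemma modeN u k x : md u k (- x) = - md u k x.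
Proof. by apply/eqP; rewrite -subr_eq0 opprK -modeDr addNr mode0r. Qed.

Lemma vparN x : par true (- x) = - par true x.
Proof. by apply/eqP; rewrite -subr_eq0 opprK -vparD addNr vpar0. Qed.

(** Operators of sign [i] commute with the parity involution up to [(-1)^i]. *)
Lemma conj_par_even j v n x : has_sg D j v ->
  par true (md v (2 * n) (par true x)) = (-1) ^+ j *: md v (2 * n) x.
Proof.
move=> hv; rewrite (sg_sum D x) [in RHS]modeDr vparD modeDr vparD scalerDr; congr (_ + _).
  rewrite (vpar_sg (has_sg_proj _ _)) (signr_bool_scale false).
  by rewrite (vpar_sg (mode_even _ hv (has_sg_proj _ _))) addbF.
rewrite (vpar_sg (has_sg_proj _ _)) (signr_bool_scale true) modeN vparN.
rewrite (vpar_sg (mode_even _ hv (has_sg_proj _ _))) !signr_bool_scale.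
by case: (j) => //=; rewrite opprK.
Qed.

Lemma conj_par_odd j v n x : has_sg D j v ->
  par true (md v (2 * n - 1) (par true x)) = (-1) ^+ (~~ j) *: md v (2 * n - 1) x.
Proof.
move=> hv; rewrite (sg_sum D x) [in RHS]modeDr vparD modeDr vparD scalerDr; congr (_ + _).
  rewrite (vpar_sg (has_sg_proj _ _)) (signr_bool_scale false).
  by rewrite (vpar_sg (mode_odd _ hv (has_sg_proj _ _))) addbF.
rewrite (vpar_sg (has_sg_proj _ _)) (signr_bool_scale true) modeN vparN.
rewrite (vpar_sg (mode_odd _ hv (has_sg_proj _ _))) !signr_bool_scale.
by case: (j) => //=; rewrite opprK.
Qed.

(** [2 L(0)], the mode of [tau] of doubled index 1 *)
Definition tau1 : V -> V := md (tau D) 1.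

(** the coefficient of [phi_1] in [tau_commutator] *)
Lemma tau1_even j v w m : has_sg D j v ->
  tau1 (md v (2 * m) w) - md v (2 * m) (tau1 w) =
  md (tau1 v) (2 * m) w + md (md (tau D) (-1) v) (2 * (m + 1)) w.
Proof.
move=> hv; have := congr1 (fun g : W => g (true, false)) (tau_commutator w m hv).
have [_ f10 _] := FiterE (tau D) v w 1 m; have [_ f10' _] := FiterE (tau D) v w 0 (m + 1).
rewrite oserB !oserD f10 f10' qe_act /= addr0 => <-; 
congr (_ - _).
  rewrite /Fprod phi_mode /qphi1 phi1_act /= [oact_op _ _ _ (false, false)]oact_op_even //.
  by rewrite oact_op_odd // !ymode_p2_cvec /= vpar0 mode0r vpar0 add0r.
rewrite qc_act phi_mode /qphi2 phi2_act /= addr0 oact_op_odd // ymode_p1_cvec /=.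
rewrite (conj_par_even _ _ hv).
by case: (j); rewrite /= ?expr1 ?expr0 ?gparN ?gpar1 ?scaleN1r ?scale1r ?opprK.
Qed.

(** the coefficient of [phi_1 phi_2] in [tau_commutator] *)
Lemma tau1_odd j v w m : has_sg D j v ->
  tau1 (md v (2 * m - 1) w) - md v (2 * m - 1) (tau1 w) =
  md (tau1 v) (2 * m - 1) w + md (md (tau D) (-1) v) (2 * (m + 1) - 1) w
  + md (md (tau D) 0 v) (2 * m) w.
Proof.
move=> hv; have := congr1 (fun g : W => g (true, true)) (tau_commutator w m hv).
have [_ _ f11] := FiterE (tau D) v w 1 m; have [_ _ f11'] := FiterE (tau D) v w 0 (m + 1).
have [f00 _ _] := FiterE (tau D) v w 0 m.
rewrite oserB !oserD f11 f11' qe_act /= f00 scale1r => <-; 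
congr (_ - _).
  rewrite /Fprod phi_mode /qphi1 phi1_act /= [oact_op _ _ _ (true, true)]oact_op_even //.
  rewrite oact_op_odd // !ymode_p2_cvec /= mode0r add0r.
  by rewrite (conj_par_odd 1 _ (tau_sg D)) expr0 scale1r.
rewrite qc_act phi_mode /qphi2 phi2_act /= [oact_op _ _ _ (true, true)]oact_op_even //.
rewrite oact_op_odd // !ymode_p1_cvec /= mode0r add0r (conj_par_odd _ _ hv).
by case: (j); rewrite /= ?expr1 ?expr0 ?scaleN1r ?scale1r ?opprK.
Qed.

(** ** The derivative of a vertex operator *)

(** The two components of the [G(-1/2)]-derivative property; combined with [tau_m1], they
    make [L(-1)] act as [d/dx]. *)
Lemma G_even v w n : md (md (tau D) 0 v) (2 * n) w = md v (2 * n - 1) w.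
Proof.
have := congr1 (fun g : series V => (g (xexp X1 (- n - 1)) (false, false)))
  (G_derivative D v w).
rewrite -[Gop D (-1) v]/(md (tau D) 0 v) phi1E => H.
have e0 : - xexp X1 (- n - 1) X1 - 1 = n by rewrite !expoE /=; lia.
transitivity ((Y1 D md (md (tau D) 0 v) (const w) (xexp X1 (- n - 1)) : W) (false, false)).
  by rewrite Y1constE !expoE /= ymode_p1_cvec /= -[in LHS]e0 !expoE.
rewrite -{}H.
transitivity ((dphi1 (Y1 D md v (const w)) (xexp X1 (- n - 1)) : W) (false, false) +
  (smul (qmono 0 p1) (dx X1 (Y1 D md v (const w))) (xexp X1 (- n - 1)) : W) (false, false)); first by [].
rewrite qmono_act phi1_act /= addr0 /dphi1 /=.
rewrite -[Y1 _ _ _ _ _ _]/((Y1 D md v (const w) (xexp X1 (- n - 1)) : W) (true, false)).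
by rewrite Y1constE !expoE /= ymode_p1_cvec /=; congr (md v _ w); lia.
Qed.

Lemma G_odd v w n : md (md (tau D) 0 v) (2 * n - 1) w = md v (2 * (n - 1)) w *~ (- n).
Proof.
have := congr1 (fun g : series V => (g (xexp X1 (- n - 1)) (true, false)))
  (G_derivative D v w).
rewrite -[Gop D (-1) v]/(md (tau D) 0 v) phi1E => H.
transitivity ((Y1 D md (md (tau D) 0 v) (const w) (xexp X1 (- n - 1)) : W) (true, false)).
  by rewrite Y1constE !expoE /= ymode_p1_cvec /=; congr (md _ _ w); lia.
rewrite -{}H.
transitivity ((dphi1 (Y1 D md v (const w)) (xexp X1 (- n - 1)) : W) (true, false) +
  (smul (qmono 0 p1) (dx X1 (Y1 D md v (const w))) (xexp X1 (- n - 1)) : W) (true, false)); first by [].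
rewrite qmono_act phi1_act /= /dphi1 /= add0r subr0 /dx.
transitivity (((Y1 D md v (const w) (xexp X1 (- n - 1) + xexp X1 1) : W) (false, false)) *~
  (xexp X1 (- n - 1) X1 + 1)); first by [].
rewrite Y1constE !expoE /= ymode_p1_cvec /=.
by congr (md v _ w *~ _); lia.
Qed.

(** The Neveu-Schwarz relation [G(-1/2)^2 = L(-1)], as [tau] has mode [2 L(-1)] at doubled
    index [-1]. *)
Lemma tau_m1 v : md (tau D) (-1) v =
  md (tau D) 0 (md (tau D) 0 v) + md (tau D) 0 (md (tau D) 0 v).
Proof.
have := GG D (-1) 0 v; rewrite /scomm /= -[Gop D (-1) v]/(md (tau D) 0 v).
rewrite -[Gop D (0 - 1)]/(md (tau D) 0).
rewrite expr1 scaleN1r opprK => ->.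
rewrite (_ : (-1) ^+ 2 + -1 = 0 :> int) // mulr0 !mul0r gscalar0 scale0r addr0.
rewrite -[Lop _ _ _]/(gscalar L (2^-1 : C) *: md (tau D) (-1) v) scalerA -gscalarM.
by rewrite divff ?pnatr_eq0 // gscalar1 scale1r.
Qed.

(** ** Homogeneity of the modes *)

(** Through [L(-1) = G(-1/2)^2] and the derivative property, the terms with modes of [tau]
    other than [2 L(0)] are multiples of the same mode of [v]. *)
Lemma tau1_mode j v w k : has_sg D j v ->
  tau1 (md v k w) = md v k (tau1 w) + md (tau1 v) k w - md v k w *~ (k + 2).
Proof.
move=> hv; apply/eqP; rewrite -addrA addrC -subr_eq; apply/eqP.
have [m [->|->]] : exists m, k = 2 * m \/ k = 2 * m - 1.
  by have := divz_eq k 2; have := modz_ge0 k (isT : 2 != 0 :> int);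
     have := ltz_pmod k (isT : 0 < 2 :> int) => *; exists (- ((- k) %/ 2)%Z); lia.
- rewrite (tau1_even _ _ hv) tau_m1 modeDl G_even G_odd -mulrzDr addrK; congr (_ + _).
  by rewrite -mulrNz; congr (_ *~ _); lia.
rewrite (tau1_odd _ _ hv) tau_m1 modeDl !G_odd !G_even -addrA; congr (_ + _).
have -> : 2 * (m + 1 - 1) - 1 = 2 * m - 1 by lia.
rewrite -!mulrzDr -[X in _ + X]mulr1z -mulrzDr -mulrNz; congr (_ *~ _); lia.
Qed.

Lemma modez u k x (n : int) : md u k (x *~ n) = md u k x *~ n.
Proof.
case: n => n; [rewrite -!pmulrn|rewrite !NegzE !mulrNz -!pmulrn modeN; congr (- _)].
  by elim: n => [|n IH]; rewrite ?mode0r // !mulrS modeDr IH.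
by elim: n => [|n IH]; rewrite // mulrS modeDr IH -mulrS.
Qed.

Lemma modezl u k x (n : int) : md (u *~ n) k x = md u k x *~ n.
Proof.
have N u' : md (- u') k x = - md u' k x.
  by apply/eqP; rewrite -subr_eq0 opprK -modeDl addNr mode0l.
case: n => n; [rewrite -!pmulrn|rewrite !NegzE !mulrNz -!pmulrn N; congr (- _)].
  by elim: n => [|n IH]; rewrite ?mode0l // !mulrS modeDl IH.
by elim: n => [|n IH]; rewrite // mulrS modeDl IH -mulrS.
Qed.

Lemma gscalarz (n : int) (x : V) : gscalar L (n%:~R : C) *: x = x *~ n.
Proof.
have nat k : gscalar L (k%:R : C) *: x = x *+ k.
  elim: k => [|k IH]; first by rewrite gscalar0 scale0r.
  by rewrite -natr1 gscalarD scalerDl IH gscalar1 scale1r mulrSr.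
case: n => n; first by rewrite -!pmulrn nat.
rewrite NegzE !mulrNz -!pmulrn -nat -scaleNr; congr (_ *: _).
by apply/eqP; rewrite -addr_eq0 -gscalarD addNr gscalar0.
Qed.

Lemma mulrz_inj0 (n : int) (x : V) : x *~ n = 0 -> n != 0 -> x = 0.
Proof.
rewrite -gscalarz => h n0.
have : gscalar L ((n%:~R : C)^-1) *: (gscalar L (n%:~R : C) *: x) = 0 by rewrite h scaler0.
by rewrite scalerA -gscalarM mulVf ?intr_eq0 // gscalar1 scale1r.
Qed.

Lemma tau1_wt n v : has_wt D n v -> tau1 v = v *~ n.
Proof.
move=> /L0_wt h.
have : gscalar L (2 : C) *: Lop D 0 v = gscalar L (2 : C) *: (gscalar L (n%:~R / 2) *: v) by rewrite h.
rewrite -[Lop _ _ _]/(gscalar L (2^-1 : C) *: tau1 v) !scalerA -!gscalarM.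
rewrite divff ?pnatr_eq0 // gscalar1 scale1r => ->.
by rewrite mulrC divfK ?pnatr_eq0 // gscalarz.
Qed.

Lemma wt_proj n v : has_wt D n (wt D n v).
Proof. by rewrite /has_wt wt_orth eqxx. Qed.

Lemma wt0 n : wt D n 0 = 0.
Proof. by apply: add_zero => x y; apply: wtD. Qed.

Lemma wtN n x : wt D n (- x) = - wt D n x.
Proof. by apply/eqP; rewrite -subr_eq0 opprK -wtD addNr wt0. Qed.

Lemma wt_sumE n (s : seq int) (F : int -> V) :
  wt D n (\sum_(m <- s) F m) = \sum_(m <- s) wt D n (F m).
Proof. by elim: s => [|m s IH]; rewrite ?big_nil ?wt0 // !big_cons wtD IH. Qed.

Lemma wtz n x (k : int) : wt D n (x *~ k) = wt D n x *~ k.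
Proof. by rewrite -!gscalarz wtZ. Qed.

Lemma tau1_sum (s : seq int) (F : int -> V) :
  tau1 (\sum_(m <- s) F m) = \sum_(m <- s) tau1 (F m).
Proof.
by elim: s => [|m s IH]; rewrite ?big_nil /tau1 ?mode0r // !big_cons modeDr -IH.
Qed.

(** Eigenvectors of [2 L(0)] are homogeneous, as its eigenvalues on the
    homogeneous subspaces are distinct. *)
Lemma eigen_wt n v : tau1 v = v *~ n -> has_wt D n v.
Proof.
move=> hv; have [s us es] := wt_sum D v.
have eig m : wt D m (tau1 v) = wt D m v *~ m.
  rewrite [in LHS]es tau1_sum wt_sumE [in RHS]es wt_sumE.
  have e k : wt D m (tau1 (wt D k v)) = wt D m (wt D k v) *~ m.
    rewrite (tau1_wt (wt_proj k v)) wtz wt_orth.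
    by case: eqP => [->//|_]; rewrite !mul0rz.
  under eq_bigr do rewrite e.
  by rewrite -mulrz_suml.
have wt0' m : m != n -> wt D m v = 0.
  move=> mn; apply: (@mulrz_inj0 (m - n)); last by rewrite subr_eq0.
  by rewrite mulrzBr -eig hv wtz subrr.
rewrite /has_wt [in RHS]es [in LHS]es wt_sumE; apply: eq_bigr => m _.
by rewrite wt_orth; case: eqP => // /eqP nm; rewrite wt0' // eq_sym.
Qed.

Lemma mode_wt_sg j p q v w k : has_sg D j v -> has_wt D p v -> has_wt D q w ->
  has_wt D (p + q - k - 2) (md v k w).
Proof.
move=> hj hv hw; apply: eigen_wt.
rewrite (tau1_mode _ _ hj) (tau1_wt hv) (tau1_wt hw) modez modezl.
rewrite -mulrzDr -mulrzBr; congr (_ *~ _); lia.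
Qed.

Lemma has_wtD n x y : has_wt D n x -> has_wt D n y -> has_wt D n (x + y).
Proof. by rewrite /has_wt wtD => -> ->. Qed.

Lemma has_wt_sg n i x : has_wt D n x -> has_wt D n (sg D i x).
Proof. by rewrite /has_wt wt_sg => ->. Qed.

Lemma mode_wt p q v w k : has_wt D p v -> has_wt D q w ->
  has_wt D (p + q - k - 2) (md v k w).
Proof.
move=> hv hw; rewrite (sg_sum D v) modeDl.
by apply: has_wtD; apply: mode_wt_sg hw; rewrite ?has_sg_proj //;
  try exact: has_sg_proj; apply: has_wt_sg.
Qed.

End Weights.

(** * Matrix coefficients *)

Section MatrixCoefficients.

Variables (R : realType) (L : option nat).
Local Notation C := R[i].
Local Notation Lam := (grassmann C L).
Local Notation Q := (osa R L).
Local Notation "f ** g" := (@sprod R L f g) (at level 40, left associativity).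
Variables (V : lmodType Lam) (D : ns_vosa V).
Local Notation W := (oser V).
Local Notation md := (mode D).
Local Notation par := (vpar D).
Implicit Types (e d : expo) (u v w : V).

(** Ranges of weights rather than single weights: modes map ranges to ranges, so
    that arbitrary vectors need not be decomposed in what follows. *)
Definition wtin (a b : int) (x : V) : Prop :=
  forall n : int, ~~ (a <= n <= b) -> wt D n x = 0.

Lemma wtin_exists x : exists N : nat, wtin (- N%:Z) N%:Z x.
Proof.
have [s us es] := wt_sum D x; exists (\max_(n <- s) `|n|%N) => n hn.
rewrite es wt_sumE big_seq big1 // => m ms; rewrite wt_orth; case: eqP => // nm.
case/negP: hn; rewrite nm.
have : (`|m| <= \max_(n <- s) `|n|)%N.
  by rewrite (big_rem m) //= leq_maxl.
by lia.
Qed.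

Lemma wtin_sub a b a' b' x : a' <= a -> b <= b' -> wtin a b x -> wtin a' b' x.
Proof. by move=> ha hb h n hn; apply: h; lia. Qed.

Lemma wtinD a b x y : wtin a b x -> wtin a b y -> wtin a b (x + y).
Proof. by move=> hx hy n hn; rewrite wtD hx // hy // addr0. Qed.

Lemma wtin0 a b : wtin a b 0.
Proof. by move=> n _; rewrite wt0. Qed.

Lemma wtinZ a b c x : wtin a b x -> wtin a b (c *: x).
Proof. by move=> hx n hn; rewrite wtZ hx // scaler0. Qed.

Lemma wtin_sum a b (I : Type) (s : seq I) (P : pred I) (F : I -> V) :
  (forall i, P i -> wtin a b (F i)) -> wtin a b (\sum_(i <- s | P i) F i).
Proof. by move=> h; elim/big_rec: _ => [|i x /h Fi hx]; [apply: wtin0 | apply: wtinD]. Qed.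

Lemma sg0 i : sg D i 0 = 0.
Proof. by apply: add_zero => x y; apply: sgD. Qed.

Lemma wtin_par i a b x : wtin a b x -> wtin a b (par i x).
Proof.
move=> hx n hn; rewrite /vpar; case: i; last exact: hx.
by rewrite wtD wtN !wt_sg hx // !sg0 subr0.
Qed.

Lemma has_wt_wtin a b n x : a <= n <= b -> has_wt D n x -> wtin a b x.
Proof.
move=> hn hx m hm; rewrite -hx wt_orth; case: eqP => // mn.
by rewrite mn hn in hm.
Qed.

Lemma mode_suml (s : seq int) (F : int -> V) k w :
  md (\sum_(n <- s) F n) k w = \sum_(n <- s) md (F n) k w.
Proof. by elim: s => [|n s IH]; rewrite ?big_nil ?mode0l // !big_cons modeDl IH. Qed.

Lemma mode_sumr u (s : seq int) (F : int -> V) k :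
  md u k (\sum_(n <- s) F n) = \sum_(n <- s) md u k (F n).
Proof. by elim: s => [|n s IH]; rewrite ?big_nil ?mode0r // !big_cons modeDr IH. Qed.

Lemma wtin_mode a b a' b' (k : int) x y : wtin a b x -> wtin a' b' y ->
  wtin (a + a' - k - 2) (b + b' - k - 2) (md x k y).
Proof.
move=> hx hy; have [s _ ->] := wt_sum D x; have [s' _ ->] := wt_sum D y.
rewrite mode_suml; apply: wtin_sum => p _; rewrite mode_sumr; apply: wtin_sum => q _.
have [hp|/hx ->] := boolP (a <= p <= b); last by rewrite mode0l; apply: wtin0.
have [hq|/hy ->] := boolP (a' <= q <= b'); last by rewrite mode0r; apply: wtin0.
by apply: has_wt_wtin (mode_wt _ (wt_proj _ _ _) (wt_proj _ _ _)); lia.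
Qed.

Definition wtinW a b (g : W) := forall o, wtin a b (g o).

Lemma wtinW_scale a b (q : Q) g : wtinW a b g -> wtinW a b (q *: g).
Proof. by move=> hg o; apply: wtin_sum => p _; apply/wtinZ/hg. Qed.

Lemma wtinW_cvec a b w : wtin a b w -> wtinW a b (cvec w).
Proof. by move=> hw o; rewrite /cvec; case: ifP => _ //; apply: wtin0. Qed.

Lemma wtinW_oact a b a' b' (k : int) x g : wtin a b x -> wtinW a' b' g ->
  wtinW (a + a' - k - 2) (b + b' - k - 2) (oact_op D (md x k) g).
Proof. by move=> hx hg o; apply/wtin_par/wtin_mode/wtin_par. Qed.

(** The odd variables lower the weight by one half, so the two halves of a
    vertex operator contribute to a range of weights. *)
Lemma wtinW_ymode a b a' b' psi x (n : int) g : wtin a b x -> wtinW a' b' g ->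
  wtinW (a + a' - 2 * n - 2) (b + b' - 2 * n - 1) (ymode D psi x n g).
Proof.
move=> hx hg o; apply: wtinD.
  by apply: (wtin_sub _ _ (wtinW_oact (k := 2 * n) hx hg o)); lia.
apply: (wtinW_scale psi) => o'.
by apply: (wtin_sub _ _ (wtinW_oact (k := 2 * n - 1) hx hg o')); lia.
Qed.

Variables (v' : {scalar V}) (hv' : graded_dual D v').

Lemma dual_bound : exists S : nat, forall a b x,
  wtin a b x -> S%:Z < a \/ b < - S%:Z -> v' x = 0.
Proof.
have [s hs] := hv'; exists (\max_(n <- s) `|n|%N) => a b x hx hab.
have [t _ ->] := wt_sum D x; rewrite raddf_sum big1 // => n _.
have [hn|/hx ->] := boolP (a <= n <= b); last by rewrite raddf0.
apply: hs (wt_proj _ _ _); apply/negP => ns.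
have : (`|n| <= \max_(n <- s) `|n|)%N by rewrite (big_rem n) //= leq_maxl.
by lia.
Qed.

Lemma Fprod_degree u v w : exists N : nat, forall n m : int,
  (N < `|(n + m)%R|)%N -> forall o, v' (Fprod D u v w n m o) = 0.
Proof.
have [S hS] := dual_bound.
have [A hA] := wtin_exists u; have [B hB] := wtin_exists v; have [K hK] := wtin_exists w.
exists (A + B + K + S + 9)%N => n m hnm o.
have h := wtinW_ymode (qphi1 R L) (n := n) hA
  (wtinW_ymode (qphi2 R L) (n := m) hB (wtinW_cvec hK)) o.
by apply: (hS _ _ _ h); lia.
Qed.

Lemma dualZ (a : Lam) (x : V) : v' (a *: x) = a * v' x.
Proof. exact: scalarZ. Qed.

Lemma dual_scale (q : Q) (g : W) : (forall o, v' (g o) = 0) -> forall o, v' ((q *: g) o) = 0.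
Proof.
move=> h o; rewrite oscaleE /oact; apply: etrans (raddf_sum _ _ _ _) _.
by apply: big1 => p _; apply: etrans (dualZ _ _) _; rewrite h mulr0.
Qed.

Lemma dual_sum (I : Type) (s : seq I) (F : I -> W) : (forall i o, v' (F i o) = 0) ->
  forall o, v' ((\sum_(i <- s) F i) o) = 0.
Proof.
move=> h o; rewrite oser_sum; apply: etrans (raddf_sum _ _ _ _) _.
by apply: big1 => i _; apply: h.
Qed.

Lemma Fiter_degree u v w : exists N : nat, forall n m : int,
  (N < `|(n + m)%R|)%N -> forall o, v' (Fiter D u v w n m o) = 0.
Proof.
have [S hS] := dual_bound.
have [A hA] := wtin_exists u; have [B hB] := wtin_exists v; have [K hK] := wtin_exists w.
exists (A + B + K + S + 9)%N => n m hnm; apply: dual_sum => b; apply: dual_scale => o.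
have h := wtinW_ymode (qphi1 R L - qphi2 R L) (n := n) hA (wtinW_cvec hB) b.
have h' := wtinW_ymode (qphi2 R L) (n := m) h (wtinW_cvec hK) o.
by apply: (hS _ _ _ h'); lia.
Qed.

Lemma smap_neq0 (g : series V) e : (smap v' g e : Q) != 0 ->
  (g e : W) != 0 /\ exists o, v' (g e o) != 0.
Proof.
move=> h; have ex : exists o, v' (g e o) != 0.
  apply: contrapT => ne; case/eqP: h; apply/funext => o.
  by apply/eqP/negPn/negP => ho; apply: ne; exists o.
split=> //; case: ex => o; apply: contraNneq => ge.
have -> : g e o = 0 by exact: (congr1 (fun h : W => h o) ge).
by apply/eqP; apply: raddf0.
Qed.

(** Truncation for [u] and [v] bounds the powers of [x_0] below, weights bound the total degree. *)
Lemma incone_iterate u v w : incone X0 (smap v' (Yiter D md u v w)).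
Proof.
have [N hN] := truncation_nat D u v; have [M hM] := Fiter_degree u v w.
exists (N + M + 9)%N => e /smap_neq0[/(Yiter_supp hN)[e1 e0] [o]].
rewrite -[Yiter _ _ _ _ _ _ _]/((Yiter D md u v w e : W) o) YiterE e1 eqxx => H.
have : (`|((- e X0 - 1) + (- e X2 - 1))%R| <= M)%N.
  by rewrite leqNgt; apply: contraNN H => /hM ->.
by rewrite /cone e1; lia.
Qed.

(** Truncation for [v] and [w] bounds the powers of [x_2] below, weights bound the total degree. *)
Lemma incone_product u v w : incone X2 (smap v' (Yprod D md u v w)).
Proof.
have [N hN] := truncation_nat D v w; have [M hM] := Fprod_degree u v w.
exists (N + M + 9)%N => e; apply: contraNT => H.
apply/eqP/funext => o; rewrite /smap.
rewrite -[Yprod _ _ _ _ _ _ _]/((Yprod D md u v w e : W) o) (YprodE _ hN (leqnn _)).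
case: (eqVneq (e X1) 0) => [e1|_]; last by rewrite raddf0.
apply: dual_sum => n; apply: dual_sum => k {}o.
set c := ocoef _ _ _ _ _ _; have [->|/ocoef_supp[_ hc]] := eqVneq c 0.
  by rewrite scale0r raddf0.
apply: dual_scale => {}o.
have [h|h] := ltrP N%:Z (- (e X2 - k%:Z) - 1).
  by rewrite /Fprod (ymode_trunc (qphi2 R L) hN h) ymode0 raddf0.
apply: hM; move: H; rewrite /cone e1 eqxx /= => H; lia.
Qed.

Lemma bounded_cone i j (f : series Lam) :
  [\/ i = X0 /\ j = X2 | i = X2 /\ j = X0] -> incone i f -> bounded_powers i j f.
Proof.
move=> hij [N hN]; exists (N + N)%:Z => e b fb.
have /hN : (f e : Q) != 0.
  by apply: contraNneq fb => h; apply/eqP/(congr1 (fun q : Q => q b) h).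
by case: hij => -[-> ->]; rewrite /cone; lia.
Qed.

End MatrixCoefficients.

(** * Clearing denominators *)

Lemma mulrn_shift (M : zmodType) (a b : M) k : a - b *+ k - b = a + b - b *+ k.+2.
Proof. by rewrite !mulrS !opprD !addrA addrK addrAC. Qed.

Section Denominators.

Variables (R : realType) (L : option nat).
Local Notation C := R[i].
Local Notation Lam := (grassmann C L).
Local Notation Q := (osa R L).
Local Notation "f ** g" := (@sprod R L f g) (at level 40, left associativity).

Local Notation lplus := (lplus R L).
Definition lminus : @lform R L := (1, 1, -1).
Definition lx0 : @lform R L := (1, 0, 0).
Definition lx2 : @lform R L := (0, 1, 0).

Definition mul_x02 (z : series Lam) : series Lam := fun e =>
  (z (e - xexp X0 1) : Q) + (z (e - xexp X2 1) : Q).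

Definition mul_phi12 (z : series Lam) : series Lam := fun e => qe 1 * (z e : Q).

Lemma mul_x02B z z' : mul_x02 (z - z') = mul_x02 z - mul_x02 z'.
Proof. by apply/funext => e; rewrite serB /mul_x02 !serB addrACA -opprD. Qed.

Lemma mul_phi12B z z' : mul_phi12 (z - z') = mul_phi12 z - mul_phi12 z'.
Proof. by apply/funext => e; rewrite serB /mul_phi12 !serB mulrBr. Qed.

Lemma mul_phi12_x02 z : mul_phi12 (mul_x02 z) = mul_x02 (mul_phi12 z).
Proof. by apply/funext => e; rewrite /mul_phi12 /mul_x02 mulrDr. Qed.

Lemma mul_phi12_phi12 z : mul_phi12 (mul_phi12 z) = 0.
Proof. by apply/funext => e; rewrite /mul_phi12 mulrA qeqe mul0r. Qed.

Lemma lplusE z : lser lplus ** z = mul_x02 z + mul_phi12 z.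
Proof. by apply/funext => e; rewrite lser_mul serD /= !qc1 !mul1r. Qed.

Lemma lminusE z : lser lminus ** z = mul_x02 z - mul_phi12 z.
Proof. by apply/funext => e; rewrite lser_mul serB /= !qc1 !mul1r qeN1 mulNr. Qed.

Lemma mul_x020 : mul_x02 0 = 0.
Proof. by have := mul_x02B 0 0; rewrite !subrr. Qed.

Lemma mul_phi120 : mul_phi12 0 = 0.
Proof. by have := mul_phi12B 0 0; rewrite !subrr. Qed.

Lemma mul_x02D z z' : mul_x02 (z + z') = mul_x02 z + mul_x02 z'.
Proof. by rewrite -[X in z + X]opprK mul_x02B -[- z']sub0r mul_x02B mul_x020 sub0r opprK. Qed.

Lemma mul_phi12D z z' : mul_phi12 (z + z') = mul_phi12 z + mul_phi12 z'.
Proof. by rewrite -[X in z + X]opprK mul_phi12B -[- z']sub0r mul_phi12B mul_phi120 sub0r opprK. Qed.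

(** With [X = x_0 + x_2] and [eps = phi_1 phi_2], both [(X + eps)^n] and [(X - eps)^n]
    are [X^n] up to a multiple of [X^(n-1) eps]. As [eps (X + eps)^t = eps X^t], one
    more factor makes up for the change of sign. *)
Lemma lminus_lplus t (z : series Lam) :
  iter t (sprod (lser lplus)) z = 0 -> iter t.+1 (sprod (lser lminus)) z = 0.
Proof.
move=> h; pose y := iter t mul_x02 (mul_phi12 z).
have yE s : mul_phi12 (iter s (sprod (lser lplus)) z) = iter s mul_x02 (mul_phi12 z).
  by elim: s => [//|s IH]; rewrite iterS lplusE mul_phi12D mul_phi12_x02 mul_phi12_phi12 IH addr0.
have y0 : y = 0 by rewrite /y -yE h mul_phi120.
have Ey s : mul_phi12 (iter s mul_x02 (mul_phi12 z)) = 0.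
  by elim: s => [|s IH]; rewrite ?mul_phi12_phi12 // iterS mul_phi12_x02 IH mul_x020.
(* [k] is [2 (s + 1)], since each factor is [X - eps = (X + eps) - 2 eps] *)
have key s : exists k : nat, iter s.+1 (sprod (lser lminus)) z =
    iter s.+1 (sprod (lser lplus)) z - iter s mul_x02 (mul_phi12 z) *+ k.
  elim: s => [|s [k IH]].
    exists 2; rewrite /= lplusE lminusE mulr2n opprD addrA addrK.
    by [].
  exists k.+2; rewrite iterS IH lminusE mul_x02B mul_phi12B.
  have mX n x : mul_x02 (x *+ n) = mul_x02 x *+ n.
    by elim: n => [|n IHn]; rewrite ?mul_x020 // !mulrS mul_x02D IHn.
  have mE n x : mul_phi12 (x *+ n) = mul_phi12 x *+ n.
    by elim: n => [|n IHn]; rewrite ?mul_phi120 // !mulrS mul_phi12D IHn.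
  rewrite mX mE Ey mul0rn (@subr0 _ (mul_phi12 _)) (yE s.+1).
  rewrite [iter s.+2 _ _]iterS lplusE (yE s.+1) [iter s.+1 mul_x02 _]iterS.
  set A := mul_x02 (iter s.+1 _ z); set B := mul_x02 (iter s mul_x02 (mul_phi12 z)).
  exact: mulrn_shift.
have [k ->] := key t; rewrite -/y y0 mul0rn subr0 iterS h.
by rewrite lplusE mul_x020 mul_phi120 addr0.
Qed.

Lemma body1 : gbody (1 : Lam) != 0.
Proof. by rewrite /gbody gval1 eqxx oner_neq0. Qed.

Lemma in_S_lminus : in_S lminus.
Proof. by split; [apply: gsign1|apply: gsign1|apply/gsignN/gsign1|left; apply: body1]. Qed.

Lemma in_S_lx0 : in_S lx0.
Proof. by split; [apply: gsign1|apply: gsign0|apply: gsign0|left; apply: body1]. Qed.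

Lemma in_S_lx2 : in_S lx2.
Proof. by split; [apply: gsign0|apply: gsign1|apply: gsign0|right; apply: body1]. Qed.

Definition denoms (r t : nat) : seq (@lform R L) :=
  nseq r lx0 ++ (nseq r lx2 ++ nseq t lminus).

Lemma denoms_in_S r t : all_in_S (denoms r t).
Proof.
move=> l; rewrite !mem_cat => /or3P[] /nseqP[-> _];
  [exact: in_S_lx0 | exact: in_S_lx2 | exact: in_S_lminus].
Qed.

Lemma foldr_nseq (T S : Type) (f : T -> S -> S) x l n : foldr f x (nseq n l) = iter n (f l) x.
Proof. by elim: n => [//|n IH] /=; rewrite IH. Qed.

Lemma lx0_iter r f e : (iter r (sprod (lser lx0)) f e : Q) = f (e - xexp X0 r%:Z).
Proof.
elim: r e => [|r IH] e; first by rewrite xexp0 subr0.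
rewrite iterS lser_mul /= qc1 /qc /qe !qm0 !mul0r !addr0 mul1r IH.
by congr (f _); apply: expoP; rewrite !expoE /=; lia.
Qed.

Lemma lx2_iter r f e : (iter r (sprod (lser lx2)) f e : Q) = f (e - xexp X2 r%:Z).
Proof.
elim: r e => [|r IH] e; first by rewrite xexp0 subr0.
rewrite iterS lser_mul /= qc1 /qc /qe !qm0 !mul0r !addr0 add0r mul1r IH.
by congr (f _); apply: expoP; rewrite !expoE /=; lia.
Qed.

Lemma lprod_denoms r t f : lprod (denoms r t) ** f =
  iter r (sprod (lser lx0)) (iter r (sprod (lser lx2)) (iter t (sprod (lser lminus)) f)).
Proof.
rewrite (proj2 (lprod_mul f (all_in_S_even (@denoms_in_S r t)))) /denoms.
by rewrite !foldr_cat !foldr_nseq.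
Qed.

(** Once the power of [x_0 + x_2 - phi_1 phi_2] is applied the two series are equal, so their
    common value has finitely many negative powers of [x_0] and of [x_2] and bounded
    degree, and a monomial turns it into a polynomial. *)
Lemma clear_denominators t (f g : series Lam) : incone X0 f -> incone X2 g ->
  iter t (sprod (lser lplus)) (g - f) = 0 ->
  exists r s, superpoly (lprod (denoms r.+1 s.+1) ** f) /\
    lprod (denoms r.+1 s.+1) ** g = lprod (denoms r.+1 s.+1) ** f.
Proof.
move=> hf hg /lminus_lplus gf.
have iterB n (z z' : series Lam) : iter n (sprod (lser lminus)) (z - z') =
    iter n (sprod (lser lminus)) z - iter n (sprod (lser lminus)) z'.
  by elim: n => [//|n IH]; rewrite !iterS IH sprodBr //; apply: lser_fsupp.
have ic i n z : x02 i -> incone i z -> incone i (iter n (sprod (lser lminus)) z).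
  by move=> hi hz; elim: n => [//|n IH]; rewrite iterS; apply: incone_lser_mul.
have {gf} E : iter t.+1 (sprod (lser lminus)) g = iter t.+1 (sprod (lser lminus)) f.
  by apply/eqP; rewrite -subr_eq0 -iterB gf.
have [N hN] := ic X0 t.+1 f (or_introl erefl) hf.
have [M hM] := ic X2 t.+1 g (or_intror erefl) hg.
(* exponents start at [- N] for [x_0] and at [- M] for [x_2] *)
exists (N + M)%N, t; rewrite !lprod_denoms E; split=> //.
set p := iter t.+1 _ f in E hN *; rewrite E in hM.
exists (N + M + N + M + N + M + 4)%N => e b.
set q := iter _ _ _; have -> : q e b = (p (e - xexp X0 (N + M).+1%:Z - xexp X2 (N + M).+1%:Z) : Q) b.
  by rewrite /q -(lx2_iter _ p) -lx0_iter.
have [->|pe] := eqVneq (p (e - xexp X0 (N + M).+1%:Z - xexp X2 (N + M).+1%:Z) : Q) 0.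
  by rewrite eqxx.
move=> _; have := hN _ pe; have := hM _ pe; rewrite /cone !expoE /= => h1 h2.
by split; lia.
Qed.

Lemma mul_const1 f : f ** const 1 = f.
Proof. by apply/funext => e; rewrite constE mul_qmono subr0 qc1 mulr1. Qed.

Lemma smap_iter (V : lmodType Lam) (v' : {scalar V}) t (z : series V) :
  smap v' (iter t (smul (lser lplus)) z) = iter t (sprod (lser lplus)) (smap v' z).
Proof.
elim: t => [//|t IH]; rewrite !iterS -IH.
apply: (@smul_map _ _ _ Lam^o); [exact: raddfD|exact: scalarZ|exact: lser_fsupp].
Qed.

Lemma iota20_lprod d f : all_in_S d -> incone X0 f -> iota20 (lprod d ** f, d) = f.
Proof. by move=> hd; apply: (expansion_lprod (or_introl erefl) (@iota20_inverse R L)). Qed.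

Lemma iota02_lprod d f : all_in_S d -> incone X2 f -> iota02 (lprod d ** f, d) = f.
Proof. by move=> hd; apply: (expansion_lprod (or_intror erefl) (@iota02_inverse R L)). Qed.

Lemma lprod_iota20 (h : superfrac R L) : is_frac h ->
  lprod h.2 ** iota20 (frac_subst h) = ssubst h.1.
Proof.
move=> [ph dh]; apply: (lprod_expansion (or_introl erefl) (@iota20_inverse R L)) => //.
exact/incone_superpoly/superpoly_ssubst.
Qed.

Lemma lprodCA d d' f : evens d -> evens d' ->
  lprod d ** (lprod d' ** f) = lprod d' ** (lprod d ** f).
Proof.
move=> ed ed'; rewrite (proj2 (lprod_mul _ ed)) [in RHS](proj2 (lprod_mul _ ed')).
rewrite (proj2 (lprod_mul f ed)) (proj2 (lprod_mul f ed')).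
elim: d ed => [//|l d IH] ed /=.
rewrite IH; last by move=> k kd; apply: ed; rewrite inE kd orbT.
have el : even_lform l by apply: ed; rewrite inE eqxx.
move: (foldr _ f d) => g; elim: d' {ed' IH} => [//|l' d' IH'] /=.
by rewrite lserCA // IH'.
Qed.

(** Multiplying the common expansion by either denominator recovers that numerator,
    so the cross products agree. *)
Lemma iota20_inj (h h' : superfrac R L) : is_frac h -> is_frac h' ->
  iota20 (frac_subst h) = iota20 (frac_subst h') -> frac_eq h' h.
Proof.
move=> fh fh' e; exists [::]; split=> //; rewrite const1_mul.
have [ed ed'] := (all_in_S_even fh.2, all_in_S_even fh'.2).
apply/eqP; rewrite subr_eq0; apply/eqP/ssubst_inj.
rewrite !ssubst_lprod // -(lprod_iota20 fh) -(lprod_iota20 fh') -e.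
exact: lprodCA.
Qed.

Lemma frac_eq_refl (h : superfrac R L) : frac_eq h h.
Proof. by exists [::]; split=> //; rewrite subrr const1_mul. Qed.

Lemma pole_frac_denoms (p : series Lam) r s :
  pole_frac p r.+1%:Z r.+1%:Z s.+1%:Z = (p, denoms r.+1 s.+1).
Proof. by rewrite /pole_frac /frac_mul /= !const1_mul mul_const1. Qed.

End Denominators.

Theorem proposition9p2 (R : realType) (L : option nat)
    (V : lmodType (grassmann R[i] L)) (D : ns_vosa V)
    (u v w : V) (v' : {scalar V}) (hv' : graded_dual D v') :
  let iterate := smap v' (Yiter D (mode D) u v w) in
  let product := smap v' (Yprod D (mode D) u v w) in
  bounded_powers X0 X2 iterate /\
  bounded_powers X2 X0 product /\
  exists h : superfrac R L,
    [/\ is_frac h,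
        iterate = iota20 (frac_subst h),
        (forall h' : superfrac R L, is_frac h' ->
           iterate = iota20 (frac_subst h') -> frac_eq h' h),
        (exists (k : series (grassmann R[i] L)) (r s t : int), superpoly k /\
           frac_eq (frac_subst h) (pole_frac (ssubst k) r s t))
      & product = iota02 (frac_subst h)].
Proof.
move=> iterate product.
have ci : incone X0 iterate by apply: incone_iterate.
have cp : incone X2 product by apply: incone_product.
split; first by apply: bounded_cone ci; left.
split; first by apply: bounded_cone cp; right.
have [t zt] := weak_associativity D u v w.
have z0 : iter t (sprod (lser (lplus R L))) (product - iterate) = 0.
  have -> : product - iterate = smap v' (defect D u v w).
    apply/funext => e; apply/funext => b.
    by rewrite /smap /defect; apply/esym/raddfB.
  rewrite -smap_iter (_ : iter t _ _ = 0) //.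
  by apply/funext => e; apply/funext => b; apply: raddf0.
have [r [s [pk pe]]] := clear_denominators ci cp z0.
have dS := @denoms_in_S R L r.+1 s.+1; set d := denoms R L r.+1 s.+1 in pk pe dS *.
pose h : superfrac R L := (ssubst_inv (sprod (lprod d) iterate), d).
have fh : is_frac h by split=> //; apply: superpoly_ssubst_inv.
have hE : frac_subst h = (sprod (lprod d) iterate, d) by rewrite /frac_subst ssubst_invK.
have ih : iota20 (frac_subst h) = iterate by rewrite hE iota20_lprod.
exists h; split=> //.
- by move=> h' fh' eh'; apply: iota20_inj; rewrite // ih.
- exists h.1, r.+1%:Z, r.+1%:Z, s.+1%:Z; split; first exact: fh.1.
  by rewrite pole_frac_denoms; apply: frac_eq_refl.
by rewrite hE -pe iota02_lprod.
Qed.
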